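(* Let $k\ge2$ and $1\leq n\leq\omega$, and let $\mathbb{F}_k(n)$ be the quotient-poset of $(\mathcal{F}_k(n);\leq^* )$. If $k=2$ then the first-order theory of $\mathbb{F}_k(n)$ is decidable; otherwise it is undecidable and, moreover, computably isomorphic to first-order arithmetic (the set of first-order sentences true in $(\mathbb N;+,\cdot)$).
   Context: For a preorder $Q$, a $Q$-tree is a finite nonempty poset with a least element in which every lower cone is a chain, with a labeling $c$ into $Q$; $(P,c)\le_h(P',c')$ iff there is a monotone $\varphi:P\to P'$ with $c(x)\le c'(\varphi(x))$ for all $x$. Let $\bar k=\{0,\dots,k-1\}$ as an antichain, $\mathcal T_k(0)=\bar k$ and $\mathcal T_k(m+1)$ = the set of $\mathcal T_k(m)$-trees with $\le_h$. Embed $\mathcal T_k(m)$ into $\mathcal T_k(m+1)$ by $e_0(i)=$ the one-node tree labeled $i$, and $e_{m+1}(T,t)=(T,e_m\circ t)$; $\mathcal T_k(\omega)$ is the direct limit (union) of $\mathcal T_k(0)\subseteq\mathcal T_k(1)\subseteq\cdots$ under these identifications, with the induced preorder $\le_h$. For $1\le n\le\omega$, $\mathcal F_k(n)$ is the set of nonempty finite subsets of $\mathcal T_k(n)$, preordered by $S\le^*R$ iff every $s\in S$ satisfies $s\le_h r$ for some $r\in R$. *)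

(* Defs.v *)
From Stdlib Require Import List PeanoNat.
From mathcomp Require Import all_boot.

Set Implicit Arguments.
Unset Strict Implicit.
Unset Printing Implicit Defensive.

Record QTree (Q : Type) : Type := {
  qt_car : finType;
  qt_le : qt_car -> qt_car -> Prop;
  qt_refl : forall x, qt_le x x;
  qt_antisym : forall x y, qt_le x y -> qt_le y x -> x = y;
  qt_trans : forall x y z, qt_le x y -> qt_le y z -> qt_le x z;
  qt_root : qt_car;
  qt_root_least : forall x, qt_le qt_root x;
  qt_cone_chain : forall x y z, qt_le y x -> qt_le z x -> qt_le y z \/ qt_le z y;
  qt_lab : qt_car -> Q }.

Definition hle (Q : Type) (Qle : Q -> Q -> Prop) (T T' : QTree Q) : Prop :=
  exists phi : qt_car T -> qt_car T',
    (forall x y, qt_le x y -> qt_le (phi x) (phi y)) /\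
    (forall x, Qle (qt_lab x) (qt_lab (phi x))).

Definition single_tree (Q : Type) (q : Q) : QTree Q :=
  @Build_QTree Q unit (fun _ _ => True) (fun _ => I)
    (fun x y _ _ => match x, y with tt, tt => erefl end)
    (fun _ _ _ _ _ => I) tt (fun _ => I) (fun _ _ _ _ _ => or_introl I)
    (fun _ => q).

Definition relabel (Q Q' : Type) (f : Q -> Q') (T : QTree Q) : QTree Q' :=
  @Build_QTree Q' (qt_car T) (@qt_le Q T) (@qt_refl Q T) (@qt_antisym Q T)
    (@qt_trans Q T) (qt_root T) (@qt_root_least Q T) (@qt_cone_chain Q T)
    (fun x => f (qt_lab x)).

Fixpoint Tk (k m : nat) : Type :=
  match m with
  | 0 => 'I_k
  | m'.+1 => QTree (Tk k m')
  end.

Fixpoint Tle (k m : nat) : Tk k m -> Tk k m -> Prop :=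
  match m return Tk k m -> Tk k m -> Prop with
  | 0 => fun i j => i = j
  | m'.+1 => @hle (Tk k m') (@Tle k m')
  end.

Fixpoint emb (k m : nat) : Tk k m -> Tk k m.+1 :=
  match m return Tk k m -> Tk k m.+1 with
  | 0 => fun i => single_tree i
  | m'.+1 => fun T => relabel (@emb k m') T
  end.

Fixpoint lift (k m d : nat) : Tk k m -> Tk k (Nat.add d m) :=
  match d return Tk k m -> Tk k (Nat.add d m) with
  | 0 => fun t => t
  | d'.+1 => fun t => @emb k (Nat.add d' m) (@lift k m d' t)
  end.

(* T_k(omega): the direct limit; an element is an element of some T_k(m);
   two elements are compared after embedding both into a common level. *)
Definition Tomega (k : nat) : Type := {m : nat & Tk k m}.

Definition Tomega_le (k : nat) (x y : Tomega k) : Prop :=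
  @Tle k (Nat.add (projT1 y) (projT1 x))
    (@lift k (projT1 x) (projT1 y) (projT2 x))
    (eq_rect _ (Tk k) (@lift k (projT1 y) (projT1 x) (projT2 y)) _
       (Nat.add_comm (projT1 x) (projT1 y))).

Inductive onat : Type := | ofin of nat | oomega.

Definition Tn (k : nat) (n : onat) : Type :=
  match n with ofin m => Tk k m | oomega => Tomega k end.

Definition Tn_le (k : nat) (n : onat) : Tn k n -> Tn k n -> Prop :=
  match n return Tn k n -> Tn k n -> Prop with
  | ofin m => @Tle k m
  | oomega => @Tomega_le k
  end.

Definition fin_nonempty (X : Type) (S : X -> Prop) : Prop :=
  exists l : list X, l <> nil /\ forall x, S x <-> List.In x l.

Definition Fk (k : nat) (n : onat) : Type :=
  {S : Tn k n -> Prop | fin_nonempty S}.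

Definition Fk_le (k : nat) (n : onat) (S R : Fk k n) : Prop :=
  forall s, proj1_sig S s -> exists r, proj1_sig R r /\ @Tn_le k n s r.

Definition quot (X : Type) (le : X -> X -> Prop) : Type :=
  {A : X -> Prop | exists x, forall y, A y <-> (le x y /\ le y x)}.

Definition quot_le (X : Type) (le : X -> X -> Prop) (A B : quot le) : Prop :=
  exists x y, proj1_sig A x /\ proj1_sig B y /\ le x y.

Definition FFk (k : nat) (n : onat) : Type := quot (@Fk_le k n).
Definition FFk_le (k : nat) (n : onat) : FFk k n -> FFk k n -> Prop :=
  @quot_le (Fk k n) (@Fk_le k n).

Definition scons (X : Type) (x : X) (rho : nat -> X) : nat -> X :=
  fun i => match i with 0 => x | i'.+1 => rho i' end.

(* language of posets: one binary relation symbol <=, plus equality;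
   variables are de Bruijn indices *)
Inductive pform : Type :=
| PLe of nat & nat
| PEq of nat & nat
| PNot of pform
| PAnd of pform & pform
| POr of pform & pform
| PImp of pform & pform
| PAll of pform
| PEx of pform.

Fixpoint psat (X : Type) (R : X -> X -> Prop) (rho : nat -> X) (f : pform)
  : Prop :=
  match f with
  | PLe i j => R (rho i) (rho j)
  | PEq i j => rho i = rho j
  | PNot a => ~ psat R rho a
  | PAnd a b => psat R rho a /\ psat R rho b
  | POr a b => psat R rho a \/ psat R rho b
  | PImp a b => psat R rho a -> psat R rho b
  | PAll a => forall x, psat R (scons x rho) a
  | PEx a => exists x, psat R (scons x rho) a
  end.

Fixpoint pbound (n : nat) (f : pform) : Prop :=
  match f with
  | PLe i j | PEq i j => i < n /\ j < n
  | PNot a => pbound n a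
  | PAnd a b | POr a b | PImp a b => pbound n a /\ pbound n b
  | PAll a | PEx a => pbound n.+1 a
  end.

Inductive aterm : Type :=
| AVar of nat
| AAdd of aterm & aterm
| AMul of aterm & aterm.

Inductive aform : Type :=
| AEq of aterm & aterm
| ANot of aform
| AAnd of aform & aform
| AOr of aform & aform
| AImp of aform & aform
| AAll of aform
| AEx of aform.

Fixpoint aeval (rho : nat -> nat) (t : aterm) : nat :=
  match t with
  | AVar i => rho i
  | AAdd u v => Nat.add (aeval rho u) (aeval rho v)
  | AMul u v => Nat.mul (aeval rho u) (aeval rho v)
  end.

Fixpoint asat (rho : nat -> nat) (f : aform) : Prop :=
  match f with
  | AEq t u => aeval rho t = aeval rho u
  | ANot a => ~ asat rho a
  | AAnd a b => asat rho a /\ asat rho b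
  | AOr a b => asat rho a \/ asat rho b
  | AImp a b => asat rho a -> asat rho b
  | AAll a => forall x, asat (scons x rho) a
  | AEx a => exists x, asat (scons x rho) a
  end.

Fixpoint tbound (n : nat) (t : aterm) : Prop :=
  match t with
  | AVar i => i < n
  | AAdd u v | AMul u v => tbound n u /\ tbound n v
  end.

Fixpoint abound (n : nat) (f : aform) : Prop :=
  match f with
  | AEq t u => tbound n t /\ tbound n u
  | ANot a => abound n a
  | AAnd a b | AOr a b | AImp a b => abound n a /\ abound n b
  | AAll a | AEx a => abound n.+1 a
  end.

(* Goedel numbering via the Cantor pairing function *)
Definition cpair (x y : nat) : nat :=
  Nat.add (Nat.div (Nat.mul (Nat.add x y) (Nat.add (Nat.add x y) 1)) 2) y.

Fixpoint pcode (f : pform) : nat :=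
  match f with
  | PLe i j => cpair 0 (cpair i j)
  | PEq i j => cpair 1 (cpair i j)
  | PNot a => cpair 2 (pcode a)
  | PAnd a b => cpair 3 (cpair (pcode a) (pcode b))
  | POr a b => cpair 4 (cpair (pcode a) (pcode b))
  | PImp a b => cpair 5 (cpair (pcode a) (pcode b))
  | PAll a => cpair 6 (pcode a)
  | PEx a => cpair 7 (pcode a)
  end.

Fixpoint tcode (t : aterm) : nat :=
  match t with
  | AVar i => cpair 0 i
  | AAdd u v => cpair 1 (cpair (tcode u) (tcode v))
  | AMul u v => cpair 2 (cpair (tcode u) (tcode v))
  end.

Fixpoint acode (f : aform) : nat :=
  match f with
  | AEq t u => cpair 0 (cpair (tcode t) (tcode u))
  | ANot a => cpair 1 (acode a)
  | AAnd a b => cpair 2 (cpair (acode a) (acode b))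
  | AOr a b => cpair 3 (cpair (acode a) (acode b))
  | AImp a b => cpair 4 (cpair (acode a) (acode b))
  | AAll a => cpair 5 (acode a)
  | AEx a => cpair 6 (acode a)
  end.

Definition Th_poset (X : Type) (R : X -> X -> Prop) : nat -> Prop :=
  fun c => exists f, pbound 0 f /\ pcode f = c /\ forall rho, psat R rho f.

Definition Th_arith : nat -> Prop :=
  fun c => exists f, abound 0 f /\ acode f = c /\ forall rho, asat rho f.

Inductive rf : Type :=
| RZero
| RSucc
| RProj of nat
| RComp of rf & list rf
| RPrim of rf & rf
| RMu of rf.

Inductive ev : rf -> list nat -> nat -> Prop :=
| evZero v : ev RZero v 0
| evSucc v : ev RSucc v (nth 0 v 0).+1
| evProj i v : ev (RProj i) v (nth 0 v i)
| evComp f gs v ys y : evs gs v ys -> ev f ys y -> ev (RComp f gs) v y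
| evPrim0 f g v y : ev f v y -> ev (RPrim f g) (0 :: v) y
| evPrimS f g n v z y :
    ev (RPrim f g) (n :: v) z -> ev g (n :: z :: v) y ->
    ev (RPrim f g) (n.+1 :: v) y
| evMu f v n :
    ev f (n :: v) 0 -> (forall m, m < n -> exists y, ev f (m :: v) y.+1) ->
    ev (RMu f) v n
with evs : list rf -> list nat -> list nat -> Prop :=
| evsNil v : evs nil v nil
| evsCons g gs v y ys : ev g v y -> evs gs v ys -> evs (g :: gs) v (y :: ys).

Definition computable (h : nat -> nat) : Prop :=
  exists r : rf, forall x, ev r [:: x] (h x).

Definition decidable_set (A : nat -> Prop) : Prop :=
  exists r : rf, forall x, (A x -> ev r [:: x] 1) /\ (~ A x -> ev r [:: x] 0).

Definition comp_iso (A B : nat -> Prop) : Prop :=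
  exists h g : nat -> nat,
    [/\ computable h, computable g, cancel h g, cancel g h &
        forall x, A x <-> B (h x)].

(* Main.v *)
Require Import Defs.
From HB Require Import structures.
From mathcomp Require Import all_boot zify boolp.

(** A finite nonempty set of iterated trees is an iterated forest up to equivalence, and the
    order of forests is decidable by recursion; this reduces the theory to arithmetic. If
    [k > 2], the joins of the two alternating chains of length [i] with labels [a] and [b] form a
    definable copy of the natural numbers, and a third label [c] gives a second copy. One forest
    codes the region below the graph of any decreasing function from an initial segment of the
    first copy to the second, as a union of rectangles; the functions [i |-> x + (y - i)] and
    [i |-> x * (y - i)] then define addition and multiplication. Padding makes both reductions
    injective and increasing, and Myhill's theorem applies.

    If [k = 2], a forest is determined by an ordinal in nested Cantor normal form and a nonempty
    set of two signs, with order lexicographic in the two. The ordinals that occur are closed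
    under changing any one coefficient of a finite power of omega (of [omega^0] if [n = 1]), so
    in Ehrenfeucht games they cannot be told apart from the sequences of natural numbers with
    finitely many nonzero terms, and there a quantifier may be bounded computably in terms of
    the elements already chosen and the number of remaining rounds. *)

Set Implicit Arguments.
Unset Strict Implicit.
Unset Printing Implicit Defensive.

(** * Computable functions *)

(** A forest dominates everything below its trees, so the relation that one element codes between
    the two copies is closed downwards; hence sum and product are read off decreasing functions. A
    rectangle is a single tree: above a root labelled [a] stand a chain alternating [b] and [a] and
    a chain alternating [c] and [a], and the label shared by the two copies lets the root serve
    both. The obstacle to defining a copy is that from level 2 on a label may be a tree that
    contains both [a] and [b]; a single node with such a label lies above all alternating chains. An
    order property excludes it: every nonminimal irreducible element below a number has a greatest
    element strictly below it, which fails for the node labelled by a two-element chain.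

    With two labels an ordinal appears because a new root is either absorbed or moves the forest to
    the next multiple of a power of omega. In a game of [r] rounds only the [r] lowest coefficients
    count for more than their order, each up to a power of two, so terms with large exponents are
    compared only as a whole and need no description. *)

Definition cmp n (f : (nat -> nat) -> nat) :=
  exists r : rf, forall rho, ev r (mkseq rho n) (f rho).

Notation C1 f := (cmp 1 (fun r => f (r 0))).
Notation C2 f := (cmp 2 (fun r => f (r 0) (r 1))).
Notation C3 f := (cmp 3 (fun r => f (r 0) (r 1) (r 2))).
Notation C4 f := (cmp 4 (fun r => f (r 0) (r 1) (r 2) (r 3))).

Lemma mkseqS (rho : nat -> nat) n :
  mkseq rho n.+1 = rho 0 :: mkseq (fun i => rho i.+1) n.
Proof. by rewrite /mkseq /= -[1]/(1 + 0) iotaDl -map_comp. Qed.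

Lemma cmp_ext n f g : f =1 g -> cmp n f -> cmp n g.
Proof. by move=> fg [r hr]; exists r => rho; rewrite -fg. Qed.

Lemma cmp_var n i : i < n -> cmp n (fun r => r i).
Proof.
by move=> lt_in; exists (RProj i) => rho; have := evProj i (mkseq rho n); rewrite nth_mkseq.
Qed.

(** Environments stand for argument lists of every length, and only the first entries reach the
    program; substitution therefore involves no vectors. *)
Lemma cmp_comp n m f (gs : nat -> (nat -> nat) -> nat) :
  cmp m f -> (forall i, i < m -> cmp n (gs i)) -> cmp n (fun r => f (fun i => gs i r)).
Proof.
move=> [r hr] hg.
have [l hl] : exists l, forall rho, evs l (mkseq rho n) (mkseq (fun i => gs i rho) m).
  clear r hr; elim: m gs hg => [|m IH] gs hg; first by exists nil => rho; apply: evsNil.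
  have [r0 h0] := hg 0 (ltn0Sn m).
  have [l hl] := IH (fun i => gs i.+1) (fun i => hg i.+1).
  by exists (r0 :: l) => rho; rewrite mkseqS; apply: evsCons.
by exists (RComp r l) => rho; apply: evComp (hl rho) (hr _).
Qed.

Lemma cmp_comp1 n f a : C1 f -> cmp n a -> cmp n (fun r => f (a r)).
Proof. by move=> hf ha; apply: (cmp_comp (gs := fun _ => a) hf) => -[]. Qed.

Lemma cmp_comp2 n f a b : C2 f -> cmp n a -> cmp n b -> cmp n (fun r => f (a r) (b r)).
Proof.
by move=> hf ha hb; apply: (cmp_comp (gs := fun i => if i is 0 then a else b) hf) => -[|[]].
Qed.

Lemma cmp_comp3 n f a b c : C3 f -> cmp n a -> cmp n b -> cmp n c ->
  cmp n (fun r => f (a r) (b r) (c r)).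
Proof.
move=> hf ha hb hc.
by apply: (cmp_comp (gs := fun i => match i with 0 => a | 1 => b | _ => c end) hf) => -[|[|[]]].
Qed.

Lemma cmp_comp4 n f a b c d : C4 f -> cmp n a -> cmp n b -> cmp n c -> cmp n d ->
  cmp n (fun r => f (a r) (b r) (c r) (d r)).
Proof.
move=> hf ha hb hc hd.
by apply: (cmp_comp (gs := fun i => match i with 0 => a | 1 => b | 2 => c | _ => d end) hf)
  => -[|[|[|[]]]].
Qed.

Lemma cmp_S n a : cmp n a -> cmp n (fun r => (a r).+1).
Proof. by apply: cmp_comp1; exists RSucc => rho; apply: (evSucc (mkseq rho 1)). Qed.

Lemma cmp_const n c : cmp n (fun=> c).
Proof.
elim: c => [|c IH]; last exact: cmp_S.
by exists RZero => rho; apply: evZero.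
Qed.

Lemma cmp_rec n a g m : cmp n a -> cmp n.+2 (fun r => g (fun i => r i.+2) (r 0) (r 1)) -> cmp n m ->
  cmp n (fun r => nat_rect (fun=> nat) (a r) (g r) (m r)).
Proof.
move=> [ra ha] [rg hg] [rm hm].
have [l hl] : exists l, forall rho, evs l (mkseq rho n) (mkseq rho n).
  have [l hl] : exists l, forall rho, evs l (mkseq rho n) [seq rho i | i <- iota 0 n].
    have : {subset iota 0 n <= iota 0 n} by [].
    elim: {1 3}(iota 0 n) => [|i s IH] sub; first by exists nil => rho; apply: evsNil.
    have [|l hl] := IH; first by move=> x xs; apply: sub; rewrite inE xs orbT.
    have /cmp_var [r hr] : i < n by have := sub i (mem_head _ _); rewrite mem_iota.
    by exists (r :: l) => rho; apply: evsCons.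
  by exists l.
exists (RComp (RPrim ra rg) (rm :: l)) => rho.
apply: evComp (evsCons (hm rho) (hl rho)) _.
elim: (m rho) => [|i IH] /=; first exact: evPrim0.
apply: evPrimS IH _.
have := hg (fun i0 => match i0 with 0 => i | 1 => nat_rect (fun=> nat) (a rho) (g rho) i
                              | j.+2 => rho j end).
by rewrite !mkseqS.
Qed.

Create HintDb cdb.

Ltac csolve := solve [eauto with cdb nocore].

Ltac cstep := cbv beta;
  match goal with
  | |- cmp ?n (fun r => r ?i) => exact (@cmp_var n i isT)
  | |- cmp ?n (fun _ => ?c) => exact (cmp_const n c)
  | |- cmp ?n (fun r => S (@?a r)) => apply (@cmp_S n a)
  | |- cmp ?n (fun r => nat_rect (fun=> nat) (@?a r) (@?g r) (@?m r)) =>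
      apply (@cmp_rec n a g m)
  | |- cmp ?n (fun r => nat_of_bool (?f (@?a r) (@?b r))) =>
      apply (@cmp_comp2 n (fun x y => nat_of_bool (f x y)) a b); [csolve| |]
  | |- cmp ?n (fun r => nat_of_bool (?f (@?a r))) =>
      apply (@cmp_comp1 n (fun x => nat_of_bool (f x)) a); [csolve|]
  | |- cmp ?n (fun r => ?f (@?a r) (@?b r) (@?c r) (@?d r)) =>
      apply (@cmp_comp4 n f a b c d); [csolve| | | |]
  | |- cmp ?n (fun r => ?f (@?a r) (@?b r) (@?c r)) => apply (@cmp_comp3 n f a b c); [csolve| | |]
  | |- cmp ?n (fun r => ?f (@?a r) (@?b r)) => apply (@cmp_comp2 n f a b); [csolve| |]
  | |- cmp ?n (fun r => ?f (@?a r)) => apply (@cmp_comp1 n f a); [csolve|]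
  end.

(** * Arithmetic, Boolean operations and bounded search *)

Lemma C_add : C2 addn.
Proof.
apply: (cmp_ext (f := fun r => nat_rect (fun=> nat) (r 1) (fun _ a => a.+1) (r 0))).
  by move=> r; elim: (r 0) => //= m ->.
by repeat cstep.
Qed.

Lemma C_pred : C1 predn.
Proof.
apply: (cmp_ext (f := fun r => nat_rect (fun=> nat) 0 (fun i _ => i) (r 0))).
  by move=> r; case: (r 0).
by repeat cstep.
Qed.

Lemma C_sub : C2 subn.
Proof.
apply: (cmp_ext (f := fun r => nat_rect (fun=> nat) (r 0) (fun _ a => a.-1) (r 1))).
  by move=> r; elim: (r 1) => /= [|m ->]; rewrite ?subn0 ?subnS.
by have hpred := C_pred; repeat cstep.
Qed.

Lemma cmp_if n (b : (nat -> nat) -> bool) x y : cmp n b -> cmp n x -> cmp n y ->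
  cmp n (fun r => if b r then x r else y r).
Proof.
move=> hb hx hy.
apply: (cmp_ext (f := fun r => nat_rect (fun=> nat) (y r) (fun _ _ => x r) (b r))).
  by move=> r; case: (b r).
apply: cmp_rec => //.
by apply: (cmp_comp (gs := fun i r => r i.+2) hx) => i lt_in; apply: cmp_var; rewrite !ltnS.
Qed.

Lemma cmp_and n (b c : (nat -> nat) -> bool) : cmp n b -> cmp n c -> cmp n (fun r => b r && c r).
Proof.
move=> hb hc; apply: (cmp_ext (f := fun r => if b r then nat_of_bool (c r) else 0)).
  by move=> r; case: (b r).
by apply: cmp_if => //; cstep.
Qed.

Lemma cmp_or n (b c : (nat -> nat) -> bool) : cmp n b -> cmp n c -> cmp n (fun r => b r || c r).
Proof.
move=> hb hc; apply: (cmp_ext (f := fun r => if b r then 1 else nat_of_bool (c r))).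
  by move=> r; case: (b r).
by apply: cmp_if => //; cstep.
Qed.

Lemma cmp_not n (b : (nat -> nat) -> bool) : cmp n b -> cmp n (fun r => ~~ b r).
Proof.
move=> hb; apply: (cmp_ext (f := fun r => if b r then 0 else 1)).
  by move=> r; case: (b r).
by apply: cmp_if => //; cstep.
Qed.

Lemma C_leq : C2 leq.
Proof.
apply: (cmp_ext (f := fun r => 1 - (r 0 - r 1))).
  by move=> r; rewrite /leq; case: (r 0 - r 1) => // m; rewrite subSS sub0n.
by have hsub := C_sub; repeat cstep.
Qed.

Lemma C_eq : C2 eq_op.
Proof.
apply: (cmp_ext (f := fun r => (r 0 <= r 1) && (r 1 <= r 0))).
  by move=> r; rewrite eqn_leq.
by have hle := C_leq; apply: cmp_and; repeat cstep.
Qed.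

#[export] Hint Resolve C_add C_pred C_sub C_leq C_eq : cdb.

Ltac ctac := repeat (cbv beta;
  lazymatch goal with
  | |- cmp ?n (fun r => match @?b r with true => @?x r | false => @?y r end) =>
      apply (@cmp_if n b x y)
  | |- cmp ?n (fun r => nat_of_bool (andb (@?b r) (@?c r))) => apply (@cmp_and n b c)
  | |- cmp ?n (fun r => nat_of_bool (orb (@?b r) (@?c r))) => apply (@cmp_or n b c)
  | |- cmp ?n (fun r => nat_of_bool (negb (@?b r))) => apply (@cmp_not n b)
  | |- _ => first [solve [eauto with cdb nocore] | cstep]
  end).

Definition bex (p : nat -> bool) (m : nat) : bool :=
  0 < nat_rect (fun=> nat) 0 (fun i acc => p i + acc) m.

Lemma bexP (p : nat -> bool) m : reflect (exists2 i, i < m & p i) (bex p m).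
Proof.
rewrite /bex; elim: m => [|m IH] /=; first by apply: ReflectF => -[].
case pm: (p m) => /=; first by apply: ReflectT; exists m.
apply: (iffP IH) => -[i lt_i pi]; exists i => //; first exact: ltnW.
move: lt_i; rewrite ltnS leq_eqVlt => /orP [/eqP ei|//].
by rewrite ei pm in pi.
Qed.

Lemma cmp_bex n (p : (nat -> nat) -> nat -> bool) m : cmp n.+1 (fun r => p (fun i => r i.+1) (r 0)) -> cmp n m ->
  cmp n (fun r => bex (p r) (m r)).
Proof.
move=> hp hm; rewrite /bex; ctac.
rewrite -/(cmp n.+2 (fun r => nat_of_bool (p (fun i => r i.+2) (r 0)))).
have := @cmp_comp n.+2 n.+1 _ (fun i r => if i is 0 then r 0 else r i.+1) hp.
by apply=> -[|i] lt_in; apply: cmp_var.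
Qed.

(** * Cantor pairing and its projections *)

Fixpoint tri n := if n is m.+1 then n + tri m else 0.

Lemma cpairE x y : cpair x y = tri (x + y) + y.
Proof.
rewrite /cpair; congr (_ + _).
have -> : Nat.mul (Nat.add x y) (Nat.add (Nat.add x y) 1) = Nat.mul (tri (x + y)) 2.
  by rewrite -[Nat.add x y]/(x + y); elim: (x + y) => [|n IH] //=; lia.
by rewrite PeanoNat.Nat.div_mul.
Qed.

Lemma tri_le m n : m <= n -> tri m <= tri n.
Proof. by elim: n => [|n IH] /=; [case: m|rewrite leq_eqVlt => /orP [/eqP ->|/IH] //=; lia]. Qed.

Lemma tri_ge n : n <= tri n.
Proof. by case: n => //= n; lia. Qed.

Lemma cpair_inj x y x' y' : cpair x y = cpair x' y' -> x = x' /\ y = y'.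
Proof.
rewrite !cpairE => e.
have es : x + y = x' + y'.
  case: (ltngtP (x + y) (x' + y')) => // h; have := tri_le h => /=; lia.
by move: e; rewrite es; lia.
Qed.

Lemma cpair_surj z : exists x y, z = cpair x y.
Proof.
elim: z => [|z [[|x] [y ->]]]; first by exists 0, 0.
  by exists y.+1, 0; rewrite !cpairE !addn0 !add0n /=; lia.
by exists x, y.+1; rewrite !cpairE !addnS !addSn /=; lia.
Qed.

Lemma leq_cpair_l x y : x <= cpair x y.
Proof. by rewrite cpairE; have := tri_ge (x + y); lia. Qed.

Lemma leq_cpair_r x y : y <= cpair x y.
Proof. by rewrite cpairE; lia. Qed.

Lemma ltn_cpair_r x y : 0 < x -> y < cpair x y.
Proof. by rewrite cpairE; have := tri_ge (x + y); lia. Qed.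

Lemma leq_cpair x y x' y' : x <= x' -> y <= y' -> cpair x y <= cpair x' y'.
Proof. by move=> hx hy; rewrite !cpairE; have := tri_le (leq_add hx hy); lia. Qed.

Lemma ltn_cpair x y x' y' : x <= x' -> y <= y' -> (x < x') || (y < y') ->
  cpair x y < cpair x' y'.
Proof.
move=> hx hy h; rewrite !cpairE.
have /tri_le /= : (x + y).+1 <= x' + y' by lia.
lia.
Qed.

(** Both components of a pair are at most its code, so the projections are bounded searches. *)
Definition cfst z : nat :=
  nat_rect (fun=> nat) 0 (fun x a => if bex (fun y => cpair x y == z) z.+1 then x else a) z.+1.
Definition csnd z : nat :=
  nat_rect (fun=> nat) 0 (fun y a => if cpair (cfst z) y == z then y else a) z.+1.

Lemma nat_rect_search (p : nat -> bool) x m : x < m -> p x -> (forall y, p y -> y = x) ->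
  nat_rect (fun=> nat) 0 (fun x a => if p x then x else a) m = x.
Proof.
move=> lt_xm px uniq; elim: m lt_xm => [//|m IH] /=.
case pm: (p m); first by rewrite (uniq _ pm).
by rewrite ltnS leq_eqVlt => /orP [/eqP e|/IH //]; rewrite -e px in pm.
Qed.

Lemma cfst_cpair x y : cfst (cpair x y) = x.
Proof.
apply: nat_rect_search; first by rewrite ltnS leq_cpair_l.
  by apply/bexP; exists y; rewrite ?ltnS ?leq_cpair_r.
by move=> x' /bexP [y' _ /eqP /cpair_inj []].
Qed.

Lemma csnd_cpair x y : csnd (cpair x y) = y.
Proof.
rewrite /csnd cfst_cpair; apply: nat_rect_search => //; first by rewrite ltnS leq_cpair_r.
by move=> y' /eqP /cpair_inj [].
Qed.

Lemma cpairK z : cpair (cfst z) (csnd z) = z.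
Proof. by have [x [y ->]] := cpair_surj z; rewrite cfst_cpair csnd_cpair. Qed.

Lemma leq_cfst z : cfst z <= z. Proof. by rewrite -{2}(cpairK z) leq_cpair_l. Qed.
Lemma leq_csnd z : csnd z <= z. Proof. by rewrite -{2}(cpairK z) leq_cpair_r. Qed.

Lemma C_tri : C1 tri.
Proof.
apply: (cmp_ext (f := fun r => nat_rect (fun=> nat) 0 (fun i a => i.+1 + a) (r 0))).
  by move=> r; elim: (r 0) => //= n ->.
by ctac.
Qed.

Lemma C_cpair : C2 cpair.
Proof.
apply: (cmp_ext (f := fun r => tri (r 0 + r 1) + r 1)) => [r|]; first by rewrite cpairE.
by have htri := C_tri; ctac.
Qed.
#[export] Hint Resolve C_cpair : cdb.
Global Opaque cpair.

Ltac ctacb := repeat (ctac;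
  try lazymatch goal with
  | |- cmp ?n (fun r => nat_of_bool (bex (@?p r) (@?m r))) => apply (@cmp_bex n p m)
  end).

Lemma C_cfst : C1 cfst.
Proof. rewrite /cfst; ctac. apply: (cmp_bex (n := 3) (p := fun r y => cpair (r 0) y == r 2) (m := fun r => (r 2).+1)); ctac. Qed.
#[export] Hint Resolve C_cfst : cdb.

Lemma C_csnd : C1 csnd.
Proof. by rewrite /csnd; ctac. Qed.
#[export] Hint Resolve C_csnd : cdb.
Global Opaque cfst csnd.

(** * Coded lists and course-of-values recursion *)

Definition cnth t i := cfst (nat_rect (fun=> nat) t (fun _ a => csnd a) i).

Lemma C_cnth : C2 cnth.
Proof. by rewrite /cnth; ctac. Qed.
#[export] Hint Resolve C_cnth : cdb.

Lemma cnthS x t i : cnth (cpair x t) i.+1 = cnth t i.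
Proof.
rewrite /cnth; congr cfst; elim: i => [|i IH] /=; first by rewrite csnd_cpair.
by rewrite -IH.
Qed.

Lemma cnth0 x t : cnth (cpair x t) 0 = x.
Proof. by rewrite /cnth /= cfst_cpair. Qed.

(** The step function sees the list of all earlier values, newest first; hence the reversed indices
    in [cnth_stack]. *)
Definition stack (h : nat -> nat -> nat) := nat_rect (fun=> nat) 0 (fun i a => cpair (h i a) a).

Lemma cnth_stack h m d : d < m -> cnth (stack h m) d = h (m - d.+1) (stack h (m - d.+1)).
Proof.
elim: m d => [//|m IH] [|d] lt_dm; rewrite /stack /= -/(stack h m).
  by rewrite cnth0 subn1.
by rewrite cnthS IH.
Qed.

(* Level [c'] of the table available at level [c], read at parameter [d']. *)
Definition lk T c c' d' := cnth (cnth T (c - c'.+1)) d'.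

Lemma C_lk : C4 lk.
Proof. by rewrite /lk; ctac. Qed.
#[export] Hint Resolve C_lk : cdb.

Section Rec2.
Variables (G : (nat -> nat -> nat) -> nat -> nat -> nat) (bnd : nat -> nat).
Hypothesis G_C : C3 (fun T c d => G (lk T c) c d).
Hypothesis bnd_C : C1 bnd.
Hypothesis G_ext : forall c d f f',
  (forall c' d', c' < c -> d' <= bnd d -> f c' d' = f' c' d') -> G f c d = G f' c d.

(** A monotone majorant of [bnd] and of the identity, obtained by summation. *)
Let bnd' d := nat_rect (fun=> nat) d (fun i a => a + bnd i) d.+1.

Let bnd'P d : d <= bnd' d /\ bnd d <= bnd' d.
Proof.
rewrite /bnd' /=; suff : d <= nat_rect (fun=> nat) d (fun i a => a + bnd i) d by lia.
by elim: {3}d => //= m; lia.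
Qed.

Let bnd'_mono d e : d <= e -> bnd' d <= bnd' e.
Proof.
move=> de; have -> : e = d + (e - d) by lia.
elim: (e - d) => [|m IH]; first by rewrite addn0.
apply: leq_trans IH _; rewrite /bnd' addnS.
have aux a b q : a <= b -> nat_rect (fun=> nat) a (fun i a => a + bnd i) q <=
    nat_rect (fun=> nat) b (fun i a => a + bnd i) q by move=> ab; elim: q => //= q; lia.
by have := aux _ _ (d + m).+1 (leqnSn (d + m)); rewrite /=; lia.
Qed.

(** A computation that starts at [(c, d)] reaches level [j] after at most [c - j] calls, so
    parameters up to [D c d j] suffice there. *)
Let D c d j := nat_rect (fun=> nat) d (fun _ a => bnd' a) (c - j).
Let row T j e := stack (fun i _ => G (lk T j) j (e - i)) e.+1.
Let tab c d := stack (fun j T => row T j (D c d j)).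
Let loc c d j d' := G (lk (tab c d j) j) j d'.

Let lk_tab c d j j' d' : j' < j -> d' <= D c d j' -> lk (tab c d j) j j' d' = loc c d j' d'.
Proof.
move=> jj dD; rewrite /lk /tab cnth_stack; last by lia.
have -> : j - (j - j'.+1).+1 = j' by lia.
rewrite /row cnth_stack; last by lia.
by have -> : D c d j' - ((D c d j').+1 - d'.+1) = d' by lia.
Qed.

Let D_bnd c d j j' d' d2 : j <= c -> j' < j -> d' <= D c d j -> d2 <= bnd d' -> d2 <= D c d j'.
Proof.
move=> jc jj dD d2b.
have h : bnd' (D c d j) <= D c d j'.
  rewrite /D; have -> : c - j' = (c - j) + (j - j'.+1).+1 by lia.
  elim: (j - j'.+1) => [|m IH]; first by rewrite addn1.
  by rewrite addnS /=; apply: leq_trans IH _; case: (bnd'P (nat_rect (fun=> nat) d (fun=> [eta bnd']) (c - j + m.+1))).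
by have [_ ?] := bnd'P d'; have := bnd'_mono dD; lia.
Qed.

Let loc_loc c d c1 d1 j d' : j <= c -> j <= c1 -> d' <= D c d j -> d' <= D c1 d1 j ->
  loc c d j d' = loc c1 d1 j d'.
Proof.
elim/ltn_ind: j d' => j IH d' h1 h2 h3 h4; apply: G_ext => c' d2 lt_c le_d.
have e1 := D_bnd h1 lt_c h3 le_d; have e2 := D_bnd h2 lt_c h4 le_d.
by rewrite !lk_tab //; apply: IH => //; lia.
Qed.

(** Recursion on [c] whose calls may change the parameter [d], even increase it, within [bnd]. A
    finite table suffices: level [j] lists the values at all parameters up to [D c d j], and by
    [loc_loc] a value does not depend on the table from which it is read. *)
Lemma rec2 : exists F, C2 F /\ forall c d, F c d = G F c d.
Proof.
exists (fun c d => loc c d c d); split.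
  have bnd'_C : C1 bnd' by rewrite /bnd'; ctac.
  have D_C : C3 D by rewrite /D; ctac.
  have row_C : C3 row.
    rewrite /row /stack; ctac.
    apply: (@cmp_comp3 5 (fun T c d => G (lk T c) c d) (fun r => r 2) (fun r => r 3)
      (fun r => r 4 - r 0)) => //; ctac.
  have tab_C : C3 tab by rewrite /tab /stack; ctac.
  rewrite /loc; apply: (@cmp_comp3 2 (fun T c d => G (lk T c) c d)
    (fun r => tab (r 0) (r 1) (r 0)) (fun r => r 0) (fun r => r 1)) => //; ctac.
move=> c d; apply: G_ext => c' d' lt_c le_d.
have cc : d <= D c d c by rewrite /D subnn.
have h := D_bnd (leqnn c) lt_c cc le_d.
by rewrite lk_tab //; apply: loc_loc => //; rewrite ?(ltnW lt_c) // /D subnn.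
Qed.

End Rec2.

Lemma rec1 (G : (nat -> nat) -> nat -> nat) :
  C2 (fun T c => G (fun c' => lk T c c' 0) c) ->
  (forall c f f', (forall c', c' < c -> f c' = f' c') -> G f c = G f' c) ->
  exists F, C1 F /\ forall c, F c = G F c.
Proof.
move=> GC Gext.
have [||c d f f' ff'|F [FC FE]] := @rec2 (fun f c d => G (fun c' => f c' 0) c) id.
- by apply: (@cmp_comp2 3 (fun T c => G (fun c' => lk T c c' 0) c) (fun r => r 0) (fun r => r 1));
    ctac.
- by ctac.
- by apply: Gext => c' lt_c; apply: ff'.
exists (fun c => F c 0); split; first by ctac.
by move=> c; rewrite FE.
Qed.

Lemma computable_C1 h : computable h <-> C1 h.
Proof.
split=> -[r hr]; exists r; first by move=> rho; apply: hr.
by move=> x; apply: (hr (fun=> x)).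
Qed.

Lemma decidable_reduce (A B : nat -> Prop) h : C1 h -> (forall x, A x <-> B (h x)) ->
  decidable_set B -> decidable_set A.
Proof.
move=> [r hr] AB [s hs]; exists (RComp s [:: r]) => x.
have e : evs [:: r] [:: x] [:: h x] by apply: evsCons (hr (fun=> x)) (evsNil _).
by have [h1 h2] := hs (h x); split=> [/AB/h1|nA]; [|have /h2 : ~ B (h x) by move/AB];
  apply: evComp.
Qed.

Lemma decidable_C1 (A : nat -> Prop) (b : nat -> bool) : C1 b -> (forall x, A x <-> b x) ->
  decidable_set A.
Proof.
move=> [r hr] Ab; exists r => x; have := hr (fun=> x); rewrite /= => h.
by split=> [/Ab|nA]; [move=> bx; rewrite bx in h|have := introF (iffP idP (proj2 (Ab x)) (proj1 (Ab x))) nA => bx; rewrite bx in h].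
Qed.

(** * Definability in arithmetic *)

Section Definability.
Variable X : Type.
Variable A : nat -> ((nat -> X) -> Prop) -> Prop.

(** Definable predicates are collected semantically, up to equivalence; [DefA_form] and [DefP_form]
    extract formulas afterwards, so that none is written by hand. *)
Inductive Def : nat -> ((nat -> X) -> Prop) -> Prop :=
| D_atom n P : A n P -> Def n P
| D_not n P : Def n P -> Def n (fun r => ~ P r)
| D_and n P Q : Def n P -> Def n Q -> Def n (fun r => P r /\ Q r)
| D_or n P Q : Def n P -> Def n Q -> Def n (fun r => P r \/ Q r)
| D_imp n P Q : Def n P -> Def n Q -> Def n (fun r => P r -> Q r)
| D_all0 n P : Def n.+1 P -> Def n (fun r => forall x, P (scons x r))
| D_ex0 n P : Def n.+1 P -> Def n (fun r => exists x, P (scons x r))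
| D_ext n P Q : (forall r, P r <-> Q r) -> Def n P -> Def n Q.

Lemma D_all n (P : (nat -> X) -> X -> Prop) :
  Def n.+1 (fun r => P (fun i => r i.+1) (r 0)) -> Def n (fun r => forall x, P r x).
Proof. exact: D_all0. Qed.

Lemma D_ex n (P : (nat -> X) -> X -> Prop) :
  Def n.+1 (fun r => P (fun i => r i.+1) (r 0)) -> Def n (fun r => exists x, P r x).
Proof. exact: D_ex0. Qed.

Hypothesis A_ren : forall m n f P, (forall j, j < m -> f j < n) -> A m P ->
  A n (fun r => P (fun j => r (f j))).

Lemma D_ren m n f P : (forall j, j < m -> f j < n) -> Def m P ->
  Def n (fun r => P (fun j => r (f j))).
Proof.
move=> fP DP; elim: DP n f fP => {m P}
  [m P AP|m P _ IH|m P Q _ IP _ IQ|m P Q _ IP _ IQ|m P Q _ IP _ IQ|m P _ IH|m P _ IH|m P Q PQ _ IH] n f fP.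
- by apply: D_atom; apply: A_ren AP.
- by apply: D_not; apply: IH.
- by apply: D_and; [apply: IP|apply: IQ].
- by apply: D_or; [apply: IP|apply: IQ].
- by apply: D_imp; [apply: IP|apply: IQ].
- have /IH := (fun j => match j return j < m.+1 -> (if j is i.+1 then (f i).+1 else 0) < n.+1 with 0 => fun _ => isT | i.+1 => fP i end).
  move/D_all0; apply: D_ext => r; split=> h x; move: (h x).
    by congr P; apply/funext; case.
  by congr P; apply/funext; case.
- have /IH := (fun j => match j return j < m.+1 -> (if j is i.+1 then (f i).+1 else 0) < n.+1 with 0 => fun _ => isT | i.+1 => fP i end).
  move/D_ex0; apply: D_ext => r; split=> -[x h]; exists x; move: h.
    by congr P; apply/funext; case.
  by congr P; apply/funext; case.
- by apply: (D_ext _ (IH n f fP)) => r; apply: PQ.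
Qed.

Lemma D_rel1 (Q : X -> Prop) n i : Def 1 (fun r => Q (r 0)) -> i < n -> Def n (fun r => Q (r i)).
Proof. by move=> h hi; apply: (D_ren (f := fun=> i) _ h). Qed.

Lemma D_rel2 (Q : X -> X -> Prop) n i j : Def 2 (fun r => Q (r 0) (r 1)) ->
  i < n -> j < n -> Def n (fun r => Q (r i) (r j)).
Proof.
by move=> h hi hj; apply: (D_ren (f := fun x => if x is 0 then i else j) _ h) => -[|].
Qed.

Lemma D_rel3 (Q : X -> X -> X -> Prop) n i j l : Def 3 (fun r => Q (r 0) (r 1) (r 2)) ->
  i < n -> j < n -> l < n -> Def n (fun r => Q (r i) (r j) (r l)).
Proof.
by move=> h hi hj hl;
  apply: (D_ren (f := fun x => match x with 0 => i | 1 => j | _ => l end) _ h) => -[|[|]].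
Qed.

Lemma D_rel4 (Q : X -> X -> X -> X -> Prop) n i j l m :
  Def 4 (fun r => Q (r 0) (r 1) (r 2) (r 3)) ->
  i < n -> j < n -> l < n -> m < n -> Def n (fun r => Q (r i) (r j) (r l) (r m)).
Proof.
by move=> h hi hj hl hm;
  apply: (D_ren (f := fun x => match x with 0 => i | 1 => j | 2 => l | _ => m end) _ h) => -[|[|[|]]].
Qed.

Lemma D_rel5 (Q : X -> X -> X -> X -> X -> Prop) n i j l m p :
  Def 5 (fun r => Q (r 0) (r 1) (r 2) (r 3) (r 4)) ->
  i < n -> j < n -> l < n -> m < n -> p < n -> Def n (fun r => Q (r i) (r j) (r l) (r m) (r p)).
Proof.
by move=> h hi hj hl hm hp;
  apply: (D_ren (f := fun x => match x with 0 => i | 1 => j | 2 => l | 3 => m | _ => p end) _ h)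
    => -[|[|[|[|]]]].
Qed.

Lemma D_rel6 (Q : X -> X -> X -> X -> X -> X -> Prop) n i j l m p q :
  Def 6 (fun r => Q (r 0) (r 1) (r 2) (r 3) (r 4) (r 5)) ->
  i < n -> j < n -> l < n -> m < n -> p < n -> q < n ->
  Def n (fun r => Q (r i) (r j) (r l) (r m) (r p) (r q)).
Proof.
by move=> h hi hj hl hm hp hq;
  apply: (D_ren (f := fun x => match x with 0 => i | 1 => j | 2 => l | 3 => m | 4 => p | _ => q end)
    _ h) => -[|[|[|[|[|]]]]].
Qed.

End Definability.

Create HintDb ddb.

Ltac ren_tac := fail.

Ltac drel := idtac;
  lazymatch goal with
  | |- Def _ ?n (fun r => ?Q (r ?i) (r ?j) (r ?l) (r ?m) (r ?p) (r ?q)) =>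
      apply: (@D_rel6 _ _ _ Q n i j l m p q)
  | |- Def _ ?n (fun r => ?Q (r ?i) (r ?j) (r ?l) (r ?m) (r ?p)) =>
      apply: (@D_rel5 _ _ _ Q n i j l m p)
  | |- Def _ ?n (fun r => ?Q (r ?i) (r ?j) (r ?l) (r ?m)) => apply: (@D_rel4 _ _ _ Q n i j l m)
  | |- Def _ ?n (fun r => ?Q (r ?i) (r ?j) (r ?l)) => apply: (@D_rel3 _ _ _ Q n i j l)
  | |- Def _ ?n (fun r => ?Q (r ?i) (r ?j)) => apply: (@D_rel2 _ _ _ Q n i j)
  | |- Def _ ?n (fun r => ?Q (r ?i)) => apply: (@D_rel1 _ _ _ Q n i)
  end; solve [exact isT | ren_tac | eauto with ddb nocore].

Ltac dstep := cbv beta;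
  lazymatch goal with
  | |- Def _ ?n (fun r => ~ (@?P r)) => apply (@D_not _ _ n P)
  | |- Def _ ?n (fun r => @?P r /\ @?Q r) => apply (@D_and _ _ n P Q)
  | |- Def _ ?n (fun r => @?P r \/ @?Q r) => apply (@D_or _ _ n P Q)
  | |- Def _ ?n (fun r => @?P r -> @?Q r) => apply (@D_imp _ _ n P Q)
  | |- Def _ ?n (fun r => exists x, @?P r x) => apply (@D_ex _ _ n P)
  | |- Def _ ?n (fun r => forall x, @?P r x) => apply (@D_all _ _ n P)
  end.

Ltac dtac := repeat (first [dstep | drel]).

Definition arith_atom n (P : (nat -> nat) -> Prop) :=
  exists t u, [/\ tbound n t, tbound n u & forall r, P r <-> aeval r t = aeval r u].
Notation DefA := (Def arith_atom).

Fixpoint tren (f : nat -> nat) t :=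
  match t with
  | AVar i => AVar (f i)
  | AAdd u v => AAdd (tren f u) (tren f v)
  | AMul u v => AMul (tren f u) (tren f v)
  end.

Lemma tren_bound m n f t : (forall j, j < m -> f j < n) -> tbound m t -> tbound n (tren f t).
Proof. by move=> fP; elim: t => /= [i /fP|u hu v hv [/hu ? /hv]|u hu v hv [/hu ? /hv]]. Qed.

Lemma aeval_tren f r t : aeval r (tren f t) = aeval (fun j => r (f j)) t.
Proof. by elim: t => //= u -> v ->. Qed.

Lemma arith_ren m n f P : (forall j, j < m -> f j < n) -> arith_atom m P ->
  arith_atom n (fun r => P (fun j => r (f j))).
Proof.
move=> fP [t [u [ht hu e]]]; exists (tren f t), (tren f u).
by split; [exact: tren_bound ht|exact: tren_bound hu|move=> r; rewrite !aeval_tren].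
Qed.
Ltac ren_tac ::= exact @arith_ren.

Lemma D_eq n t u : tbound n t -> tbound n u -> DefA n (fun r => aeval r t = aeval r u).
Proof. by move=> ht hu; apply: D_atom; exists t, u. Qed.

Ltac rft f := lazymatch f with
  | (fun r => r ?i) => constr:(AVar i)
  | (fun r => addn (@?x r) (@?y r)) => let a := rft x in let b := rft y in constr:(AAdd a b)
  | (fun r => muln (@?x r) (@?y r)) => let a := rft x in let b := rft y in constr:(AMul a b)
  end.

Ltac deq := cbv beta; lazymatch goal with
  | |- Def _ ?n (fun r => @eq nat (@?x r) (@?y r)) =>
    let t := rft x in let u := rft y in
    exact (@D_eq n t u ltac:(by []) ltac:(by []))
  end.

Lemma DefA_form n P : DefA n P -> exists2 f, abound n f & forall r, asat r f <-> P r.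
Proof.
elim=> {n P} [n P [t [u [ht hu e]]]|n P _ [f hf e]|n P Q _ [f hf e] _ [g hg e']
  |n P Q _ [f hf e] _ [g hg e']|n P Q _ [f hf e] _ [g hg e']|n P _ [f hf e]|n P _ [f hf e]
  |n P Q PQ _ [f hf e]].
- by exists (AEq t u) => // r; rewrite e.
- by exists (ANot f) => // r /=; rewrite e.
- by exists (AAnd f g) => // r /=; rewrite e e'.
- by exists (AOr f g) => // r /=; rewrite e e'.
- by exists (AImp f g) => // r /=; rewrite e e'.
- by exists (AAll f) => // r /=; split=> h x; apply/e.
- by exists (AEx f) => // r /=; split=> -[x h]; exists x; apply/e.
- by exists f => // r; rewrite e.
Qed.

Lemma aeval_ext n r r' t : (forall i, i < n -> r i = r' i) -> tbound n t -> aeval r t = aeval r' t.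
Proof. by move=> h; elim: t => /= [i /h|u hu v hv [/hu -> /hv ->]|u hu v hv [/hu -> /hv ->]]. Qed.

Lemma asat_ext n r r' f : (forall i, i < n -> r i = r' i) -> abound n f -> (asat r f <-> asat r' f).
Proof.
elim: f n r r' => /= [t u|f IH|f If g Ig|f If g Ig|f If g Ig|f IH|f IH] n r r' h.
- by case=> /(aeval_ext h) -> /(aeval_ext h) ->.
- by move/(IH _ _ _ h) => ->.
- by case=> /(If _ _ _ h) -> /(Ig _ _ _ h) ->.
- by case=> /(If _ _ _ h) -> /(Ig _ _ _ h) ->.
- by case=> /(If _ _ _ h) -> /(Ig _ _ _ h) ->.
- have h' x i : i < n.+1 -> scons x r i = scons x r' i by case: i => //= i /h.
  by move=> hf; split=> H x; apply/(IH _ _ _ (h' x) hf).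
- have h' x i : i < n.+1 -> scons x r i = scons x r' i by case: i => //= i /h.
  by move=> hf; split=> -[x H]; exists x; apply/(IH _ _ _ (h' x) hf).
Qed.

(** The language has no constants: 1 is the multiplicative idempotent that is not an additive
    one. *)
Lemma D_one n i : i < n -> DefA n (fun r => r i = 1).
Proof.
move=> hi; apply: (@D_rel1 _ _ arith_ren (fun x => x = 1)) => //.
apply: (@D_ext _ _ _ (fun r => r 0 * r 0 = r 0 /\ ~ (r 0 + r 0 = r 0))); first by move=> r; nia.
by dtac; deq.
Qed.

Lemma D_zero n i : i < n -> DefA n (fun r => r i = 0).
Proof.
move=> hi; apply: (@D_rel1 _ _ arith_ren (fun x => x = 0)) => //.
by apply: (@D_ext _ _ _ (fun r => r 0 + r 0 = r 0)); [move=> r; lia|deq].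
Qed.

Lemma D_lt n i j : i < n -> j < n -> DefA n (fun r => r i < r j).
Proof.
move=> hi hj; apply: (@D_rel2 _ _ arith_ren (fun x y => x < y)) => //.
apply: (@D_ext _ _ _ (fun r => exists d, exists u, u = 1 /\ r 0 + d + u = r 1)).
  by move=> r; split=> [[d [u [-> e]]]|lt]; [lia|exists (r 1 - (r 0).+1), 1; lia].
by do !dstep; [apply: D_one|deq].
Qed.

Lemma D_succ n i j : i < n -> j < n -> DefA n (fun r => r j = (r i).+1).
Proof.
move=> hi hj; apply: (@D_rel2 _ _ arith_ren (fun y x => y = x.+1)) => //.
apply: (@D_ext _ _ _ (fun r => exists u, u = 1 /\ r 1 + u = r 0)).
  by move=> r; split=> [[u [-> e]]|lt]; [lia|exists 1; lia].
by do !dstep; [apply: D_one|deq].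
Qed.


(** A common divisor divides [j - i], which is a difference of multiples of the two moduli; hence it
    divides [b], and then 1. *)
Lemma beta_coprime i j b : i < j -> (forall d, 0 < d <= j -> d %| b) ->
  coprime (i.+1 * b).+1 (j.+1 * b).+1.
Proof.
move=> ij hb; rewrite /coprime; set d := gcdn _ _.
have d1 : d %| (i.+1 * b).+1 by apply: dvdn_gcdl.
have d2 : d %| (j.+1 * b).+1 by apply: dvdn_gcdr.
have dd : d %| b.
  apply: (@dvdn_trans (j - i)); last by apply: hb; lia.
  have -> : j - i = j.+1 * (i.+1 * b).+1 - i.+1 * (j.+1 * b).+1 by nia.
  by rewrite dvdn_sub // dvdn_mull.
by rewrite -dvdn1 -(@dvdn_addr (i.+1 * b)) ?addn1 // dvdn_mull.
Qed.

Lemma beta_exists (s : nat -> nat) N : exists a b, forall i, i <= N -> a %% (i.+1 * b).+1 = s i.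
Proof.
have [b [hb sb]] : exists b, (forall d, 0 < d <= N -> d %| b) /\ forall i, i <= N -> s i <= b.
  (* The factorial makes the moduli coprime, and the sum makes each of them exceed the value it has
     to return. *)
  exists (N`! * \sum_(i < N.+1) s i); split=> [d /dvdn_fact h|i iN]; first exact: dvdn_mulr.
  apply: leq_trans (leq_pmull _ (fact_gt0 _)).
  by rewrite (bigD1 (Ordinal (iN : i < N.+1))) //= leq_addr.
suff [a ha] : exists a, forall i, i <= N -> a = s i %[mod (i.+1 * b).+1].
  exists a, b => i iN; rewrite ha // modn_small //.
  by have := sb i iN; nia.
have : forall m, m <= N.+1 -> exists a, forall i, i < m -> a = s i %[mod (i.+1 * b).+1].
  elim=> [|m IH] mN; first by exists 0.
  have [a ha] := IH (ltnW mN).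
  set M := \prod_(i < m) (i.+1 * b).+1.
  have co : coprime M (m.+1 * b).+1.
    rewrite /M; elim/big_ind: _ => [|x y hx hy|i _]; first exact: coprime1n.
      by rewrite coprimeMl hx.
    by apply: beta_coprime => // d hd; apply: hb; lia.
  exists (chinese M (m.+1 * b).+1 a (s m)) => i; rewrite ltnS leq_eqVlt => /orP [/eqP ->|im].
    exact: chinese_modr.
  rewrite -ha //; have /dvdnP [q hq] : (i.+1 * b).+1 %| M.
    by rewrite /M (bigD1 (Ordinal im)) //= dvdn_mulr.
  have := chinese_modl co a (s m); move: (chinese _ _ _ _) => c e.
  by rewrite -(@modn_dvdm M c) ?hq ?dvdn_mull // -hq e hq modn_dvdm // dvdn_mull.
by move/(_ N.+1 (leqnn _)).
Qed.

Definition beta a b i := a %% (i.+1 * b).+1.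

Lemma D_beta n i j l m : i < n -> j < n -> l < n -> m < n ->
  DefA n (fun r => beta (r i) (r j) (r l) = r m).
Proof.
move=> hi hj hl hm; apply: (@D_rel4 _ _ arith_ren (fun x y z w => beta x y z = w)) => //.
apply: (@D_ext _ _ _ (fun r => exists l1, exists q, exists k, [/\ l1 = (r 2).+1, k = (l1 * r 1).+1,
   r 3 < k & r 0 = q * k + r 3])).
  move=> r; rewrite /beta; split=> [[l1 [q [k [-> -> lt ->]]]]|<-]; first by rewrite modnMDl modn_small.
  exists (r 2).+1, (r 0 %/ ((r 2).+1 * r 1).+1), ((r 2).+1 * r 1).+1.
  by split=> //; [rewrite ltn_mod|rewrite -divn_eq].
apply: (@D_ext _ _ _ (fun r => exists l1, exists q, exists k, l1 = (r 2).+1 /\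
   (exists p, p = l1 * r 1 /\ k = p.+1) /\ r 3 < k /\ r 0 = q * k + r 3)).
  move=> r; split=> -[l1 [q [k h]]]; exists l1, q, k; first by case: h => -> [[p [-> ->]]] [].
  by case: h => -> -> ??; do !split=> //; exists ((r 2).+1 * r 1).
by do !dstep; first [apply: D_succ|apply: D_lt|deq].
Qed.

(** * Arithmetical graphs of recursive functions *)

Section RfInd.
Variable P : rf -> Prop.
Hypothesis (P0 : P RZero) (PS : P RSucc) (Pp : forall i, P (RProj i))
  (Pc : forall f gs, P f -> (forall i, i < size gs -> P (nth RZero gs i)) -> P (RComp f gs))
  (Pr : forall f g, P f -> P g -> P (RPrim f g)) (Pm : forall f, P f -> P (RMu f)).

Fixpoint rf_nested_ind r : P r :=
  match r with
  | RZero => P0 | RSucc => PS | RProj i => Pp i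
  | RComp f gs => Pc (rf_nested_ind f)
     ((fix F (s : seq rf) : forall i, i < size s -> P (nth RZero s i) :=
       match s with
       | nil => fun i h => match notF h with end
       | g :: s' => fun i => match i with 0 => fun _ => rf_nested_ind g | j.+1 => F s' j end
       end) gs)
  | RPrim f g => Pr (rf_nested_ind f) (rf_nested_ind g)
  | RMu f => Pm (rf_nested_ind f)
  end.
End RfInd.

Lemma evs_size gs v ys : evs gs v ys -> size ys = size gs.
Proof. by elim: gs ys => [|g gs IH] ys h; inversion h; subst => //=; rewrite (IH ys0). Qed.

Lemma ev_det r v y y' : ev r v y -> ev r v y' -> y = y'.
Proof.
elim/rf_nested_ind: r v y y' => [||i|f gs IHf IHgs|f g IHf IHg|f IHf] v y y' h h'.
- by inversion h; inversion h'.
- by inversion h; inversion h'; subst.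
- by inversion h; inversion h'; subst.
- inversion h as [| | |? ? ? ys ? e1 e2| | |]; inversion h' as [| | |? ? ? ys' ? e1' e2'| | |]; subst.
  suff E : ys = ys' by apply: IHf e2 _; rewrite E.
  clear -IHgs e1 e1'; elim: gs IHgs ys ys' e1 e1' => [|g gs IH] IHgs ys ys' h h';
    inversion h; inversion h'; subst => //.
  by congr cons; [apply: (IHgs 0 isT v)|apply: (IH (fun i => IHgs i.+1))].
- case: v h h' => [|N v]; first by move=> h; inversion h.
  elim: N y y' => [|N IH] y y' h h'; inversion h; inversion h'; subst; first exact: (IHf v).
  by apply: (IHg (N :: z :: v)) => //; rewrite (IH z z0).
- inversion h as [| | | | | |? ? ? h0 h1]; inversion h' as [| | | | | |? ? ? h0' h1']; subst.
  case: (ltngtP y y') => // lt.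
    by have [z /IHf /(_ h0)] := h1' _ lt.
  by have [z /IHf /(_ h0')] := h1 _ lt.
Qed.

Definition catenv := foldr (@scons nat).

Lemma catenv_lt r s i : i < size s -> catenv r s i = nth 0 s i.
Proof. by elim: s i => //= x s IH [|i] //= /IH. Qed.

Lemma catenv_ge r s i : catenv r s (size s + i) = r i.
Proof. by elim: s => //= x s IH. Qed.

Lemma mkseq_catenv r s : mkseq (catenv r s) (size s) = s.
Proof.
apply: (@eq_from_nth _ 0); first by rewrite size_mkseq.
by move=> i; rewrite size_mkseq => h; rewrite nth_mkseq // catenv_lt.
Qed.

(* The argument [y] is stored in front of the argument list. *)
Definition graph r n := DefA n.+1 (fun w => ev r (mkseq (fun i => w i.+1) n) (w 0)).

Lemma D_graph r n m idx (v : (nat -> nat) -> nat -> nat) y : graph r n ->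
  (forall i, i < n -> idx i < m) -> y < m -> (forall w i, v w i = w (idx i)) ->
  DefA m (fun w => ev r (mkseq (v w) n) (w y)).
Proof.
move=> h hi hy vE.
apply: (@D_ext _ _ _ (fun w => ev r (mkseq (fun i => w (idx i)) n) (w y))).
  by move=> w; rewrite (eq_mkseq (vE w)).
have := @D_ren _ _ arith_ren n.+1 m (fun j => if j is i.+1 then idx i else y) _ _ h.
by apply=> -[|i] // /hi.
Qed.

(** One quantifier is spent on each program of the list. The value of the head is quantified
    innermost, where the arguments have already moved up by the number of the other values. *)
Lemma D_evs gs n : (forall i, i < size gs -> graph (nth RZero gs i) n) ->
  forall m off P, off + n <= m -> DefA (size gs + m) P ->
  DefA m (fun w => exists ys, evs gs (mkseq (fun i => w (off + i)) n) ys /\ P (catenv w ys)).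
Proof.
elim: gs => [|g gs IH] hg m off P hoff DP.
  apply: (D_ext _ DP) => w; split=> [h|[ys [h]]]; first by exists nil; split=> //; apply: evsNil.
  by inversion h.
have DP' : DefA (size gs + m) (fun w => exists y,
    ev g (mkseq (fun i => w (size gs + (off + i))) n) y /\ P (scons y w)).
  apply: D_ex; apply: D_and.
    by apply: (D_graph (idx := fun i => (size gs + (off + i)).+1) (hg 0 isT)) => // i hi; lia.
  by apply: (D_ext _ DP) => r; rewrite (_ : scons _ _ = r) //; apply/funext; case.
have := IH (fun i => hg i.+1) m off _ hoff DP'.
apply: D_ext => w; split=> [[ys [h1 [y [h2 h3]]]]|[ys [h1 h2]]].
  exists (y :: ys); split=> //; apply: evsCons => //.
  rewrite -(evs_size h1) in h2; congr ev: h2; apply: eq_mkseq => i; exact: catenv_ge.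
inversion h1; subst; exists ys0; split=> //; exists y; split=> //.
by rewrite -(evs_size H4); congr ev: H1; apply: eq_mkseq => i; rewrite catenv_ge.
Qed.

Lemma graph_all r n : graph r n.
Proof.
elim/rf_nested_ind: r n => [||i|f gs IHf IHgs|f g IHf IHg|f IHf] n; rewrite /graph.
- apply: (@D_ext _ _ _ (fun r => r 0 = 0)); last exact: D_zero.
  by move=> r; split=> [->|h]; [apply: evZero|inversion h].
- case: n => [|n].
    apply: (@D_ext _ _ _ (fun r => r 0 = 1)); last exact: D_one.
    by move=> r; split=> [->|h]; [apply: (evSucc nil)|inversion h].
  apply: (@D_ext _ _ _ (fun r => r 0 = (r 1).+1)); last exact: D_succ.
  by move=> r; split=> [->|h]; [apply: (evSucc (mkseq _ n.+1))|inversion h].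
- have [lt|ge] := ltnP i n.
    apply: (@D_ext _ _ _ (fun r => r 0 = r i.+1)); last exact: D_eq (AVar 0) (AVar i.+1) _ _.
    move=> r; split=> [->|h]; last by inversion h; rewrite nth_mkseq.
    by have := evProj i (mkseq (fun i => r i.+1) n); rewrite nth_mkseq.
  apply: (@D_ext _ _ _ (fun r => r 0 = 0)); last exact: D_zero.
  have e r : nth 0 (mkseq (fun i0 => r i0.+1 : nat) n) i = 0 by rewrite nth_default ?size_mkseq.
  move=> r; split=> [->|h]; last by inversion h; rewrite e.
  by have := evProj i (mkseq (fun i => r i.+1) n); rewrite e.
- have DP : DefA (size gs + n.+1) (fun w => ev f (mkseq w (size gs)) (w (size gs))).
    by apply: (D_graph (idx := id)); rewrite ?addnS ?ltnS ?leq_addr // => i hi; lia.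
  have := @D_evs gs n (fun i h => IHgs i h n) n.+1 1 _ (leqnn _) DP.
  apply: D_ext => w; split=> [[ys [h1 h2]]|h].
    move: h2; rewrite -(evs_size h1) mkseq_catenv -[X in catenv _ _ X]addn0 catenv_ge.
    exact: evComp h1.
  inversion h as [| | |? ? ? ys ? h1 h2| | |]; subst; exists ys; split=> //.
  by rewrite -(evs_size h1) mkseq_catenv -[X in catenv _ _ X]addn0 catenv_ge.
- case: n => [|n].
    by apply: (@D_ext _ _ _ (fun r => r 0 < r 0)) (D_lt _ _) => // r; rewrite ltnn; split=> // h; inversion h.
  (* The pair [a], [b] codes the course of values of the recursion by the beta function; the other
     quantified variables name terms, since [D_beta] and the graphs speak of variables. *)
  apply: (@D_ext _ _ _ (fun w => exists a, exists b,
    (exists z, exists z0, z = 0 /\ beta a b z = z0 /\ ev f (mkseq (fun i => w i.+2) n) z0) /\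
    (forall i, i < w 1 -> exists z, exists i1, exists z', i1 = i.+1 /\ beta a b i = z /\
       beta a b i1 = z' /\ ev g (mkseq (fun j => match j with 0 => i | 1 => z | k.+2 => w k.+2 end) n.+2) z') /\
    beta a b (w 1) = w 0)).
    move=> w; rewrite mkseqS; set v := mkseq (fun i => w i.+2) n.
    have mk2 i z : mkseq (fun j => match j with 0 => i | 1 => z | k.+2 => w k.+2 end) n.+2 = i :: z :: v.
      by rewrite !mkseqS.
    split=> [[a [b [[z [z0 [-> [e0 h0]]]]] [hs he]]]|h].
      rewrite -he; move: (w 1) hs => N hs.
      have : forall m, m <= N -> ev (RPrim f g) (m :: v) (beta a b m); last exact.
      elim=> [|m IH] mN; first by apply: evPrim0; rewrite e0.
      have [z1 [i1 [z' [ei [ez [ez' hg]]]]]] := hs m mN.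
      by apply: evPrimS (IH (ltnW mN)) _; rewrite ez -ei ez' -mk2.
    move: (w 1) (w 0) h => N y h.
    have [s [s0 sS sN]] : exists s : nat -> nat, [/\ ev f v (s 0),
        forall i, i < N -> ev g (i :: s i :: v) (s i.+1) & s N = y].
      elim: N y h => [|N IH] y h; inversion h; subst; first by exists (fun=> y).
      have [s [s0 sS sN]] := IH _ H4.
      exists (fun i => if i <= N then s i else y); split=> //; last by rewrite ltnn.
      move=> i; rewrite ltnS => iN; rewrite iN; case: ltnP => [/sS //|Ni].
      by have -> : i = N by [lia]; rewrite sN.
    have [a [b ab]] := beta_exists s N.
    exists a, b; split; first by exists 0, (s 0); split=> //; split=> //; apply: ab.
    split; last by rewrite /beta ab.
    move=> i iN; exists (s i), i.+1, (s i.+1); rewrite /beta (ab i (ltnW iN)) (ab _ iN).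
    by do 3!split=> //; rewrite mk2; apply: sS.
  repeat dstep; try (first [apply: D_zero|apply: D_beta|apply: D_lt|apply: D_succ]; by []).
    by apply: (D_graph (idx := fun i => i.+2.+4) (IHf n)).
  by apply: (D_graph (idx := fun j => match j with 0 => 3 | 1 => 2 | k.+2 => k.+2.+2.+4 end) (IHg n.+2)) => [[|[|i]]| |_ [|[|i]]] // hi; lia.
- apply: (@D_ext _ _ _ (fun w => (exists z, z = 0 /\ ev f (mkseq (fun j => if j is k.+1 then w k.+1 else w 0) n.+1) z) /\
    forall m, m < w 0 -> exists y, exists z, z = y.+1 /\ ev f (mkseq (fun j => if j is k.+1 then w k.+1 else m) n.+1) z)).
    move=> w; split=> [[[z [->]]]|h].
      rewrite mkseqS => h0 h1; apply: evMu => // m /h1 [y [z' [->]]].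
      by rewrite mkseqS; exists y.
    inversion h as [| | | | | |? ? ? h0 h1]; subst; split; first by exists 0; rewrite mkseqS.
    by move=> m /h1 [y hy]; exists y, y.+1; rewrite mkseqS.
  repeat dstep; try (first [apply: D_zero|apply: D_lt|apply: D_succ]; by []).
    by apply: (D_graph (idx := fun j => if j is k.+1 then k.+2 else 1) (IHf n.+1)) => [[|i]| |_ [|i]] // hi; lia.
  by apply: (D_graph (idx := fun j => if j is k.+1 then k.+4 else 2) (IHf n.+1)) => [[|i]| |_ [|i]] // hi; lia.
Qed.

Lemma D_C1 f n i j : C1 f -> i < n -> j < n -> DefA n (fun w => w j = f (w i)).
Proof.
move=> [r hr] hi hj; apply: (@D_ext _ _ _ (fun w => ev r (mkseq (fun=> w i) 1) (w j))).
  move=> w; split=> [h|->]; last exact: hr.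
  exact: ev_det h (hr (fun=> w i)).
by apply: (D_graph (idx := fun=> i) (graph_all r 1)).
Qed.

Lemma D_C2 f n i j l : C2 f -> i < n -> j < n -> l < n -> DefA n (fun w => w l = f (w i) (w j)).
Proof.
move=> [r hr] hi hj hl.
apply: (@D_ext _ _ _ (fun w => ev r (mkseq (fun k => w (if k is 0 then i else j)) 2) (w l))).
  move=> w; have h' := hr (fun k => w (if k is 0 then i else j)).
  by split=> [h|->]; [exact: ev_det h h'|exact: h'].
by apply: (D_graph (idx := fun k => if k is 0 then i else j) (graph_all r 2)) => // -[].
Qed.

(** * Tarski's theorem and Myhill's theorem *)

Lemma tcode_inj : injective tcode.
Proof.
elim=> [i|u hu v hv|u hu v hv] [j|u' v'|u' v'] /= /cpair_inj [] // _; first by move=> ->.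
  by case/cpair_inj => /hu -> /hv ->.
by case/cpair_inj => /hu -> /hv ->.
Qed.

Lemma acode_inj : injective acode.
Proof.
elim=> [t u|f hf|f hf g hg|f hf g hg|f hf g hg|f hf|f hf]
  [t' u'|f'|f' g'|f' g'|f' g'|f'|f'] /= /cpair_inj [] // _ => [|/hf ->||||/hf ->|/hf ->] //;
  by case/cpair_inj => [/tcode_inj -> /tcode_inj ->] || case/cpair_inj => /hf -> /hg ->.
Qed.

Lemma pcode_inj : injective pcode.
Proof.
elim=> [i j|i j|f hf|f hf g hg|f hf g hg|f hf g hg|f hf|f hf]
  [i' j'|i' j'|f'|f' g'|f' g'|f' g'|f'|f'] /= /cpair_inj [] // _ => [||/hf ->||||/hf ->|/hf ->] //;
  by case/cpair_inj => [-> ->] || case/cpair_inj => /hf -> /hg ->.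
Qed.

Lemma Th_arithE f r : abound 0 f -> (Th_arith (acode f) <-> asat r f).
Proof.
move=> hf; split=> [[f' [_ [/acode_inj -> h]]]|h]; first exact: h.
by exists f; split=> //; split=> // r'; apply/(@asat_ext 0 r r').
Qed.

(** Tarski's diagonal argument against a decision program [s]. For the code [c] of a formula, [h c]
    is the code of the sentence asserting that formula of the number [c]. The formula [f] says that
    [s] does not return 1 on [h] of its variable, and its instance at its own code refutes [s]. *)
Theorem Th_arith_undecidable : ~ decidable_set Th_arith.
Proof.
move=> [s hs].
have [S1 hS1 S1E] := DefA_form (@D_succ 2 0 1 isT isT).
(* In place of numerals: [nf c] says that variable 0 equals [c], reached by [c] successor steps from
   the solution of [x + x = x]. *)
pose nf := nat_rect (fun=> aform) (AEq (AAdd (AVar 0) (AVar 0)) (AVar 0)) (fun _ a => AEx (AAnd a S1)).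
have nf_bound c : abound 1 (nf c).
  have mono n f : abound n f -> abound n.+1 f.
    have tmono t m : tbound m t -> tbound m.+1 t.
      elim: t => //= [i|u hu v hv [/hu ? /hv]|u hu v hv [/hu ? /hv]] //; exact: ltnW.
    elim: f n => //= [t u|f If g Ig|f If g Ig|f If g Ig|f If|f If] n;
      by [case=> /tmono ? /tmono | case=> /If ? /Ig | move/If].
  by elim: c => //= c IH; split=> //; apply: mono.
have nfE c r : asat r (nf c) <-> r 0 = c.
  elim: c r => [|c IH] r; first by rewrite /=; lia.
  rewrite /=; split=> [[x [/IH /= -> /S1E /= ->]] //|e].
  by exists c; split; [apply/IH|apply/S1E].
pose s1 := acode S1.
pose nc c := nat_rect (fun=> nat) (acode (nf 0)) (fun _ a => cpair 6 (cpair 2 (cpair a s1))) c.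
have nfc c : acode (nf c) = nc c by elim: c => //= c ->.
pose h c := cpair 6 (cpair 2 (cpair (nc c) c)).
have hC : C1 h by rewrite /h /nc; ctac.
have : DefA 1 (fun w => exists y, exists z, y = h (w 0) /\ z = 1 /\ ev s (mkseq (fun=> y) 1) z).
  repeat dstep; [exact: D_C1|exact: D_one|].
  by apply: (D_graph (idx := fun=> 1) (graph_all s 1)).
move/D_not/DefA_form => [f hf fE].
pose d := AEx (AAnd (nf (acode f)) f).
have dc : acode d = h (acode f) by rewrite /d /= nfc.
have db : abound 0 d by [].
have dE : asat id d <-> ~ ev s [:: h (acode f)] 1.
  split=> [[x [/nfE /= -> /fE /= h1]] h2|h1].
    by apply: h1; exists (h (acode f)), 1.
  exists (acode f); split; first exact/nfE.
  by apply/fE => -[y [z [/= -> [->]]]].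
have [h1 h2] := hs (acode d).
have := Th_arithE id db; rewrite dE dc => E; rewrite dc in h1 h2.
have n1 : ~ ev s [:: h (acode f)] 1.
  by move=> e; have /h2 /(ev_det e) : ~ Th_arith (h (acode f)) by move/E.
exact/n1/h1/E.
Qed.

(** If [x < f x] for all [x], a preimage of [y] is below [y]; a bounded search then decides the
    range of [f] and inverts [f]. *)
Definition inv_lt (f : nat -> nat) y := nat_rect (fun=> nat) 0 (fun x a => if f x == y then x else a) y.
Definition hit_lt (f : nat -> nat) y := bex (fun x => f x == y) y.

Lemma inv_ltK f x : injective f -> x < f x -> inv_lt f (f x) = x.
Proof. by move=> fi lt; apply: nat_rect_search => // y /eqP /fi. Qed.

Lemma C_inv_lt f : C1 f -> C1 (inv_lt f).
Proof. by move=> fC; rewrite /inv_lt; ctac. Qed.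

Lemma C_hit_lt f : C1 f -> C1 (hit_lt f).
Proof. by move=> fC; apply: (cmp_bex (p := fun r x => f x == r 0)); ctac. Qed.

(* Myhill's theorem.  Since both reductions increase their argument, the backward chain of
   alternating preimages of [x] is found by course-of-values recursion. *)
Lemma comp_iso_reductions (A B : nat -> Prop) f g : C1 f -> C1 g ->
  injective f -> injective g -> (forall x, x < f x) -> (forall y, y < g y) ->
  (forall x, A x <-> B (f x)) -> (forall y, B y <-> A (g y)) -> comp_iso A B.
Proof.
move=> fC gC fi gi fx gy Af Bg.
have hitP e y : reflect (exists2 x, x < y & e x = y) (hit_lt e y).
  by apply: (iffP (bexP _ _)) => -[x lt /eqP]; [move=> ?; exists x|exists x => //; apply/eqP].
have iC := C_inv_lt fC; have jC := C_inv_lt gC; have fhC := C_hit_lt fC; have ghC := C_hit_lt gC.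
(* The value is 1 if the backward chain of [x] stops on the side of [A], and 0 if it stops on the
   side of [B]; the bijection uses [f] in the former case and the inverse of [g] in the latter. *)
pose G o x := if hit_lt g x then if hit_lt f (inv_lt g x) then o (inv_lt f (inv_lt g x)) else 0 else 1.
have [||o [oC oE]] := @rec1 G.
- rewrite /G; ctac.
- move=> x u v uv; rewrite /G; case: (hitP g x) => // -[y lt e].
  rewrite -e inv_ltK //; case: (hitP f y) => // -[z lt' e'].
  by rewrite -e' inv_ltK //; apply: uv; lia.
pose oB y := if hit_lt f y then o (inv_lt f y) else 0.
have o_g y : o (g y) = oB y.
  rewrite oE /G /oB; case: (hitP g) => [_|[]]; first by rewrite inv_ltK.
  by exists y.
have oB_f x : oB (f x) = o x.
  by rewrite /oB; case: hitP => [_|[]]; [rewrite inv_ltK|exists x].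
have o_no x : ~~ hit_lt g x -> o x = 1 by rewrite oE /G => /negPf ->.
have oB_no x : ~~ hit_lt f x -> oB x = 0 by rewrite /oB => /negPf ->.
have oBC : C1 oB by rewrite /oB; ctac.
exists (fun x => if o x == 1 then f x else inv_lt g x), (fun y => if oB y == 1 then inv_lt f y else g y).
split.
- by apply/computable_C1; ctac.
- by apply/computable_C1; ctac.
- move=> x /=; case: (o x =P 1) => [e|ne]; first by rewrite oB_f e eqxx inv_ltK.
  have : hit_lt g x by apply: contraT => /o_no.
  by case/hitP => y _ e; move: ne; rewrite -e o_g inv_ltK // => /eqP/negPf ->.
- move=> y /=; case: (oB y =P 1) => [e|ne].
    have : hit_lt f y by apply: contraT => /oB_no; rewrite e.
    by case/hitP => x _ e'; move: e; rewrite -e' oB_f inv_ltK // => ->; rewrite eqxx.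
  by rewrite o_g; case: eqP => // _; rewrite inv_ltK.
- move=> x; case: eqP => [e|ne]; first exact: Af.
  have : hit_lt g x by apply: contraT => /o_no.
  by case/hitP => y _ e; rewrite -e inv_ltK // Bg.
Qed.

(** * Terms for iterated forests *)

(* [N t f] is the tree with root labelled [t] and subforest [f]; the label [L i] is identified
   with the one-node tree [N (L i) E], as the embeddings [emb] require. *)
Inductive fterm := E | L of nat | N of fterm & fterm | J of fterm & fterm.

(** Morphisms are only weakly monotone: when the root of [N t f] goes to the root of the target, [f]
    may still use that root, whence [fle f (N t' f')]. A leaf [L i] below [N t f] is either a root
    label below [t] or lies below [f]. *)
Fixpoint fle x y {struct x} : bool :=
  match x with
  | E => true
  | J f g => fle f y && fle g y
  | L i => (fix lin y := match y with
      | E => false | L j => i == j | N t f => lin t || lin f | J f g => lin f || lin g end) y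
  | N t f => (fix nin y := match y with
      | E => false | L j => fle t (L j) && fle f (L j)
      | N t' f' => fle t t' && fle f (N t' f') || nin f'
      | J g h => nin g || nin h end) y
  end.

Definition feq x y := fle x y && fle y x.
Definition istree t := match t with L _ | N _ _ => true | _ => false end.

Fixpoint fsize x := match x with E => 1 | L _ => 1 | N t f => (fsize t + fsize f).+1
  | J f g => (fsize f + fsize g).+1 end.

Lemma fleLL i j : fle (L i) (L j) = (i == j). Proof. by []. Qed.
Lemma fleLN i t f : fle (L i) (N t f) = fle (L i) t || fle (L i) f. Proof. by []. Qed.
Lemma fleNL t f j : fle (N t f) (L j) = fle t (L j) && fle f (L j). Proof. by []. Qed.
Lemma fleNN t f t' f' : fle (N t f) (N t' f') = fle t t' && fle f (N t' f') || fle (N t f) f'.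
Proof. by []. Qed.
Lemma fleJ f g y : fle (J f g) y = fle f y && fle g y. Proof. by []. Qed.

Lemma fle_treeJ t f g : istree t -> fle t (J f g) = fle t f || fle t g.
Proof. by case: t. Qed.

Lemma fle_treeE t : istree t -> fle t E = false.
Proof. by case: t. Qed.
#[global] Arguments fle : simpl never.

Lemma fle_Jl x f g : fle x f -> fle x (J f g).
Proof.
elim: x => [|i|t _ h _|a IHa b IHb] //; try by rewrite fle_treeJ // => ->.
by rewrite !fleJ => /andP [/IHa -> /IHb].
Qed.

Lemma fle_Jr x f g : fle x g -> fle x (J f g).
Proof.
elim: x => [|i|t _ h _|a IHa b IHb] //; try by rewrite fle_treeJ // => ->; rewrite orbT.
by rewrite !fleJ => /andP [/IHa -> /IHb].
Qed.

Lemma fle_N x t f : fle x f -> fle x (N t f).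
Proof.
elim: x => [|i|u _ h _|a IHa b IHb] //; rewrite ?fleLN ?fleNN; try by move->; rewrite orbT.
by rewrite !fleJ => /andP [/IHa -> /IHb].
Qed.

Lemma fle_refl x : fle x x.
Proof.
elim: x => [|i|t ht f hf|f hf g hg] //; first by rewrite fleLL.
  by rewrite fleNN ht fle_N.
by rewrite fleJ fle_Jl // fle_Jr.
Qed.

Lemma fle_trans y x z : fle x y -> fle y z -> fle x z.
Proof.
have [n] := ubnP (fsize x + fsize y + fsize z); elim: n x y z => // n IH x y z.
case: x => [|i|t f|f g] //; last first.
  by rewrite !fleJ => hn /andP [h1 h2] h3; rewrite (IH f y z) ?(IH g y z) //; move: hn => /=; lia.
all: case: y => [|j|t' f'|g h] //.
all: try by rewrite fle_treeJ // fleJ => hn h1 /andP [h2 h3];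
  case/orP: h1 => h1; [apply: (IH _ g)|apply: (IH _ h)] => //; move: hn => /=; lia.
all: case: z => [|l|t'' f''|g' h'] //.
all: try by move=> hn h1; rewrite !fle_treeJ //;
  case/orP => h2; rewrite (IH _ _ _ _ h1 h2) ?orbT //; move: hn => /=; lia.
all: try by rewrite fleLL => _ h1; rewrite -?(eqP h1) // => /eqP <-.
- move=> hn; rewrite fleNL => /andP [h1 h2]; rewrite fleLN fleNN => /orP [] h3.
    rewrite (IH _ _ _ _ h1 h3) ?(IH _ _ (N t'' f'') _ h2) ?fleLN ?h3 //; move: hn => /=; lia.
  by rewrite (IH (N t f) _ _ _ _ h3) ?orbT // ?fleNL ?h1 //; move: hn => /=; lia.
- move=> hn; rewrite fleNN !fleNL => /orP [/andP [h1 h2]|h1] /andP [h3 h4].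
    by rewrite (IH _ _ _ _ h1 h3) ?(IH _ _ (L l) _ h2) ?fleNL ?h3 //; move: hn => /=; lia.
  by rewrite -fleNL; apply: IH h1 h4; move: hn => /=; lia.
- move=> hn h1 h2; move: (h2); rewrite fleNN => /orP [/andP [h3 h4]|h3]; last first.
    by apply: fle_N; apply: IH h1 h3; move: hn => /=; lia.
  move: h1; rewrite !fleNN => /orP [/andP [h1 h5]|h1].
    by rewrite (IH _ _ _ _ h1 h3) ?(IH _ _ _ _ h5 h2) //; move: hn => /=; lia.
  by rewrite -fleNN; apply: IH h1 h4; move: hn => /=; lia.
- rewrite fleLN fleNL => hn /orP [] h1 /andP [h2 h3].
    by apply: IH h1 h2; move: hn => /=; lia.
  by apply: IH h1 h3; move: hn => /=; lia.
- move=> hn h1 h2; move: (h2); rewrite fleNN => /orP [/andP [h3 h4]|h3]; last first.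
    by apply: fle_N; apply: IH h1 h3; move: hn => /=; lia.
  move: h1; rewrite !fleLN => /orP [] h1; first by rewrite (IH _ _ _ _ h1 h3) //; move: hn => /=; lia.
  by rewrite -fleLN; apply: IH h1 h4; move: hn => /=; lia.
Qed.

Lemma feq_refl x : feq x x. Proof. by rewrite /feq fle_refl. Qed.
Lemma feq_sym x y : feq x y = feq y x. Proof. by rewrite /feq andbC. Qed.
Lemma feq_trans y x z : feq x y -> feq y z -> feq x z.
Proof. by move=> /andP [a b] /andP [c d]; rewrite /feq (fle_trans a c) (fle_trans d b). Qed.

Lemma fle_feql x y z : feq x y -> fle x z = fle y z.
Proof. by case/andP => a b; apply/idP/idP; apply: fle_trans. Qed.

Lemma fle_feqr x y z : feq x y -> fle z x = fle z y.
Proof. by case/andP => a b; apply/idP/idP => h; [apply: fle_trans h a|apply: fle_trans h b]. Qed.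

(** Forests are determined by the trees below them, which is how [Fk_le] compares finite sets. *)
Lemma fle_trees x y : (forall t, istree t -> fle t x -> fle t y) -> fle x y.
Proof.
elim: x => [|i h|t _ f _ h|f hf g hg h] //; try by apply: h => //; apply: fle_refl.
by rewrite fleJ hf ?hg // => t ht hx; apply: h => //; [apply: fle_Jr|apply: fle_Jl].
Qed.

Fixpoint okf k x := match x with E => true | L i => i < k | N t f => [&& istree t, okf k t & okf k f]
  | J f g => okf k f && okf k g end.
Fixpoint rk x := match x with E => 0 | L _ => 0 | N t f => maxn (rk t).+1 (rk f)
  | J f g => maxn (rk f) (rk g) end.

(** * Finite trees and the terms that represent them *)

Section TreeTerms.
Variable Q : Type.
Implicit Types (T : QTree Q).

Definition qlt T (x y : qt_car T) := qt_le x y /\ x <> y.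

Lemma qlt_trans T (x y z : qt_car T) : qlt x y -> qlt y z -> qlt x z.
Proof.
move=> [h1 n1] [h2 n2]; split; first exact: qt_trans h1 h2.
by move=> e; subst z; apply: n1; apply: qt_antisym.
Qed.

Definition above T (x : qt_car T) := #|[pred y | `[< qlt x y >]]|.
Definition below T (x : qt_car T) := #|[pred y | `[< qlt y x >]]|.

Lemma above_lt T (x y : qt_car T) : qlt x y -> above y < above x.
Proof.
move=> xy; apply: proper_card; apply/properP; split.
  by apply/subsetP => z; rewrite !inE => /asboolP h; apply/asboolP; apply: qlt_trans h.
by exists y; rewrite !inE; apply/asboolP => // -[].
Qed.

Lemma below_lt T (x y : qt_car T) : qlt x y -> below x < below y.
Proof.
move=> xy; apply: proper_card; apply/properP; split.
  by apply/subsetP => z; rewrite !inE => /asboolP h; apply/asboolP; apply: qlt_trans xy.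
by exists x; rewrite !inE; apply/asboolP => // -[].
Qed.

(* [tau x] is the term of the subtree above [x]: its root label is [l x] and its subforest is a
   join of the [tau y] with [y] strictly above [x]. *)
Definition valid T (l tau : qt_car T -> fterm) := forall x, exists B,
  [/\ feq (tau x) (N (l x) B), forall y, qlt x y -> fle (tau y) B &
      forall u, istree u -> fle u B -> exists2 y, qlt x y & fle u (tau y)].

Definition bigJ := foldr J E.

Lemma fle_bigJ t s : istree t -> fle t (bigJ s) = has (fle t) s.
Proof. by move=> ht; elim: s => [|x s IH] /=; rewrite ?fle_treeE // fle_treeJ // IH. Qed.

Lemma valid_ex T k (m : nat) (l : qt_car T -> fterm) :
  (forall x, [&& istree (l x), okf k (l x) & rk (l x) <= m]) ->
  exists tau, valid l tau /\ forall x, [&& istree (tau x), okf k (tau x) & rk (tau x) <= m.+1].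
Proof.
move=> hl.
have [tau htau] : exists tau, forall x, tau x = N (l x) (bigJ [seq tau y | y <- enum (qt_car T) & `[< qlt x y >]]).
  have : forall n, exists tau : qt_car T -> fterm, forall x, above x < n ->
      tau x = N (l x) (bigJ [seq tau y | y <- enum (qt_car T) & `[< qlt x y >]]).
    elim=> [|n [tau IH]]; first by exists (fun=> E).
    exists (fun x => if above x < n then tau x else N (l x) (bigJ [seq tau y | y <- enum (qt_car T) & `[< qlt x y >]])).
    move=> x lt; have E : [seq (if above y < n then tau y else
         N (l y) (bigJ [seq tau z | z <- enum (qt_car T) & `[< qlt y z >]])) | y <- enum (qt_car T) & `[< qlt x y >]]
        = [seq tau y | y <- enum (qt_car T) & `[< qlt x y >]].
      apply/eq_in_map => y; rewrite mem_filter => /andP [/asboolP /above_lt h _].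
      by rewrite ifT //; apply: leq_trans h _; rewrite -ltnS.
    by rewrite E; case: ifP => // /IH.
  move/(_ #|qt_car T|.+1) => [tau h]; exists tau => x; apply: h.
  by rewrite ltnS; apply: max_card.
have mem x y : (y \in [seq y <- enum (qt_car T) | `[< qlt x y >]]) = `[< qlt x y >].
  by rewrite mem_filter mem_enum andbT.
exists tau; split=> x.
  exists (bigJ [seq tau y | y <- enum (qt_car T) & `[< qlt x y >]]); split.
  - by rewrite -htau feq_refl.
  - move=> y xy; rewrite htau fle_bigJ // has_map; apply/hasP; exists y; first by rewrite mem; apply/asboolP.
    by rewrite /= -htau fle_refl.
  - move=> u hu; rewrite fle_bigJ // has_map => /hasP [y]; rewrite mem => /asboolP xy h.
    by exists y.
have [n] := ubnP (above x); elim: n x => // n IH x lt.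
rewrite htau /=; have /and3P [-> -> hr] := hl x; rewrite /= geq_max ltnS hr /=.
have : all (fun f => okf k f && (rk f <= m.+1)) [seq tau y | y <- enum (qt_car T) & `[< qlt x y >]].
  rewrite all_map; apply/allP => y; rewrite mem => /asboolP /above_lt h /=.
  by have /and3P [_ -> ->] := IH y (leq_trans h lt).
elim: [seq _ | _ <- _ & _] => //= f s IHs /andP [/andP [-> hf] /IHs /andP [-> hs]] /=.
by rewrite geq_max hf hs.
Qed.

End TreeTerms.

Lemma feq_JC a b g : feq a b -> feq (J g b) (J a g).
Proof.
move=> /andP [ab ba]; rewrite /feq !fleJ.
by repeat (apply/andP; split); eauto using fle_Jl, fle_Jr, fle_refl.
Qed.

Lemma feq_JA a b g : feq (J a (J b g)) (J (J a b) g).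
Proof.
rewrite /feq !fleJ.
by repeat (apply/andP; split); eauto using fle_Jl, fle_Jr, fle_refl.
Qed.

Section Hom.
Variables (Q : Type) (Qle : Q -> Q -> Prop) (T T' : QTree Q).
Variables (l tau : qt_car T -> fterm) (l' tau' : qt_car T' -> fterm).
Hypotheses (V : valid l tau) (V' : valid l' tau').
Hypothesis labE : forall x x', Qle (qt_lab x) (qt_lab x') <-> fle (l x) (l' x').

Lemma valid_mono (U : QTree Q) (m nu : qt_car U -> fterm) x y : valid m nu -> qt_le x y ->
  fle (nu y) (nu x).
Proof.
move=> VU xy; case: (pselect (x = y)) => [->|ne]; first exact: fle_refl.
have [B [e h _]] := VU x.
by rewrite (fle_feqr _ e); apply: fle_N; apply: h.
Qed.

(** Climbing from [x'] as long as the embedding falls into the subforest leads to a node whose label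
    takes that of [x], while everything above [x] still embeds above that node. *)
Lemma valid_step x x' : fle (tau x) (tau' x') -> exists x'', [/\ qt_le x' x'',
  fle (l x) (l' x'') & forall y, qlt x y -> fle (tau y) (tau' x'')].
Proof.
have [n] := ubnP (above x'); elim: n x' => // n IH x' lt.
have [B [e h1 h2]] := V x; have [B' [e' h1' h2']] := V' x'.
rewrite (fle_feql _ e) (fle_feqr _ e') fleNN => /orP [/andP [h3 h4]|].
  exists x'; split=> //; first exact: qt_refl.
  by move=> y /h1 h5; rewrite (fle_feqr _ e'); apply: fle_trans h5 h4.
move/(h2' (N _ _) isT) => [y' xy' h].
have [|x'' [h5 h6 h7]] := IH y' (leq_trans (above_lt xy') lt); first by rewrite (fle_feql _ e).
by exists x''; split=> //; case: xy' => xy' _; apply: qt_trans h5.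
Qed.

Lemma hle_to_fle : hle Qle T T' -> fle (tau (qt_root T)) (tau' (qt_root T')).
Proof.
move=> [phi [mono lab]].
have key x : fle (tau x) (tau' (phi x)).
  have [n] := ubnP (above x); elim: n x => // n IH x lt.
  have [B [e h1 h2]] := V x; have [B' [e' h1' h2']] := V' (phi x).
  rewrite (fle_feql _ e) (fle_feqr _ e') fleNN (proj1 (labE _ _) (lab x)) /=.
  apply/orP; left; apply: fle_trees => u hu /(h2 u hu) [y xy uy].
  rewrite -(fle_feqr _ e'); apply: fle_trans uy _.
  apply: fle_trans (IH y (leq_trans (above_lt xy) lt)) _.
  by apply: valid_mono V' _; apply: mono; case: xy.
by apply: fle_trans (key _) _; apply: valid_mono V' _; apply: qt_root_least.
Qed.

(** Lower cones are chains, so among the elements below [x] the one with the most predecessors is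
    the greatest. *)
Lemma pred_ex (x : qt_car T) : x <> qt_root T ->
  exists p, qlt p x /\ forall z, qlt z x -> qt_le z p.
Proof.
move=> nx; have rx : `[< qlt (qt_root T) x >] by apply/asboolP; split; [apply: qt_root_least|congruence].
pose p := [arg max_(z > qt_root T | `[< qlt z x >]) below z].
have [/asboolP px pmax] : `[< qlt p x >] /\ forall z, `[< qlt z x >] -> below z <= below p.
  by rewrite /p; case: arg_maxnP.
exists p; split=> // z zx; case: (pselect (z = p)) => [->|ne]; first exact: qt_refl.
case: (@qt_cone_chain _ T x z p) => //; [by case: zx|by case: px|].
move=> pz; have /below_lt : qlt p z by split=> // e; case: ne.
by rewrite ltnNge pmax //; apply/asboolP.
Qed.

(** The morphism is built upwards from the root, in the order of [below]: [valid_step] places an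
    element above the image of its immediate predecessor. Besides the label condition, [good] keeps
    room for everything above the element. *)
Lemma fle_to_hle : fle (tau (qt_root T)) (tau' (qt_root T')) -> hle Qle T T'.
Proof.
move=> h0.
pose good phi x := [/\ fle (l x) (l' (phi x)), forall y, qlt x y -> fle (tau y) (tau' (phi x))
  & forall y, qlt y x -> qt_le (phi y) (phi x)].
suff [phi hphi] : exists phi, forall x, good phi x.
  exists phi; split=> [x y xy|x]; last by apply/labE; case: (hphi x).
  case: (pselect (x = y)) => [->|ne]; first exact: qt_refl.
  by have [_ _] := hphi y; apply.
suff /(_ #|qt_car T|.+1) [phi h] : forall n, exists phi, forall x, below x < n -> good phi x.
  by exists phi => x; apply: h; rewrite ltnS; apply: max_card.
elim=> [|n [phi IH]]; first by exists (fun=> qt_root T').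
have step x : exists x'', below x = n -> [/\ fle (l x) (l' x''),
    forall y, qlt x y -> fle (tau y) (tau' x'') & forall y, qlt y x -> qt_le (phi y) x''].
  case: (pselect (below x = n)) => [bx|ne]; last by exists (qt_root T').
  case: (pselect (x = qt_root T)) => [xr|/pred_ex [p [px pmax]]].
    move: h0; rewrite -xr => /valid_step [x'' [_ h1 h2]]; exists x'' => _; split=> // y.
    by move=> [yx]; case; rewrite xr in yx *; apply: qt_antisym (qt_root_least _).
  have bp : below p < n by rewrite -bx; apply: below_lt.
  have [_ /(_ x px) /valid_step [x'' [h1 h2 h3]] h4] := IH p bp.
  exists x'' => _; split=> // y /pmax yp; apply: qt_trans h1.
  case: (pselect (y = p)) => [->|ne]; first exact: qt_refl.
  by apply: h4.
have [psi hpsi] := choice step.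
exists (fun x => if below x < n then phi x else psi x) => x; rewrite ltnS => bx.
have lt y : qlt y x -> below y < n by move=> /below_lt h; apply: leq_trans h bx.
rewrite /good; case: ifP => bx'.
  by have [h1 h2 h3] := IH x bx'; split=> // y yx; rewrite lt //; apply: h3.
have [|h1 h2 h3] := hpsi x; first by move: bx'; lia.
by split=> // y yx; rewrite lt //; apply: h3.
Qed.

End Hom.

Section Graft.
Variables (Q : Type) (T T' : QTree Q).
Let car : finType := (qt_car T + qt_car T')%type.

Definition graft_le (x y : car) := match x, y with
  | inl a, inl b => qt_le a b
  | inr a, inr b => qt_le a b
  | inl a, inr b => a = qt_root T
  | inr a, inl b => False end.

Lemma graft_refl x : graft_le x x.
Proof. by case: x => a; apply: qt_refl. Qed.

Lemma graft_antisym x y : graft_le x y -> graft_le y x -> x = y.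
Proof. by case: x => a; case: y => b //= h1 h2; congr (_ _); apply: qt_antisym. Qed.

Lemma root_min (a : qt_car T) : qt_le a (qt_root T) -> a = qt_root T.
Proof. by move=> h; apply: qt_antisym h (qt_root_least _). Qed.

Lemma graft_trans x y z : graft_le x y -> graft_le y z -> graft_le x z.
Proof.
case: x => a; case: y => b //; case: z => c //=; try exact: qt_trans.
by move=> h ?; subst b; apply: root_min.
Qed.

Lemma graft_root_least x : graft_le (inl (qt_root T)) x.
Proof. by case: x => a //=; apply: qt_root_least. Qed.

Lemma graft_chain x y z : graft_le y x -> graft_le z x -> graft_le y z \/ graft_le z y.
Proof.
case: x => a; case: y => b //; case: z => c //=; try exact: qt_cone_chain.
- by move=> -> _; left; apply: qt_root_least.
- by move=> -> _; left.
- by move=> _ ->; right.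
Qed.

Definition graft : QTree Q := @Build_QTree Q car graft_le graft_refl graft_antisym graft_trans
  (inl (qt_root T)) graft_root_least graft_chain
  (fun x => match x with inl a => qt_lab a | inr b => qt_lab b end).

Variables (l tau : qt_car T -> fterm) (l' tau' : qt_car T' -> fterm).
Hypotheses (V : valid l tau) (V' : valid l' tau').

(** Placing [T'] directly above the root of [T] adds its term to the subforest of the root; the
    terms at all other nodes stay as they were. *)
Lemma graft_valid g : feq (tau (qt_root T)) (N (l (qt_root T)) g) ->
  exists nu, valid (T := graft) (fun x => match x with inl a => l a | inr b => l' b end) nu /\
   feq (nu (qt_root graft)) (N (l (qt_root T)) (J g (tau' (qt_root T')))).
Proof.
move=> eg; have [B [e h1 h2]] := V (qt_root T).
set r' := tau' _; set t := l (qt_root T).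
exists (fun x => match x with inl a => if a == qt_root T then N t (J B r') else tau a
                 | inr b => tau' b end); split; last first.
  rewrite /= eqxx /feq !fleNN !fleJ fle_refl /=.
  have jl h f : fle f (N t (J h f)) by apply: fle_N; apply: fle_Jr; apply: fle_refl.
  have NJ h f : fle (N t h) (N t (J h f)).
    by rewrite fleNN fle_refl fle_N // fle_Jl // fle_refl.
  have BE : feq (N t B) (N t g) by apply: feq_trans eg; rewrite feq_sym.
  have -> : fle B (N t (J g r')).
    apply: fle_trans (NJ g r'); rewrite -(fle_feqr _ BE); apply: fle_N; exact: fle_refl.
  have -> : fle g (N t (J B r')).
    apply: fle_trans (NJ B r'); rewrite (fle_feqr _ BE); apply: fle_N; exact: fle_refl.
  by rewrite !jl.
have qinl a b : qlt (T := graft) (inl a) (inl b) <-> qlt a b.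
  by split=> -[h ne]; split=> //; [move=> eab; apply: ne; rewrite eab|case].
have qinr a b : qlt (T := graft) (inr a) (inr b) <-> qlt a b.
  by split=> -[h ne]; split=> //; [move=> eab; apply: ne; rewrite eab|case].
have nroot a b : qlt a b -> (b == qt_root T) = false.
  move=> [h ne]; apply/eqP => eb; apply: ne; rewrite eb; apply: root_min; by rewrite -eb.
case=> [a|b].
  case: eqP => [->|ne].
    exists (J B r'); split; first exact: feq_refl.
      case=> [y /qinl xy|y _]; first by rewrite (nroot _ _ xy); apply: fle_Jl; apply: h1.
      by apply: fle_Jr; apply: (valid_mono V'); apply: qt_root_least.
    move=> u hu; rewrite fle_treeJ // => /orP [/(h2 u hu) [y xy uy]|h].
      by exists (inl y); [apply/qinl|rewrite (nroot _ _ xy)].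
    by exists (inr (qt_root T')).
  have [B1 [e1 h3 h4]] := V a; exists B1; split=> //.
    by case=> [y /qinl xy|y [/= /ne]] //; rewrite (nroot _ _ xy); apply: h3.
  by move=> u hu /(h4 u hu) [y xy uy]; exists (inl y); [apply/qinl|rewrite (nroot _ _ xy)].
have [B1 [e1 h3 h4]] := V' b; exists B1; split=> //; first by case=> [y [/=]|y /qinr /h3].
by move=> u hu /(h4 u hu) [y xy uy]; exists (inr y) => //; apply/qinr.
Qed.

End Graft.

Fixpoint rep k m : Tk k m -> fterm -> Prop :=
  match m return Tk k m -> fterm -> Prop with
  | 0 => fun i u => feq u (L i)
  | m'.+1 => fun T u => exists l tau, [/\ forall x, rep (qt_lab x) (l x), valid (T := T) l tau
      & feq u (tau (qt_root T))]
  end.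

Lemma rep_le k m (T T' : Tk k m) u u' : rep T u -> rep T' u' -> (Tle T T' <-> fle u u').
Proof.
elim: m T T' u u' => [|m IH] T T' u u'.
  move=> /= e e'; rewrite (fle_feql _ e) (fle_feqr _ e') fleLL.
  by split=> [->|/eqP h]; [apply: eqxx|apply: val_inj].
move=> [l [tau [h1 V e]]] [l' [tau' [h1' V' e']]]; rewrite (fle_feql _ e) (fle_feqr _ e').
have labE x x' : Tle (qt_lab x) (qt_lab x') <-> fle (l x) (l' x').
  exact: IH (h1 x) (h1' x').
by split; [exact: (hle_to_fle V V' labE)|exact: (fle_to_hle V V' labE)].
Qed.

Lemma rep_ex k m (T : Tk k m) : exists u, rep T u /\ [&& istree u, okf k u & rk u <= m].
Proof.
elim: m T => [|m IH] T /=; first by exists (L T); rewrite feq_refl /= ltn_ord.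
have [l hl] := choice (fun x : qt_car T => IH (qt_lab x)).
have [|tau [V htau]] := @valid_ex _ T k m l; first by move=> x; case: (hl x).
exists (tau (qt_root T)); split=> //; exists l, tau; split=> //; last exact: feq_refl.
by move=> x; case: (hl x).
Qed.

(** A leaf is equivalent to the node it labels, so a term survives the embeddings; thus one kind of
    term serves all levels and the direct limit. *)
Lemma rep_emb k m (T : Tk k m) u : rep T u -> rep (emb T) u.
Proof.
elim: m T u => [|m IH] T u /=.
  move=> e; exists (fun=> L T), (fun=> L T); split=> //; first by move=> _; apply: feq_refl.
  move=> x; exists E; split; first by rewrite /feq fleNL fleLN !fleLL !eqxx.
    by move=> y [_ []]; case: x; case: y.
  by move=> v hv; rewrite fle_treeE.
move=> [l [tau [h1 V e]]]; exists l, tau; split=> // x; exact: IH.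
Qed.

Lemma rep_lift k m d (T : Tk k m) u : rep T u -> rep (Defs.lift d T) u.
Proof. by move=> h; elim: d => //= d IH; apply: rep_emb. Qed.

Lemma rep_cast k m m' (e : m = m') (T : Tk k m) u : rep T u -> rep (eq_rect _ (Tk k) T _ e) u.
Proof. by case: m' / e. Qed.

(** For [N t f] one starts from a single node labelled [t] and grafts the trees of [f] one at a
    time; [g] in [main] is the part already grafted. *)
Lemma rep_surj k m u : [&& istree u, okf k u & rk u <= m] -> exists T : Tk k m, rep T u.
Proof.
have [n] := ubnP (fsize u); elim: n m u => // n IH m u hn /and3P [].
case: u hn => [|i|t f|f g] // hn _.
  move=> /= hi _; elim: m => [|m [T hT]]; first by exists (Ordinal hi); apply: feq_refl.
  by exists (emb T); apply: rep_emb.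
case: m => [|m]; first by move=> _ /=; lia.
move=> /= /and3P [ht hkt hkf]; rewrite geq_max ltnS => /andP [hrt hrf].
have [||T0 hT0] := IH m t; [by move: hn => /=; lia|by rewrite ht hkt hrt|].
have NJ h1 h2 : feq h1 h2 -> feq (N t h1) (N t h2).
  by move=> /andP [a b]; rewrite /feq !fleNN !fle_refl !fle_N.
suff main : forall f g, fsize f < n -> okf k f -> rk f <= m.+1 -> 
    (exists (T : Tk k m.+1) l tau, [/\ forall x, rep (qt_lab x) (l x), valid (T := T) l tau,
       l (qt_root T) = t & feq (tau (qt_root T)) (N t g)]) ->
    (exists (T : Tk k m.+1) l tau, [/\ forall x, rep (qt_lab x) (l x), valid (T := T) l tau,
       l (qt_root T) = t & feq (tau (qt_root T)) (N t (J f g))]).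
  have [|//|//||T [l [tau [h1 h2 _ e]]]] := main f E.
  - by move: hn => /=; lia.
  - exists (single_tree T0), (fun=> t), (fun=> N t E); split=> //; last exact: feq_refl.
    move=> x; exists E; split; first exact: feq_refl.
      by move=> y [_ []]; case: x; case: y.
    by move=> v hv; rewrite fle_treeE.
  exists T; exists l, tau; split=> //; rewrite feq_sym; apply: feq_trans e _.
  by apply: NJ; rewrite /feq fleJ fle_refl fle_Jl ?fle_refl.
elim=> [|i|t1 _ f1 _|f1 IH1 f2 IH2] g hf hk hr [T [l [tau [h1 h2 h3 h4]]]].
- exists T, l, tau; split=> //; apply: feq_trans h4 (NJ _ _ _).
  by rewrite /feq fleJ fle_refl fle_Jr ?fle_refl.
- have [|T' [l' [tau' [h1' h2' e']]]] := IH m.+1 (L i) hf; first by apply/and3P.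
  have [|nu [Vn en]] := graft_valid h2 h2' (g := g); first by rewrite h3.
  exists (graft T T'); eexists; exists nu; split; [|exact: Vn|exact: h3|].
    by case.
  apply: feq_trans en _; rewrite h3; apply: NJ.
  exact: feq_JC.
- have [|T' [l' [tau' [h1' h2' e']]]] := IH m.+1 (N t1 f1) hf; first by apply/and3P.
  have [|nu [Vn en]] := graft_valid h2 h2' (g := g); first by rewrite h3.
  exists (graft T T'); eexists; exists nu; split; [|exact: Vn|exact: h3|].
    by case.
  apply: feq_trans en _; rewrite h3; apply: NJ.
  exact: feq_JC.
- move: hf hk hr => /= hf /andP [hk1 hk2]; rewrite geq_max => /andP [hr1 hr2].
  have [||||T1 [l1 [tau1 [a1 a2 a3 a4]]]] := IH2 g; [lia|by []|by []|by exists T, l, tau|].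
  have [||||T2 [l2 [tau2 [b1 b2 b3 b4]]]] := IH1 (J f2 g); [lia|by []|by []|by exists T1, l1, tau1|].
  exists T2, l2, tau2; split=> //; apply: feq_trans b4 (NJ _ _ _).
  exact: feq_JA.
Qed.

(** * Satisfaction over terms *)

Section Transfer.
Variable X : Type.
Variable R : X -> X -> Prop.

(* Satisfaction in the poset quotient of a preorder, without forming the quotient. *)
Fixpoint gsat (rho : nat -> X) (f : pform) : Prop :=
  match f with
  | PLe i j => R (rho i) (rho j)
  | PEq i j => R (rho i) (rho j) /\ R (rho j) (rho i)
  | PNot a => ~ gsat rho a
  | PAnd a b => gsat rho a /\ gsat rho b
  | POr a b => gsat rho a \/ gsat rho b
  | PImp a b => gsat rho a -> gsat rho b
  | PAll a => forall x, gsat (scons x rho) a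
  | PEx a => exists x, gsat (scons x rho) a
  end.

Lemma gsat_ext n r r' f : (forall i, i < n -> r i = r' i) -> pbound n f -> (gsat r f <-> gsat r' f).
Proof.
elim: f n r r' => /= [i j|i j|f IH|f If g Ig|f If g Ig|f If g Ig|f IH|f IH] n r r' h.
- by case=> /h -> /h ->.
- by case=> /h -> /h ->.
- by move/(IH _ _ _ h) => ->.
- by case=> /(If _ _ _ h) -> /(Ig _ _ _ h) ->.
- by case=> /(If _ _ _ h) -> /(Ig _ _ _ h) ->.
- by case=> /(If _ _ _ h) -> /(Ig _ _ _ h) ->.
- have h' x i : i < n.+1 -> scons x r i = scons x r' i by case: i => //= i /h.
  by move=> hf; split=> H x; apply/(IH _ _ _ (h' x) hf).
- have h' x i : i < n.+1 -> scons x r i = scons x r' i by case: i => //= i /h.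
  by move=> hf; split=> -[x H]; exists x; apply/(IH _ _ _ (h' x) hf).
Qed.

Lemma psat_gsat r f : (forall x y, R x y -> R y x -> x = y) -> (forall x, R x x) ->
  (psat R r f <-> gsat r f).
Proof.
move=> anti refl; elim: f r => /= [i j|i j|f IH|f If g Ig|f If g Ig|f If g Ig|f IH|f IH] r //.
- by split=> [->|[/anti h /h]].
- by rewrite IH.
- by rewrite If Ig.
- by rewrite If Ig.
- by rewrite If Ig.
- by split=> h x; apply/IH.
- by split=> -[x h]; exists x; apply/IH.
Qed.

End Transfer.

Lemma gsat_transfer X Y (R : X -> X -> Prop) (R' : Y -> Y -> Prop) (sim : X -> Y -> Prop) f r r' :
  (forall x, exists y, sim x y) -> (forall y, exists x, sim x y) ->
  (forall x y x' y', sim x y -> sim x' y' -> (R x x' <-> R' y y')) ->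
  (forall i, sim (r i) (r' i)) -> (gsat R r f <-> gsat R' r' f).
Proof.
move=> h1 h2 h3; elim: f r r' => /= [i j|i j|f IH|f If g Ig|f If g Ig|f If g Ig|f IH|f IH] r r' h.
- exact: h3.
- by rewrite !(h3 _ _ _ _ (h _) (h _)).
- by rewrite (IH r r').
- by rewrite (If r r') // (Ig r r').
- by rewrite (If r r') // (Ig r r').
- by rewrite (If r r') // (Ig r r').
- split=> H; [move=> y; have [x xy] := h2 y|move=> x; have [y xy] := h1 x].
    by apply/(IH (scons x r)) => [[]|//].
  by apply/(IH _ (scons y r')) => [[]|//].
- split=> -[]; [move=> x H; have [y xy] := h1 x; exists y|move=> y H; have [x xy] := h2 y; exists x].
    by apply/(IH (scons x r)) => [[]|//].
  by apply/(IH _ (scons y r')) => [[]|//].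
Qed.

(** * The quotient poset presented by terms *)

Definition okn k n u := okf k u && (if n is ofin m then rk u <= m else true).
Definition pst k n := {u : fterm | okn k n u && ~~ fle u E}.
Definition Pst k n u (h : okn k n u && ~~ fle u E) : pst k n := exist _ u h.
Definition pst_le k n (x y : pst k n) : Prop := fle (sval x) (sval y).

Section Presentation.
Variables (k : nat) (n : onat).

Definition repn : Tn k n -> fterm -> Prop :=
  match n return Tn k n -> fterm -> Prop with
  | ofin m => @rep k m
  | oomega => fun T u => rep (projT2 T) u
  end.

Lemma repn_le T T' u u' : repn T u -> repn T' u' -> (Tn_le T T' <-> fle u u').
Proof.
rewrite /repn; case: n T T' => [m|] T T'; first exact: rep_le.
move=> h h'; rewrite /= /Tomega_le; apply: rep_le; first exact: rep_lift.
by apply: rep_cast; apply: rep_lift.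
Qed.

Lemma repn_ex T : exists u, repn T u /\ istree u && okn k n u.
Proof.
rewrite /repn /okn; case: n T => [m|] T.
  exact: rep_ex T.
by have [u [h /and3P [a b _]]] := rep_ex (projT2 T); exists u; rewrite a b.
Qed.

Lemma repn_surj u : istree u -> okn k n u -> exists T, repn T u.
Proof.
rewrite /okn /repn => ht /andP [hk]; case: n => [m hr|_].
  by have [|T hT] := @rep_surj k m u; [rewrite ht hk hr|exists T].
have [|T hT] := @rep_surj k (rk u) u; first by rewrite ht hk leqnn.
by exists (existT _ _ T).
Qed.

(** Together the clauses say that the trees below [u] are, up to representation, those below a
    member of [S]. *)
Definition repS (S : Fk k n) u :=
  (forall T, sval S T -> exists v, [/\ repn T v, istree v & fle v u]) /\
  (forall v, istree v -> fle v u -> exists T w, [/\ sval S T, repn T w & fle v w]).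

Lemma repS_le S S' u u' : repS S u -> repS S' u' -> (Fk_le S S' <-> fle u u').
Proof.
move=> [h1 h2] [h1' h2']; split=> [h|h].
  apply: fle_trees => t ht tu.
  have [T [w [TS Tw tw]]] := h2 t ht tu.
  have [T' [TS' TT']] := h T TS.
  have [w' [Tw' _ wu']] := h1' T' TS'.
  by apply: fle_trans wu'; apply: fle_trans tw _; apply/(repn_le Tw Tw').
move=> T TS; have [v [Tv hv vu]] := h1 T TS.
have [T' [w [TS' Tw vw]]] := h2' v hv (fle_trans vu h).
by exists T'; split=> //; apply/(repn_le Tv Tw).
Qed.

Lemma repS_ex S : exists u, repS S u /\ okn k n u && ~~ fle u E.
Proof.
case: S => S [l [lnil Sl]]; rewrite /repS /=.
have [u [h1 h2 h3]] : exists u, [/\ forall T, List.In T l -> exists v, [/\ repn T v, istree v & fle v u],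
   forall v, istree v -> fle v u -> exists T w, [/\ List.In T l, repn T w & fle v w] &
   okn k n u && (~~ fle u E || ~~ (0 < size l))].
  elim: l {lnil Sl} => [|T l [u [h1 h2 h3]]].
    exists E; split=> //; first by move=> v hv; rewrite fle_treeE.
    by rewrite /okn /=; case: n.
  have [v [Tv /andP [tv okv]]] := repn_ex T; exists (J v u); split.
  - move=> T' /= [<-|/h1 [w [a b c]]]; first by exists v; split=> //; apply: fle_Jl; apply: fle_refl.
    by exists w; split=> //; apply: fle_Jr.
  - move=> w hw; rewrite fle_treeJ // => /orP [wv|/(h2 w hw) [T' [w' [a b c]]]].
      by exists T, v; split=> //; left.
    by exists T', w'; split=> //; right.
  - rewrite fleJ (fle_treeE tv) /=; move: okv h3; rewrite /okn => /andP [okv rv] /andP [/andP [oku ru] _].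
    by rewrite /= okv oku /=; case: (n) rv ru => //= m rv ru; rewrite geq_max rv ru.
exists u; split; first split.
- by move=> T /Sl /h1.
- by move=> v hv /(h2 v hv) [T [w [/Sl a b c]]]; exists T, w.
- by move: h3; case: (l) lnil => // a s _; rewrite orbF.
Qed.

Lemma repS_surj u : okn k n u && ~~ fle u E -> exists S, repS S u.
Proof.
move=> /andP [oku uE].
have [l [h1 h2]] : exists l, (forall T, List.In T l -> exists v, [/\ repn T v, istree v & fle v u]) /\
   (forall v, istree v -> fle v u -> exists T w, [/\ List.In T l, repn T w & fle v w]).
  elim: u oku {uE} => [|i|t _ f _|f If g Ig] ok.
  - by exists nil; split=> // v hv; rewrite fle_treeE.
  - have [T hT] := repn_surj (u := L i) isT ok; exists [:: T]; split=> [_ [<-|//]|v hv le].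
      by exists (L i); split=> //; apply: fle_refl.
    by exists T, (L i); split=> //; left.
  - have [T hT] := repn_surj (u := N t f) isT ok; exists [:: T]; split=> [_ [<-|//]|v hv le].
      by exists (N t f); split=> //; apply: fle_refl.
    by exists T, (N t f); split=> //; left.
  have [okl okr] : okn k n f /\ okn k n g.
    by move: ok; rewrite /okn /= => /andP [/andP [-> ->]]; case: (n) => // m; rewrite geq_max => /andP [-> ->].
  have [l1 [a1 a2]] := If okl; have [l2 [b1 b2]] := Ig okr.
  exists (l1 ++ l2)%list; split=> [T|v hv].
    by move/List.in_app_iff => [/a1|/b1] [v [c1 c2 c3]]; exists v; split=> //; [apply: fle_Jl|apply: fle_Jr].
  rewrite fle_treeJ // => /orP [/(a2 v hv)|/(b2 v hv)] [T [w [c1 c2 c3]]]; exists T, w; split=> //;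
    apply/List.in_app_iff; by [left|right].
have lnil : l <> nil.
  move=> e; move/negP: uE; apply; apply: fle_trees => t ht /(h2 t ht) [T [w []]].
  by rewrite e.
by exists (exist _ (fun T => List.In T l) (ex_intro _ l (conj lnil (fun T => iff_refl _)))).
Qed.

Definition repF (A : FFk k n) (x : pst k n) := exists2 S, sval A S & repS S (sval x).

Lemma FFk_class (A : FFk k n) S S' : sval A S -> (sval A S' <-> Fk_le S S' /\ Fk_le S' S).
Proof.
case: A => A [S0 h] /= /h [h1 h2]; rewrite h.
have [u [r0 _]] := repS_ex S0; have [v [r1 _]] := repS_ex S; have [w [r2 _]] := repS_ex S'.
move: h1 h2; rewrite (repS_le r0 r1) (repS_le r1 r0) (repS_le r0 r2) (repS_le r2 r0)
  (repS_le r1 r2) (repS_le r2 r1) => h1 h2.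
by split=> -[h3 h4]; split; [apply: fle_trans h2 _|apply: fle_trans h4 _|
   apply: fle_trans h1 _|apply: fle_trans h4 _].
Qed.

Lemma repF_le A B x y : repF A x -> repF B y -> (FFk_le A B <-> pst_le x y).
Proof.
move=> [S AS r] [S' BS' r']; rewrite /pst_le -(repS_le r r'); split=> [[S1 [S2 [h1 [h2 h]]]]|h].
  have /(FFk_class _ AS) [a b] := h1; have /(FFk_class _ BS') [c d] := h2.
  have [u1 [r1 _]] := repS_ex S1; have [u2 [r2 _]] := repS_ex S2.
  move: a b c d h; rewrite (repS_le r r') (repS_le r r1) (repS_le r1 r) (repS_le r' r2)
    (repS_le r2 r') (repS_le r1 r2) => a _ _ d h.
  by apply: fle_trans a _; apply: fle_trans h d.
by exists S, S'.
Qed.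

Lemma repF_ex A : exists x, repF A x.
Proof.
case: A => A [S h]; have [u [r hu]] := repS_ex S.
exists (exist _ u hu), S => //; apply/h; split; apply/(repS_le r r); exact: fle_refl.
Qed.

Lemma repF_surj x : exists A, repF A x.
Proof.
case: x => u hu; have [S r] := repS_surj hu.
have h : exists x, forall y, (fun S' => Fk_le S S' /\ Fk_le S' S) y <-> Fk_le x y /\ Fk_le y x by exists S.
pose A : FFk k n := exist _ (fun S' => Fk_le S S' /\ Fk_le S' S) h.
exists A, S => //=; split; apply/(repS_le r r); exact: fle_refl.
Qed.

Lemma FFk_le_refl (A : FFk k n) : FFk_le A A.
Proof. by have [x r] := repF_ex A; apply/(repF_le r r); apply: fle_refl. Qed.

Lemma FFk_le_anti (A B : FFk k n) : FFk_le A B -> FFk_le B A -> A = B.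
Proof.
have [x ra] := repF_ex A; have [y rb] := repF_ex B.
move=> /(repF_le ra rb) xy /(repF_le rb ra) yx.
case: ra => S AS r; case: rb => S' BS' r'.
suff e : sval A = sval B.
  by move: e; clear; case: A => A hA; case: B => B hB /= e; apply: eq_exist.
apply/funext => S1; apply/propext.
rewrite (FFk_class _ AS) (FFk_class _ BS').
have [u1 [r1 _]] := repS_ex S1.
rewrite (repS_le r r1) (repS_le r1 r) (repS_le r' r1) (repS_le r1 r').
by split=> -[h3 h4]; split; [apply: fle_trans yx _|apply: fle_trans h4 _|
   apply: fle_trans xy _|apply: fle_trans h4 _].
Qed.

(** The relation [repF] is total, surjective and respects the order, hence preserves truth; the
    valuation is arbitrary because [f] is a sentence. *)
Lemma Th_posetE f r : pbound 0 f ->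
  (Th_poset (@FFk_le k n) (pcode f) <-> gsat (@pst_le k n) r f).
Proof.
move=> hf.
have [r0 hr0] := choice (fun i => repF_surj (r i)).
have key : gsat (@FFk_le k n) r0 f <-> gsat (@pst_le k n) r f.
  by apply: (gsat_transfer (sim := repF)); [apply: repF_ex|apply: repF_surj|move=> *; apply: repF_le|].
rewrite -key; split=> [[f' [_ [/pcode_inj -> h]]]|h].
  by apply/psat_gsat => //; [apply: FFk_le_anti|apply: FFk_le_refl].
exists f; split=> //; split=> // r1.
apply/psat_gsat; [exact: FFk_le_anti|exact: FFk_le_refl|].
by apply/(@gsat_ext _ _ 0 r1 r0).
Qed.

End Presentation.

(** * Codes of sentences *)

Lemma C_max : C2 maxn.
Proof. by rewrite /maxn; ctac. Qed.
#[export] Hint Resolve C_max : cdb.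

Lemma ltn_csnd z : 0 < cfst z -> csnd z < z.
Proof. by move=> h; rewrite -{2}(cpairK z); apply: ltn_cpair_r. Qed.

Section RecTools.
Implicit Types f : nat -> nat.
Lemma csnd_lt z f f' : (forall c', c' < z -> f c' = f' c') -> 0 < cfst z ->
  [/\ f (csnd z) = f' (csnd z), f (cfst (csnd z)) = f' (cfst (csnd z)) &
      f (csnd (csnd z)) = f' (csnd (csnd z))].
Proof.
move=> h /ltn_csnd lt; split; apply: h => //.
  exact: leq_ltn_trans (leq_cfst _) lt.
exact: leq_ltn_trans (leq_csnd _) lt.
Qed.
End RecTools.

Definition fb2 f c := if (f (cfst c) == 0) || (f (csnd c) == 0) then 0
  else maxn (f (cfst c)) (f (csnd c)).

(** The value is 0 at numbers that code no formula, and otherwise one more than the least bound on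
    the free variables; [.-2.+1] lowers this bound by one, stopping at 0. *)
Definition pfbG f c :=
  if cfst c <= 1 then (maxn (cfst (csnd c)).+1 (csnd (csnd c)).+1).+1
  else if cfst c == 2 then f (csnd c)
  else if cfst c <= 5 then fb2 f (csnd c)
  else if cfst c <= 7 then if f (csnd c) == 0 then 0 else (f (csnd c)).-2.+1 else 0.

Lemma pfb_ex : exists F, C1 F /\ forall c, F c = pfbG F c.
Proof.
apply: rec1; first by rewrite /pfbG /fb2; ctac.
move=> c f f' ff'; rewrite /pfbG /fb2; case: leqP => // h.
have [|-> -> ->] := csnd_lt ff'; [by lia|by []].
Qed.

Fixpoint pbnd f := match f with
  | PLe i j | PEq i j => maxn i.+1 j.+1
  | PNot a => pbnd a
  | PAnd a b | POr a b | PImp a b => maxn (pbnd a) (pbnd b)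
  | PAll a | PEx a => (pbnd a).-1 end.

Lemma pbndP n f : pbound n f <-> pbnd f <= n.
Proof.
elim: f n => [i j|i j|f IH|f If g Ig|f If g Ig|f If g Ig|f IH|f IH] n /=;
  rewrite ?IH ?If ?Ig ?geq_max; try (by split=> [[-> ->]|/andP]); lia.
Qed.

Section Pfb.
Variables (F : nat -> nat) (FE : forall c, F c = pfbG F c).

Lemma pfb_code f : F (pcode f) = (pbnd f).+1.
Proof.
elim: f => [i j|i j|f IH|f If g Ig|f If g Ig|f If g Ig|f IH|f IH] /=;
  rewrite FE /pfbG /fb2 !cfst_cpair !csnd_cpair ?cfst_cpair ?csnd_cpair ?IH ?If ?Ig //=;
  by rewrite maxnSS.
Qed.

Lemma pfb_valid c : 0 < F c -> exists f, pcode f = c.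
Proof.
elim/ltn_ind: c => c IH; rewrite FE /pfbG /fb2 -[in X in _ -> X](cpairK c).
have lt2 : 1 < cfst c -> csnd c < c by move=> h; apply: ltn_csnd; lia.
have l1 : 1 < cfst c -> cfst (csnd c) < c by move=> /lt2; apply: leq_ltn_trans (leq_cfst _).
have l2 : 1 < cfst c -> csnd (csnd c) < c by move=> /lt2; apply: leq_ltn_trans (leq_csnd _).
move: (cfst c) lt2 l1 l2 => t; case: t => [|[|t]] lt2 l1 l2 /=.
- by exists (PLe (cfst (csnd c)) (csnd (csnd c))); rewrite /= cpairK.
- by exists (PEq (cfst (csnd c)) (csnd (csnd c))); rewrite /= cpairK.
have {}lt2 := lt2 isT; have {}l1 := l1 isT; have {}l2 := l2 isT.
case: t => [|t] /=; first by move/(IH _ lt2) => [f <-]; exists (PNot f).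
have IH2 : 0 < (if (F (cfst (csnd c)) == 0) || (F (csnd (csnd c)) == 0) then 0
        else maxn (F (cfst (csnd c))) (F (csnd (csnd c)))) ->
    exists f g, csnd c = cpair (pcode f) (pcode g).
  case: eqP => //= n1; case: eqP => //= n2 _.
  have [|f ef] := IH _ l1; first by lia.
  have [|g eg] := IH _ l2; first by lia.
  by exists f, g; rewrite ef eg cpairK.
case: t => [/IH2 [f [g ->]]|t]; first by exists (PAnd f g).
case: t => [/IH2 [f [g ->]]|t]; first by exists (POr f g).
case: t => [/IH2 [f [g ->]]|t]; first by exists (PImp f g).
case: t => [|t] /=.
  by case: eqP => // n1 _; have [|f <-] := IH _ lt2; [lia|exists (PAll f)].
case: t => [|t] //=.
by case: eqP => // n1 _; have [|f <-] := IH _ lt2; [lia|exists (PEx f)].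
Qed.

Lemma pfb_closed c : F c == 1 <-> exists2 f, pbound 0 f & pcode f = c.
Proof.
split=> [/eqP h|[f /pbndP hf <-]]; last by rewrite pfb_code; move: hf; rewrite leqn0.
have [|f e] := @pfb_valid c; first by rewrite h.
by exists f => //; apply/pbndP; move: h; rewrite -e pfb_code; lia.
Qed.
End Pfb.

Definition tfbG f c := if cfst c == 0 then (csnd c).+2
  else if cfst c <= 2 then fb2 f (csnd c) else 0.

Lemma tfb_ex : exists F, C1 F /\ forall c, F c = tfbG F c.
Proof.
apply: rec1; first by rewrite /tfbG /fb2; ctac.
move=> c f f' ff'; rewrite /tfbG /fb2; case: eqP => // h.
have [|_ -> ->] := csnd_lt ff'; [by lia|by []].
Qed.

Fixpoint tbnd t := match t with AVar i => i.+1 | AAdd a b | AMul a b => maxn (tbnd a) (tbnd b) end.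

Lemma tbndP n t : tbound n t <-> tbnd t <= n.
Proof.
by elim: t => [i|f If g Ig|f If g Ig] //=; rewrite If Ig geq_max; split=> [[-> ->]|/andP].
Qed.

Fixpoint abnd f := match f with
  | AEq t u => maxn (tbnd t) (tbnd u)
  | ANot a => abnd a
  | AAnd a b | AOr a b | AImp a b => maxn (abnd a) (abnd b)
  | AAll a | AEx a => (abnd a).-1 end.

Lemma abndP n f : abound n f <-> abnd f <= n.
Proof.
elim: f n => [t u|f IH|f If g Ig|f If g Ig|f If g Ig|f IH|f IH] n /=;
  rewrite ?IH ?If ?Ig ?tbndP ?geq_max; try (by split=> [[-> ->]|/andP]); lia.
Qed.

Section Afb.
Variables (T : nat -> nat) (TC : C1 T) (TE : forall c, T c = tfbG T c).

Lemma tfb_code t : T (tcode t) = (tbnd t).+1.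
Proof.
elim: t => [i|f If g Ig|f If g Ig] /=;
  rewrite TE /tfbG /fb2 !cfst_cpair !csnd_cpair ?cfst_cpair ?csnd_cpair ?If ?Ig //=;
  by rewrite maxnSS.
Qed.

Lemma tfb_valid c : 0 < T c -> exists t, tcode t = c.
Proof.
elim/ltn_ind: c => c IH; rewrite TE /tfbG /fb2 -[in X in _ -> X](cpairK c).
have l1 : 0 < cfst c -> cfst (csnd c) < c by move=> /ltn_csnd; apply: leq_ltn_trans (leq_cfst _).
have l2 : 0 < cfst c -> csnd (csnd c) < c by move=> /ltn_csnd; apply: leq_ltn_trans (leq_csnd _).
move: (cfst c) l1 l2 => [|t] l1 l2 /=; first by exists (AVar (csnd c)).
have {}l1 := l1 isT; have {}l2 := l2 isT.
have IH2 : 0 < (if (T (cfst (csnd c)) == 0) || (T (csnd (csnd c)) == 0) then 0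
        else maxn (T (cfst (csnd c))) (T (csnd (csnd c)))) ->
    exists f g, csnd c = cpair (tcode f) (tcode g).
  case: eqP => //= n1; case: eqP => //= n2 _.
  have [|f ef] := IH _ l1; first by lia.
  have [|g eg] := IH _ l2; first by lia.
  by exists f, g; rewrite ef eg cpairK.
case: t => [/IH2 [f [g ->]]|t]; first by exists (AAdd f g).
by case: t => [/IH2 [f [g ->]]|t] //; exists (AMul f g).
Qed.

Definition afbG f c :=
  if cfst c == 0 then fb2 T (csnd c)
  else if cfst c == 1 then f (csnd c)
  else if cfst c <= 4 then fb2 f (csnd c)
  else if cfst c <= 6 then if f (csnd c) == 0 then 0 else (f (csnd c)).-2.+1 else 0.

Lemma afb_ex : exists F, C1 F /\ forall c, F c = afbG F c.
Proof.
apply: rec1; first by rewrite /afbG /fb2; ctac.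
move=> c f f' ff'; rewrite /afbG /fb2; case: eqP => // h.
have [|-> -> ->] := csnd_lt ff'; [by lia|by []].
Qed.

Variables (F : nat -> nat) (FE : forall c, F c = afbG F c).

Lemma afb_code f : F (acode f) = (abnd f).+1.
Proof.
elim: f => [t u|f IH|f If g Ig|f If g Ig|f If g Ig|f IH|f IH] /=;
  rewrite FE /afbG /fb2 !cfst_cpair !csnd_cpair ?cfst_cpair ?csnd_cpair ?IH ?If ?Ig ?tfb_code //=;
  by rewrite maxnSS.
Qed.

Lemma afb_valid c : 0 < F c -> exists f, acode f = c.
Proof.
elim/ltn_ind: c => c IH; rewrite FE /afbG -[in X in _ -> X](cpairK c).
have lt2 : 0 < cfst c -> csnd c < c by exact: ltn_csnd.
have l1 : 0 < cfst c -> cfst (csnd c) < c by move=> /lt2; apply: leq_ltn_trans (leq_cfst _).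
have l2 : 0 < cfst c -> csnd (csnd c) < c by move=> /lt2; apply: leq_ltn_trans (leq_csnd _).
move: (cfst c) lt2 l1 l2 => t; case: t => [|t] lt2 l1 l2 /=.
  rewrite /fb2; case: eqP => //= n1; case: eqP => //= n2 _.
  have [|f ef] := @tfb_valid (cfst (csnd c)); first by lia.
  have [|g eg] := @tfb_valid (csnd (csnd c)); first by lia.
  by exists (AEq f g); rewrite /= ef eg cpairK.
have {}lt2 := lt2 isT; have {}l1 := l1 isT; have {}l2 := l2 isT.
case: t => [|t] /=; first by move/(IH _ lt2) => [f <-]; exists (ANot f).
have IH2 : 0 < fb2 F (csnd c) -> exists f g, csnd c = cpair (acode f) (acode g).
  rewrite /fb2; case: eqP => //= n1; case: eqP => //= n2 _.
  have [|f ef] := IH _ l1; first by lia.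
  have [|g eg] := IH _ l2; first by lia.
  by exists f, g; rewrite ef eg cpairK.
case: t => [/IH2 [f [g ->]]|t]; first by exists (AAnd f g).
case: t => [/IH2 [f [g ->]]|t]; first by exists (AOr f g).
case: t => [/IH2 [f [g ->]]|t]; first by exists (AImp f g).
case: t => [|t] /=.
  by case: eqP => // n1 _; have [|f <-] := IH _ lt2; [lia|exists (AAll f)].
case: t => [|t] //=.
by case: eqP => // n1 _; have [|f <-] := IH _ lt2; [lia|exists (AEx f)].
Qed.

Lemma afb_closed c : F c == 1 <-> exists2 f, abound 0 f & acode f = c.
Proof.
split=> [/eqP h|[f /abndP hf <-]]; last by rewrite afb_code; move: hf; rewrite leqn0.
have [|f e] := @afb_valid c; first by rewrite h.
by exists f => //; apply/abndP; move: h; rewrite -e afb_code; lia.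
Qed.
End Afb.

Lemma closed_pform_C1 : exists b : nat -> bool, C1 b /\ forall c, b c <-> exists2 f, pbound 0 f & pcode f = c.
Proof.
have [F [FC FE]] := pfb_ex; exists (fun c => F c == 1); split; first by ctac.
exact: pfb_closed.
Qed.

Lemma closed_aform_C1 : exists b : nat -> bool, C1 b /\ forall c, b c <-> exists2 f, abound 0 f & acode f = c.
Proof.
have [T [TC TE]] := tfb_ex; have [F [FC FE]] := afb_ex TC; exists (fun c => F c == 1).
by split; [ctac|apply: (afb_closed TE)].
Qed.

(* A reduction becomes injective and increasing by adding to the sentence for [x] a true conjunct
   with [x.+1] quantifiers. *)
Definition pad q a x := nat_rect (fun=> nat) a (fun _ c => cpair q c) x.+1.

Lemma pad_lt q a x y : 0 < q -> x < y -> pad q a x < pad q a y.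
Proof.
move=> hq; rewrite /pad; elim: y => // y IH; rewrite ltnS leq_eqVlt => /orP [/eqP ->|/IH h].
  exact: ltn_cpair_r.
by apply: ltn_trans h _; apply: ltn_cpair_r.
Qed.

Lemma pad_gt q a x : 0 < q -> x < pad q a x.
Proof.
move=> hq; elim: x => [|x IH]; last by apply: leq_ltn_trans IH _; apply: pad_lt.
by apply: leq_ltn_trans (leq0n _) _; apply: (ltn_cpair_r a hq).
Qed.

Lemma pad_inj q a : 0 < q -> injective (pad q a).
Proof. by move=> hq x y e; case: (ltngtP x y) => // /(pad_lt a hq); rewrite e ltnn. Qed.

Section Padding.
Variables (Th : nat -> Prop) (q a conj : nat) (h : nat -> nat) (A : nat -> Prop).
Hypotheses (q_gt0 : 0 < q) (hC : C1 h) (Ah : forall x, A x <-> Th (h x)).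
Hypothesis conjE : forall x y, Th (cpair conj (cpair x y)) <-> Th x /\ Th y.
Hypothesis padT : forall x, Th (pad q a x).

Lemma pad_reduction : exists f, [/\ C1 f, injective f, forall x, x < f x & forall x, A x <-> Th (f x)].
Proof.
exists (fun x => cpair conj (cpair (h x) (pad q a x))); split.
- by rewrite /pad; ctac.
- by move=> x y /cpair_inj [_ /cpair_inj [_ /(pad_inj q_gt0)]].
- move=> x; apply: leq_trans (pad_gt a x q_gt0) _.
  by apply: leq_trans (leq_cpair_r _ _) (leq_cpair_r _ _).
- by move=> x; rewrite conjE -Ah; split=> [|[]].
Qed.
End Padding.

Lemma arith_pad A h : C1 h -> (forall x, A x <-> Th_arith (h x)) ->
  exists f, [/\ C1 f, injective f, forall x, x < f x & forall x, A x <-> Th_arith (f x)].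
Proof.
move=> hC Ah; apply: (@pad_reduction Th_arith 5 (acode (AEq (AVar 0) (AVar 0))) 2 h) => //.
  move=> x y; split=> [[f [hf [e hs]]]|[[f [hf [<- h1]]] [g [hg [<- h2]]]]].
    case: f hf e hs => [? ?|?|f g|? ?|? ?|?|?] /= hf /cpair_inj [] // _ /cpair_inj [<- <-] hs.
    by case: hf => hf hg; split; [exists f|exists g]; split=> //; split=> // r; case: (hs r).
  by exists (AAnd f g); split=> //; split=> // r; split.
move=> x; pose F := nat_rect (fun=> aform) (AEq (AVar 0) (AVar 0)) (fun _ f => AAll f).
have Fb m : abound 1 (F m) by elim: m => //= m; rewrite !abndP; lia.
exists (F x.+1); split; first exact: Fb; split=> [|r].
  by rewrite /pad; elim: x.+1 => //= m ->.
by elim: x.+1 r => //= m IH r z.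
Qed.

Lemma poset_pad X (R : X -> X -> Prop) A h : C1 h -> (forall x, A x <-> Th_poset R (h x)) ->
  exists f, [/\ C1 f, injective f, forall x, x < f x & forall x, A x <-> Th_poset R (f x)].
Proof.
move=> hC Ah; apply: (@pad_reduction (Th_poset R) 6 (pcode (PEq 0 0)) 3 h) => //.
  move=> x y; split=> [[f [hf [e hs]]]|[[f [hf [<- h1]]] [g [hg [<- h2]]]]].
    case: f hf e hs => [? ?|? ?|?|f g|? ?|? ?|?|?] /= hf /cpair_inj [] // _ /cpair_inj [<- <-] hs.
    by case: hf => hf hg; split; [exists f|exists g]; split=> //; split=> // r; case: (hs r).
  by exists (PAnd f g); split=> //; split=> // r; split.
move=> x; pose F := nat_rect (fun=> pform) (PEq 0 0) (fun _ f => PAll f).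
have Fb m : pbound 1 (F m) by elim: m => //= m; rewrite !pbndP; lia.
exists (F x.+1); split; first exact: Fb; split=> [|r].
  by rewrite /pad; elim: x.+1 => //= m ->.
by elim: x.+1 r => //= m IH r z.
Qed.

(** * Reduction to arithmetic *)

Fixpoint enc u := match u with
  | E => cpair 0 0 | L i => cpair 1 i | N t f => cpair 2 (cpair (enc t) (enc f))
  | J f g => cpair 3 (cpair (enc f) (enc g)) end.

Definition leG (h : nat -> nat) (p : nat) : nat :=
  let x := cfst p in let y := csnd p in
  let a := cfst (csnd x) in let b := csnd (csnd x) in
  let c := cfst (csnd y) in let d := csnd (csnd y) in
  if cfst x == 0 then 1
  else if cfst x == 3 then nat_of_bool ((0 < h (cpair a y)) && (0 < h (cpair b y)))
  else if cfst y == 0 then 0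
  else if cfst y == 3 then nat_of_bool ((0 < h (cpair x c)) || (0 < h (cpair x d)))
  else if cfst x == 1 then
    if cfst y == 1 then nat_of_bool (csnd x == csnd y)
    else nat_of_bool ((0 < h (cpair x c)) || (0 < h (cpair x d)))
  else if cfst y == 1 then nat_of_bool ((0 < h (cpair a y)) && (0 < h (cpair b y)))
  else nat_of_bool ((0 < h (cpair a c)) && (0 < h (cpair b y)) || (0 < h (cpair x d))).

(** A recursive call of [leG] shrinks a component of the pair and enlarges none, and pairing is
    monotone. *)
Lemma leF_ex : exists F, C1 F /\ forall c, F c = leG F c.
Proof.
apply: rec1; first by rewrite /leG; cbv zeta; ctac.
move=> p h h' hh'; rewrite /leG; set x := cfst p; set y := csnd p.
have ep : p = cpair x y by rewrite cpairK.
have sub z : 0 < cfst z -> cfst (csnd z) < z /\ csnd (csnd z) < z.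
  move=> /ltn_csnd lt; have := leq_cfst (csnd z); have := leq_csnd (csnd z); lia.
have lx u v : u < x -> v <= y -> h (cpair u v) = h' (cpair u v).
  by move=> hu hv; apply: hh'; rewrite ep; apply: ltn_cpair; rewrite ?hu // ltnW.
have ly v : v < y -> h (cpair x v) = h' (cpair x v).
  by move=> hv; apply: hh'; rewrite ep; apply: ltn_cpair; rewrite ?hv ?orbT // ltnW.
case: eqP => // /eqP; rewrite -lt0n => /sub [ha hb].
case: eqP => [_|_]; first by rewrite !lx.
case: eqP => // /eqP; rewrite -lt0n => /sub [hc hd].
by rewrite (ly _ hc) (ly _ hd) (lx _ _ ha (ltnW hc)) (lx _ _ ha (leqnn y)) (lx _ _ hb (leqnn y)).
Qed.

Lemma leF_enc F : (forall c, F c = leG F c) -> forall x y, F (cpair (enc x) (enc y)) = fle x y.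
Proof.
move=> FE; elim=> [|i|t IHt f IHf|f IHf g IHg] y.
- by rewrite FE /leG !cfst_cpair.
- by elim: y => [|j|t' IHt' f' IHf'|f' IHf' g' IHg'];
    rewrite FE /leG !cfst_cpair !csnd_cpair /= ?cfst_cpair ?csnd_cpair //= ?IHt' ?IHf' ?IHg' !lt0b.
- by elim: y => [|j|t' IHt' f' IHf'|f' IHf' g' IHg'];
    rewrite FE /leG !cfst_cpair !csnd_cpair /= ?cfst_cpair ?csnd_cpair //=
    -?[cpair 1 j]/(enc (L j)) -?[cpair 2 (cpair (enc t') (enc f'))]/(enc (N t' f'))
    ?IHt ?IHf ?IHf' ?IHg' !lt0b.
- by rewrite FE /leG !cfst_cpair !csnd_cpair /= ?cfst_cpair ?csnd_cpair IHf IHg !lt0b.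
Qed.

Section Check.
Variables (k : nat) (n : onat).

(* [0] on numbers that code no term over [k], and one plus the rank on the others. *)
Definition chkG (h : nat -> nat) (z : nat) : nat :=
  if cfst z == 0 then nat_of_bool (csnd z == 0)
  else if cfst z == 1 then nat_of_bool (csnd z < k)
  else if (h (cfst (csnd z)) == 0) || (h (csnd (csnd z)) == 0) then 0
  else if cfst z == 2 then if (cfst (cfst (csnd z)) == 1) || (cfst (cfst (csnd z)) == 2)
    then maxn (h (cfst (csnd z))).+1 (h (csnd (csnd z))) else 0
  else if cfst z == 3 then maxn (h (cfst (csnd z))) (h (csnd (csnd z))) else 0.

Lemma chk_ex : exists F, C1 F /\ forall c, F c = chkG F c.
Proof.
apply: rec1; first by rewrite /chkG; ctac.
move=> c f f' ff'; rewrite /chkG; case: eqP => // h.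
by have [|_ -> ->] := csnd_lt ff'; first by lia.
Qed.

Variables (F : nat -> nat) (FE : forall c, F c = chkG F c).

Lemma chk_enc u : F (enc u) = if okf k u then (rk u).+1 else 0.
Proof.
elim: u => [|i|t IHt f IHf|f IHf g IHg];
  rewrite FE /chkG /= !cfst_cpair !csnd_cpair /= ?cfst_cpair ?csnd_cpair //.
  rewrite IHt IHf; case: (okf k t) => /=; last by rewrite andbF.
  case: (okf k f) => /=; last by rewrite andbF.
  by rewrite andbT; case: t {IHt} => [|i|t1 f1|f1 g1] /=; rewrite cfst_cpair //= maxnSS.
by rewrite IHf IHg; case: (okf k f) => //=; case: (okf k g) => //=; rewrite maxnSS.
Qed.

Lemma chk_valid z : 0 < F z -> exists u, enc u = z.
Proof.
elim/ltn_ind: z => z IH; rewrite FE /chkG -[in X in _ -> X](cpairK z).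
have sub : 0 < cfst z -> cfst (csnd z) < z /\ csnd (csnd z) < z.
  move=> /ltn_csnd lt; have := leq_cfst (csnd z); have := leq_csnd (csnd z); lia.
move: (cfst z) sub => [|[|t]] sub /=.
- by case: eqP => // -> _; exists E.
- by exists (L (csnd z)).
have [//|h1 h2] := sub; rewrite !eqSS.
case: eqP => //= n1; case: eqP => //= n2.
have [|u eu] := IH _ h1; first by lia.
have [|v ev] := IH _ h2; first by lia.
case: t {sub} => [|[|t]] //= _; last by exists (J u v); rewrite /= eu ev cpairK.
by exists (N u v); rewrite /= eu ev cpairK.
Qed.
End Check.

Lemma pst_codes k n : exists (le dom : nat -> bool), [/\ C1 le, C1 dom,
  forall x y, le (cpair (enc x) (enc y)) = fle x y &
  forall z, dom z <-> exists x : pst k n, enc (sval x) = z].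
Proof.
have [F [FC FE]] := leF_ex; have [G [GC GE]] := chk_ex k.
exists (fun p => 0 < F p).
exists (fun z => [&& 0 < G z, (if n is ofin m then G z <= m.+1 else true) & F (cpair z (enc E)) == 0]).
split.
- by ctac.
- by case: n => [m|]; ctac.
- by move=> x y; rewrite (leF_enc FE) lt0b.
- move=> z; split=> [/and3P [h1 h2 h3]|[[u hu] <-]].
    have [u eu] := chk_valid GE h1; move: h1 h2 h3; rewrite -eu (leF_enc FE) (chk_enc GE).
    case ok: (okf k u) => // _ h2; rewrite eqb0 => h3.
    have hu : okn k n u && ~~ fle u E by rewrite /okn ok h3; move: h2; case: (n) => //= m; rewrite ltnS => ->.
    by exists (exist _ u hu).
  move: hu => /=; rewrite /okn => /andP [/andP [ok hr] uE].
  rewrite -[cpair 0 0]/(enc E) (leF_enc FE) (chk_enc GE) ok (negPf uE) /=.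
  by case: (n) hr => //= m; rewrite ltnS => ->.
Qed.

Section ToArith.
Variables (k : nat) (n : onat) (le dom : nat -> bool).
Hypotheses (leE : forall x y, le (cpair (enc x) (enc y)) = fle x y)
  (domE : forall z, dom z <-> exists x : pst k n, enc (sval x) = z).
Variables (LE DOM : aform).
Hypotheses (LE_b : abound 2 LE) (LE_E : forall r, asat r LE <-> le (cpair (r 0) (r 1)))
  (DOM_b : abound 1 DOM) (DOM_E : forall r, asat r DOM <-> dom (r 0)).

(** Copies of the two variables are quantified at the indices 0 and 1, where [LE] expects them; this
    replaces substitution into formulas. *)
Definition leA i j := AEx (AEx (AAnd (AAnd (AEq (AVar 0) (AVar i.+2)) (AEq (AVar 1) (AVar j.+2))) LE)).

Fixpoint p2a f := match f with
  | PLe i j => leA i j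
  | PEq i j => AAnd (leA i j) (leA j i)
  | PNot a => ANot (p2a a)
  | PAnd a b => AAnd (p2a a) (p2a b)
  | POr a b => AOr (p2a a) (p2a b)
  | PImp a b => AImp (p2a a) (p2a b)
  | PAll a => AAll (AImp DOM (p2a a))
  | PEx a => AEx (AAnd DOM (p2a a)) end.

Lemma abound_mono m m' f : m <= m' -> abound m f -> abound m' f.
Proof. by rewrite !abndP; lia. Qed.

Lemma p2a_bound f m : pbound m f -> abound m (p2a f).
Proof.
have hL i j p : i < p -> j < p -> abound p (leA i j).
  by move=> hi hj; rewrite /=; do !split=> //; apply: abound_mono LE_b.
elim: f m => [i j|i j|f IH|f If g Ig|f If g Ig|f If g Ig|f IH|f IH] m.
- by case=> hi hj; apply: hL.
- by case=> hi hj; split; apply: hL.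
- exact: IH.
- by case=> /If hf /Ig hg; split.
- by case=> /If hf /Ig hg; split.
- by case=> /If hf /Ig hg; split.
- by move/IH => h; split=> //; apply: abound_mono DOM_b.
- by move/IH => h; split=> //; apply: abound_mono DOM_b.
Qed.

Lemma p2aE f (r : nat -> pst k n) r' : (forall i, r' i = enc (sval (r i))) ->
  (asat r' (p2a f) <-> gsat (@pst_le k n) r f).
Proof.
have hL s s' i j : (forall i, s' i = enc (sval (s i))) -> asat s' (leA i j) <-> @pst_le k n (s i) (s j).
  move=> e; rewrite /= /pst_le; split=> [[y [x [[-> ->] /LE_E]]]|h].
    by rewrite /= !e leE.
  by exists (s' j), (s' i); do !split=> //; apply/LE_E; rewrite /= !e leE.
elim: f r r' => [i j|i j|f IH|f If g Ig|f If g Ig|f If g Ig|f IH|f IH] r r' e.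
- exact: hL.
- by rewrite -[gsat _ _ _]/(_ /\ _) -(hL _ _ _ _ e) -(hL _ _ _ _ e).
- by rewrite /= (IH r r').
- by rewrite /= (If r r') // (Ig r r').
- by rewrite /= (If r r') // (Ig r r').
- by rewrite /= (If r r') // (Ig r r').
- split=> /= H; [move=> x|move=> z /DOM_E /domE [x ex]].
    apply/(IH _ (scons (enc (sval x)) r')); first by case.
    by apply: H; apply/DOM_E/domE; exists x.
  by apply/(IH (scons x r)) => [[|i] /=|//]; rewrite ?ex ?e.
- split=> /= -[z]; last move=> H2.
    move=> [H1 H2]; move: H1 => /DOM_E /domE [x ex]; exists x.
    by apply/(IH _ (scons z r')) => [[|i] /=|//]; rewrite ?ex ?e.
  exists (enc (sval z)); split; first by apply/DOM_E/domE; exists z.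
  by apply/(IH (scons z r)) => [[]|//].
Qed.

Let sLE := acode LE.
Let sDOM := acode DOM.
Definition leAc i j := cpair 6 (cpair 6 (cpair 2 (cpair (cpair 2
  (cpair (cpair 0 (cpair (cpair 0 0) (cpair 0 i.+2))) (cpair 0 (cpair (cpair 0 1) (cpair 0 j.+2))))) sLE))).
Definition p2aG h c :=
  let i := cfst (csnd c) in let j := csnd (csnd c) in
  if cfst c == 0 then leAc i j
  else if cfst c == 1 then cpair 2 (cpair (leAc i j) (leAc j i))
  else if cfst c == 2 then cpair 1 (h (csnd c))
  else if cfst c == 3 then cpair 2 (cpair (h i) (h j))
  else if cfst c == 4 then cpair 3 (cpair (h i) (h j))
  else if cfst c == 5 then cpair 4 (cpair (h i) (h j))
  else if cfst c == 6 then cpair 5 (cpair 4 (cpair sDOM (h (csnd c))))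
  else cpair 6 (cpair 2 (cpair sDOM (h (csnd c)))).

Lemma p2a_code : exists h, C1 h /\ forall f, h (pcode f) = acode (p2a f).
Proof.
have [||h [hC hE]] := @rec1 p2aG.
- by rewrite /p2aG /leAc; cbv zeta; ctac.
- move=> c f f' ff'; rewrite /p2aG; case: eqP => // h.
  by have [|-> -> ->] := csnd_lt ff'; first by lia.
exists h; split=> //.
by elim=> [i j|i j|f IH|f If g Ig|f If g Ig|f If g Ig|f IH|f IH]; rewrite hE /p2aG
  !cfst_cpair !csnd_cpair /= ?cfst_cpair ?csnd_cpair ?IH ?If ?Ig.
Qed.
End ToArith.

Theorem poset_to_arith k n : 0 < k -> exists h, C1 h /\
  forall c, Th_poset (@FFk_le k n) c <-> Th_arith (h c).
Proof.
move=> k0; have [le [dom [leC domC leE domE]]] := pst_codes k n.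
have [LE LE_b LE_E] : exists2 f, abound 2 f & forall r, asat r f <-> le (cpair (r 0) (r 1)).
  apply: DefA_form.
  apply: (@D_ext _ _ _ (fun r => exists v, exists w, w = 1 /\ v = nat_of_bool (le (cpair (r 0) (r 1))) /\ v = w)).
    by move=> r; split=> [[v [w [-> [-> /eqP]]]]|->]; [rewrite eqb1|exists 1, 1].
  apply: D_ex; apply: D_ex; apply: D_and; first exact: D_one.
  apply: D_and; last exact: (@D_eq 4 (AVar 1) (AVar 0)).
  by apply: (@D_C2 (fun x y => le (cpair x y)) 4 2 3 1) => //; ctac.
have [DOM DOM_b DOM_E] : exists2 f, abound 1 f & forall r, asat r f <-> dom (r 0).
  apply: DefA_form.
  apply: (@D_ext _ _ _ (fun r => exists v, exists w, w = 1 /\ v = nat_of_bool (dom (r 0)) /\ v = w)).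
    by move=> r; split=> [[v [w [-> [-> /eqP]]]]|->]; [rewrite eqb1|exists 1, 1].
  apply: D_ex; apply: D_ex; apply: D_and; first exact: D_one.
  apply: D_and; last exact: (@D_eq 3 (AVar 1) (AVar 0)).
  by apply: (@D_C1 (fun x => dom x) 3 2 1).
have [h [hC hE]] := p2a_code LE DOM.
have [b [bC bE]] := closed_pform_C1.
pose fls := AAll (ANot (AEq (AVar 0) (AVar 0))).
exists (fun c => if b c then h c else acode fls); split; first by ctac.
have hok : okn k n (L 0) && ~~ fle (L 0) E by rewrite /okn /= k0; case: (n).
pose r0 : nat -> pst k n := fun=> Pst hok.
move=> c; case: (boolP (b c)) => [/bE [f hf <-]|nb].
  rewrite (Th_posetE r0 hf) hE (@Th_arithE _ (fun i => enc (sval (r0 i)))); last first.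
    by apply: p2a_bound.
  by apply: iff_sym; apply: p2aE.
split=> [[f [hf [e _]]]|]; first by case/negP: nb; apply/bE; exists f.
by rewrite (@Th_arithE fls id) //= => /(_ 0) [].
Qed.

(** * Alternating chains *)

Lemma okn_N k n t f : okn k n (N t f) -> [/\ istree t, okn k n t & okn k n f].
Proof.
rewrite /okn /= => /andP [/and3P [-> -> ->]]; case: n => // m.
by rewrite geq_max => /andP [/ltnW -> ->].
Qed.

Lemma okn_J k n f g : okn k n (J f g) = okn k n f && okn k n g.
Proof.
rewrite /okn /=; case: n => [m|]; last by rewrite !andbT.
by rewrite geq_max; case: (okf k f); case: (okf k g); rewrite ?andbF //= andbT.
Qed.

Lemma okn_E k n : okn k n E. Proof. by rewrite /okn; case: n. Qed.

Lemma tree_label t k n : istree t -> okn k n t -> exists2 i, i < k & fle (L i) t.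
Proof.
elim: t => // [i|t IHt f _] _; first by rewrite /okn => /andP [hi _]; exists i; rewrite ?fleLL.
by move=> /okn_N [ht ok _]; have [i hi le] := IHt ht ok; exists i; rewrite // fleLN le.
Qed.

Lemma one_label k n p u : okn k n u -> (forall i, fle (L i) u -> i = p) -> fle u (L p).
Proof.
elim: u => [|i|t IHt f IHf|f IHf g IHg] //.
- by move=> _ /(_ i (fle_refl _)) ->; rewrite fleLL.
- move=> /okn_N [_ okt okf] h; rewrite fleNL IHt ?IHf // => i hi; apply: h;
    by rewrite fleLN hi ?orbT.
- rewrite okn_J => /andP [okf okg] h; rewrite fleJ IHf ?IHg // => i hi; apply: h;
    by rewrite fle_treeJ // hi ?orbT.
Qed.

(** The property is applied to the top join of the term itself: one side equals the whole, and the
    induction continues there. Empty sides are dropped beforehand, as the property speaks of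
    nonempty forests. *)
Lemma tree_le_J k n u : okn k n u -> ~~ fle u E ->
  (forall y z, okn k n y && ~~ fle y E -> okn k n z && ~~ fle z E ->
     fle u (J y z) -> fle u y \/ fle u z) ->
  exists t, [/\ istree t, okn k n t & feq u t].
Proof.
have [m] := ubnP (fsize u); elim: m u => // m IH [|i|t f|f g] // hm ok nE h.
- by exists (L i); rewrite feq_refl.
- by exists (N t f); rewrite feq_refl.
have [okl okr] : okn k n f /\ okn k n g by apply/andP; rewrite -okn_J.
case: (boolP (fle f E)) => fE.
  have e : feq g (J f g) by rewrite /feq fleJ fle_Jr ?fle_refl ?(fle_trans fE).
  have nE' : ~~ fle g E by rewrite (fle_feql _ e).
  have [||t [t1 t2 t3]] := IH g _ okr nE'; first by move: hm => /=; lia.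
    by move=> y z hy hz; rewrite !(fle_feql _ e); apply: h.
  by exists t; split=> //; apply: feq_trans t3; rewrite feq_sym.
case: (boolP (fle g E)) => gE.
  have e : feq f (J f g) by rewrite /feq fleJ fle_Jl ?fle_refl ?(fle_trans gE).
  have nE' : ~~ fle f E by rewrite (fle_feql _ e).
  have [||t [t1 t2 t3]] := IH f _ okl nE'; first by move: hm => /=; lia.
    by move=> y z hy hz; rewrite !(fle_feql _ e); apply: h.
  by exists t; split=> //; apply: feq_trans t3; rewrite feq_sym.
have hf : okn k n f && ~~ fle f E by rewrite okl.
have hg : okn k n g && ~~ fle g E by rewrite okr.
case: (h f g hf hg (fle_refl _)) => le.
  have e : feq f (J f g) by rewrite /feq le fle_Jl ?fle_refl.
  have [||t [t1 t2 t3]] := IH f _ okl fE; first by move: hm => /=; lia.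
    by move=> y z hy hz; rewrite !(fle_feql _ e); apply: h.
  by exists t; split=> //; apply: feq_trans t3; rewrite feq_sym.
have e : feq g (J f g) by rewrite /feq le fle_Jr ?fle_refl.
have [||t [t1 t2 t3]] := IH g _ okr gE; first by move: hm => /=; lia.
  by move=> y z hy hz; rewrite !(fle_feql _ e); apply: h.
by exists t; split=> //; apply: feq_trans t3; rewrite feq_sym.
Qed.

Fixpoint al p q i := if i is j.+1 then N (L p) (al q p j) else E.
Definition jt p q i := J (al p q i) (al q p i).

Lemma al_ok k n p q i : p < k -> q < k -> n <> ofin 0 -> okn k n (al p q i).
Proof.
move=> hp hq hn; suff [a b] : okf k (al p q i) /\ rk (al p q i) <= 1.
  by rewrite /okn a; case: n hn => // -[|m] // _; apply: leq_trans b _.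
elim: i p q hp hq => //= i IH p q hp hq; have [-> h] := IH q p hq hp.
by rewrite hp; split=> //; rewrite geq_max.
Qed.

Lemma al_swap p q i j : i < j -> fle (al p q i) (al q p j).
Proof.
elim: j i p q => // j IH [|i] p q // h; apply: fle_N.
elim: j i p q h {IH} => // j IH [|i] p q h; rewrite /= fleNN fle_refl //=.
by apply/orP; left; apply: fle_N; apply: IH.
Qed.

Lemma al_mono p q i j : i <= j -> fle (al p q i) (al p q j).
Proof.
elim: i j p q => // i IH [|j] p q // h; rewrite /= fleNN fle_refl /=.
by apply/orP; left; apply: fle_N; apply: IH.
Qed.

(** Adjacent nodes have incomparable labels and hence different images, so an embedding cannot
    shorten the chain. *)
Lemma al_le_size p q p' q' i j : p <> q -> fle (al p q i) (al p' q' j) -> i <= j.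
Proof.
elim: j i p q p' q' => [|j IH] [|i] p q p' q' // pq; rewrite /= fleNN fleLL.
case/orP => [/andP [/eqP e h]|h]; last by have := IH i.+1 p q _ _ pq h; lia.
case: i h => // i /=; rewrite fleNN fleLL; case/orP => [/andP [/eqP]|h]; first by congruence.
have qp : q <> p by congruence.
exact: (IH i.+1 q p _ _ qp h).
Qed.

Lemma al_swap_lt p q i j : p <> q -> 0 < i -> fle (al p q i) (al q p j) -> i < j.
Proof.
case: i j => // i [|j] // pq _; rewrite /= fleNN fleLL; case: eqP => // _ /= h.
by have := @al_le_size p q _ _ i.+1 j pq h.
Qed.

Lemma al_label p q i j : fle (L j) (al p q i) -> j = p \/ j = q.
Proof.
elim: i p q => // i IH p q /=; rewrite fleLN fleLL => /orP [/eqP|]; first by left.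
by case/IH; [right|left].
Qed.

(** Its image would need a label above both [p] and [q], while the labels of the chain are
    leaves. *)
Lemma al_no2 p q p' q' i : p <> q -> ~~ fle (N (al p q 2) E) (al p' q' i).
Proof.
move=> pq; elim: i p' q' => // i IH p' q'; rewrite /= fleNN negb_or IH andbT.
rewrite negb_and /al fleNL fleLL fleNL fleLL; apply/orP; left.
by apply/negP => /and3P [/eqP e1 /eqP e2 _]; congruence.
Qed.

Section TwoLabels.
Variables (k : nat) (n : onat) (p q : nat).
Hypotheses (pq : p <> q).

Definition pqlab u := forall i, fle (L i) u -> i = p \/ i = q.

(** All nodes of a chain may go to one node whose label lies above [p] and [q]; such nodes have to
    be excluded in [al_normal]. *)
Lemma al_any u i : fle (L p) u -> fle (L q) u -> fle (al p q i) (N u E) /\ fle (al q p i) (N u E).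
Proof. by move=> hp hq; elim: i => //= i [h1 h2]; rewrite !fleNN hp hq h1 h2. Qed.

Lemma pqlab_N u f : pqlab (N u f) -> pqlab u /\ pqlab f.
Proof. by move=> h; split=> i hi; apply: h; rewrite fleLN hi ?orbT. Qed.

Lemma pqlab_label u : istree u -> okn k n u -> pqlab u ->
  [\/ feq u (L p), feq u (L q) | fle (L p) u && fle (L q) u].
Proof.
move=> tu ok lab; have [i _ hi] := tree_label tu ok.
case: (boolP (fle (L p) u)) => hp; case: (boolP (fle (L q) u)) => hq.
- by constructor 3.
- constructor 1; rewrite /feq hp (one_label ok) // => j hj; case: (lab j hj) => // e.
  by rewrite e (negPf hq) in hj.
- constructor 2; rewrite /feq hq (one_label ok) // => j hj; case: (lab j hj) => // e.
  by rewrite e (negPf hp) in hj.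
- by case: (lab i hi) => e; rewrite e ?(negPf hp) ?(negPf hq) in hi.
Qed.

Lemma two_labels u : istree u -> okn k n u -> pqlab u -> fle (L p) u -> fle (L q) u ->
  fle (al p q 2) u \/ fle (al q p 2) u.
Proof.
case: u => // [i|u f] _ ok lab hp hq.
  by move: hp hq; rewrite !fleLL => /eqP <- /eqP; congruence.
have [tu oku _] := okn_N ok; have [labu _] := pqlab_N lab.
case: (pqlab_label tu oku labu) => [e|e|/andP [h1 h2]].
- left; move: hq; rewrite fleLN (fle_feqr _ e) fleLL; case: eqP => [|_ /= hq]; first by congruence.
  by rewrite /= fleNN (fle_feqr _ e) fle_refl; apply/orP; left; apply: fle_N; apply: fle_trans hq;
     rewrite fleNL fle_refl.
- right; move: hp; rewrite fleLN (fle_feqr _ e) fleLL; case: eqP => [|_ /= hp]; first by congruence.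
  by rewrite /= fleNN (fle_feqr _ e) fle_refl; apply/orP; left; apply: fle_N; apply: fle_trans hp;
     rewrite fleNL fle_refl.
- left; have [h _] := al_any 2 h1 h2; apply: fle_trans h _.
  by rewrite fleNN fle_refl.
Qed.

Lemma L_al a b : feq (L a) (al a b 1).
Proof. by rewrite /feq /= fleLN fleLL eqxx fleNL fle_refl. Qed.

(** A new root [a] lengthens the chain that starts with [b] and is absorbed by the one that starts
    with [a]. *)
Lemma N_al a b i j : feq (N (L a) (J (al a b i) (al b a j))) (al a b (maxn j.+1 i)).
Proof.
apply/andP; split; last first.
  case: (leqP i j.+1) => h.
    by rewrite /= fleNN fle_refl fle_N // fle_Jr ?fle_refl.
  by apply: fle_N; apply: fle_Jl; apply: fle_refl.
have -> : maxn j.+1 i = (maxn j i.-1).+1 by lia.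
rewrite /= fleNN fle_refl fleJ /=; apply/orP; left; apply/andP; split.
  by apply: (fle_trans (al_mono a b (j := (maxn j i.-1).+1) _)); [lia|apply: fle_refl].
by apply: fle_N; apply: al_mono; lia.
Qed.

(** If no label contains a two-element chain, [pqlab_label] and [two_labels] leave only labels
    equivalent to [p] or [q], and [N_al] normalizes each node. *)
Lemma al_normal u : okn k n u -> pqlab u -> ~~ fle (N (al p q 2) E) u -> ~~ fle (N (al q p 2) E) u ->
  exists i j, feq u (J (al p q i) (al q p j)).
Proof.
elim: u => [|l|t _ f IH|f IHf g IHg].
- by exists 0, 0.
- move=> _ /(_ l (fle_refl _)) [-> _ _|-> _ _]; [exists 1, 0|exists 0, 1].
    by rewrite /feq fleJ fle_Jl ?andbT ?(proj2 (andP (L_al p q))) // (proj1 (andP (L_al p q))).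
  by rewrite /feq fleJ fle_Jr ?andbT ?(proj2 (andP (L_al q p))) // (proj1 (andP (L_al q p))).
- move=> ok lab n1 n2; have [tt okt okf] := okn_N ok; have [labt labf] := pqlab_N lab.
  have [||i [j e]] := IH okf labf; try by apply: contra (@fle_N _ t f) _.
  have NE : feq (N t f) (N t (J (al p q i) (al q p j))).
    by case/andP: e => e1 e2; rewrite /feq !fleNN fle_refl !fle_N.
  case: (pqlab_label tt okt labt) => [et|et|/andP [h1 h2]]; last first.
  + case: (two_labels tt okt labt h1 h2) => h; [case/negP: n1|case/negP: n2]; by rewrite fleNN h.
  + exists 0, (maxn i.+1 j); apply: feq_trans NE _.
    apply: feq_trans (_ : feq _ (N (L q) (J (al q p j) (al p q i)))) _.
      by case/andP: et => e1 e2; rewrite /feq !fleNN e1 e2 /=; apply/andP; split; apply/orP; left;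
        apply: fle_N; rewrite fleJ; apply/andP; split; eauto using fle_Jl, fle_Jr, fle_refl.
    by apply: feq_trans (N_al q p j i) _; rewrite /feq fleJ fle_Jr ?fle_refl.
  + exists (maxn j.+1 i), 0; apply: feq_trans NE _.
    apply: feq_trans (_ : feq _ (N (L p) (J (al p q i) (al q p j)))) _.
      by case/andP: et => e1 e2; rewrite /feq !fleNN e1 e2 /= !fle_N ?fle_refl.
    by apply: feq_trans (N_al p q i j) _; rewrite /feq fleJ fle_Jl ?fle_refl.
- rewrite okn_J => /andP [okf okg] lab n1 n2.
  have [|||i1 [j1 e1]] := IHf okf; try by apply: contra (@fle_Jl _ f g) _.
    by move=> i hi; apply: lab; apply: fle_Jl.
  have [|||i2 [j2 e2]] := IHg okg; try by apply: contra (@fle_Jr _ f g) _.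
    by move=> i hi; apply: lab; apply: fle_Jr.
  exists (maxn i1 i2), (maxn j1 j2).
  case/andP: e1 => a1 b1; case/andP: e2 => a2 b2; rewrite /feq fleJ.
  move: b1 b2; rewrite !fleJ => /andP [b1 c1] /andP [b2 c2].
  apply/andP; split; apply/andP; split.
  + apply: fle_trans a1 _; rewrite fleJ; apply/andP; split; [apply: fle_Jl|apply: fle_Jr]; apply: al_mono; exact: leq_maxl.
  + apply: fle_trans a2 _; rewrite fleJ; apply/andP; split; [apply: fle_Jl|apply: fle_Jr]; apply: al_mono; exact: leq_maxr.
  + by case: (leqP i1 i2) => _; [apply: fle_Jr|apply: fle_Jl].
  + by case: (leqP j1 j2) => _; [apply: fle_Jr|apply: fle_Jl].
Qed.

Lemma al_normal_below u i : okn k n u -> fle u (al p q i) ->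
  exists i j, feq u (J (al p q i) (al q p j)).
Proof.
move=> ok le; apply: al_normal => //.
- by move=> l hl; apply: (@al_label p q i); apply: fle_trans hl le.
- by apply: contra (al_no2 p q i pq) => h; apply: fle_trans h le.
- have qp : q <> p by congruence.
  by apply: contra (al_no2 p q i qp) => h; apply: fle_trans h le.
Qed.

Lemma al_normal_tree u : istree u -> (exists i j, feq u (J (al p q i) (al q p j))) ->
  exists i, feq u (al p q i.+1) \/ feq u (al q p i.+1).
Proof.
move=> tu [i [j e]]; have /andP [h h'] := e.
move: h'; rewrite fleJ => /andP [h1 h2]; move: h; rewrite fle_treeJ // => /orP [] h3.
  by case: i e h1 h3 => [|i] e h1 h3; [rewrite fle_treeE in h3|exists i; left; apply/andP].
by case: j e h2 h3 => [|j] e h2 h3; [rewrite fle_treeE in h3|exists j; right; apply/andP].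
Qed.

End TwoLabels.

(** Descend in [z]. A join that absorbs a root equals one of its sides, because the enlarged tree
    embeds into one side. A tree [N v g] is equivalent to [g], or else its own root label takes both
    [a] and [b]. *)
Lemma absorb a b z : fle (N a z) z -> fle (N b z) z ->
  exists v g, [/\ feq z (N v g), fle a v, fle b v & forall k n, okn k n z -> istree v /\ okn k n v].
Proof.
have NE z' c : feq z z' -> fle (N c z) z -> fle (N c z') z'.
  move=> e h; rewrite -(fle_feqr _ e); apply: fle_trans h.
  by rewrite fleNN fle_refl fle_N //; case/andP: e.
have NEq z' z0 c : feq z0 z' -> fle (N c z0) z0 -> fle (N c z') z'.
  move=> e h; rewrite -(fle_feqr _ e); apply: fle_trans h.
  by rewrite fleNN fle_refl fle_N //; case/andP: e.
elim: z {NE} => [|i|v _ g IH|f IHf g IHg] ha hb.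
- by [].
- exists (L i), E; split.
  + by rewrite /feq fleNL fleLN !fle_refl.
  + by move: ha; rewrite fleNL => /andP [].
  + by move: hb; rewrite fleNL => /andP [].
  + by [].
- case: (boolP (fle (N v g) g)) => h; last first.
    exists v, g; split=> [|||k n /okn_N [] //]; first exact: feq_refl.
      move: ha; rewrite fleNN => /orP [/andP []//|h']; case/negP: h.
      by apply: fle_trans h'; apply: fle_N; apply: fle_refl.
    move: hb; rewrite fleNN => /orP [/andP []//|h']; case/negP: h.
    by apply: fle_trans h'; apply: fle_N; apply: fle_refl.
  have e : feq (N v g) g by rewrite /feq h fle_N ?fle_refl.
  have [v' [g' [h1 h2 h3 h4]]] := IH (NEq _ _ _ e ha) (NEq _ _ _ e hb).
  exists v', g'; split=> //; first exact: feq_trans e h1.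
  by move=> k n /okn_N [_ _ /h4].
- have zle c : fle (J f g) (N c (J f g)) by apply: fle_N; apply: fle_refl.
  case/orP: (etrans (esym (fle_treeJ f g (isT : istree (N a (J f g))))) ha) => h.
    have e : feq (J f g) f by rewrite /feq (fle_trans (zle a) h) fle_Jl ?fle_refl.
    have [v' [g' [h1 h2 h3 h4]]] := IHf (NEq _ _ _ e ha) (NEq _ _ _ e hb).
    exists v', g'; split=> //; first exact: feq_trans e h1.
    by move=> k n; rewrite okn_J => /andP [/h4].
  have e : feq (J f g) g by rewrite /feq (fle_trans (zle a) h) fle_Jr ?fle_refl.
  have [v' [g' [h1 h2 h3 h4]]] := IHg (NEq _ _ _ e ha) (NEq _ _ _ e hb).
  exists v', g'; split=> //; first exact: feq_trans e h1.
  by move=> k n; rewrite okn_J => /andP [_ /h4].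
Qed.

(* The single node labelled by a two-element chain has no greatest element strictly below it:
   any such [z] would absorb both labels, hence have the chain as a root label. *)
Lemma no_cover k n p q z : p <> q -> okn k n z ->
  fle z (N (al p q 2) E) -> ~~ fle (N (al p q 2) E) z ->
  exists a, [/\ a = p \/ a = q, fle (N (L a) z) (N (al p q 2) E),
    ~~ fle (N (al p q 2) E) (N (L a) z) & ~~ fle (N (L a) z) z].
Proof.
move=> pq ok zy nyz.
have [hp hq] : fle (L p) (al p q 2) /\ fle (L q) (al p q 2).
  by rewrite /= !fleLN !fleLL !eqxx /= orbT.
have base a : a = p \/ a = q -> fle (N (L a) z) (N (al p q 2) E) /\
    ~~ fle (N (al p q 2) E) (N (L a) z).
  move=> ha; have la : fle (L a) (al p q 2) by case: ha => ->.
  rewrite !fleNN la zy negb_or nyz andbT; split=> //.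
  rewrite andbT; apply/negP => /andP [h _]; have := fle_trans hp h; have := fle_trans hq h.
  by rewrite !fleLL => /eqP e1 /eqP e2; apply: pq; rewrite e1 e2.
case: (boolP (fle (N (L p) z) z)) => h1; last first.
  by exists p; have [b1 b2] := base p (or_introl erefl); split=> //; left.
case: (boolP (fle (N (L q) z) z)) => h2; last first.
  by exists q; have [b1 b2] := base q (or_intror erefl); split=> //; right.
have [v [g [e vp vq /(_ k n ok) [tv okv]]]] := absorb h1 h2.
have vu : fle v (al p q 2) by move: zy; rewrite (fle_feql _ e) fleNN orbF => /andP [].
have nuv : ~~ fle (al p q 2) v.
  by apply: contra nyz => h; rewrite (fle_feqr _ e) fleNN h.
have [i ei] := al_normal_tree tv (al_normal_below pq okv vu).
case: ei => ei; rewrite (fle_feql _ ei) in vu; rewrite (fle_feqr _ ei) in nuv; rewrite (fle_feqr _ ei) in vp;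
  rewrite (fle_feqr _ ei) in vq.
  have i2 : i < 2 by apply: al_le_size vu.
  case: i i2 {ei vu} nuv vq vp => [|[|]] // _ nuv vq; last by rewrite fle_refl in nuv.
  by move: vq; rewrite /= fleLN fleLL orbF => /eqP; congruence.
have i2 : i.+1 < 2 by apply: al_swap_lt vu => //; congruence.
case: i i2 {ei vu} nuv vq vp => [|] // _ _ _.
by rewrite /= fleLN fleLL orbF => /eqP; congruence.
Qed.

(** * Arithmetic in a poset with three parameters *)

Section PosetFormulas.
Variables (X : Type) (R : X -> X -> Prop).

Definition poset_atom n (P : (nat -> X) -> Prop) :=
  exists i j, [/\ i < n, j < n & forall r, P r <-> R (r i) (r j)].
Notation DefP := (Def poset_atom).

Lemma poset_ren m n f P : (forall j, j < m -> f j < n) -> poset_atom m P ->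
  poset_atom n (fun r => P (fun j => r (f j))).
Proof. by move=> fP [i [j [/fP hi /fP hj e]]]; exists (f i), (f j); split=> // r; apply: e. Qed.

Lemma D_R : DefP 2 (fun r => R (r 0) (r 1)).
Proof. by apply: D_atom; exists 0, 1. Qed.

Lemma DefP_form n P : DefP n P -> exists2 f, pbound n f & forall r, gsat R r f <-> P r.
Proof.
elim=> {n P} [n P [i [j [hi hj e]]]|n P _ [f hf e]|n P Q _ [f hf e] _ [g hg e']
  |n P Q _ [f hf e] _ [g hg e']|n P Q _ [f hf e] _ [g hg e']|n P _ [f hf e]|n P _ [f hf e]
  |n P Q PQ _ [f hf e]].
- by exists (PLe i j) => // r; rewrite e.
- by exists (PNot f) => // r /=; rewrite e.
- by exists (PAnd f g) => // r /=; rewrite e e'.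
- by exists (POr f g) => // r /=; rewrite e e'.
- by exists (PImp f g) => // r /=; rewrite e e'.
- by exists (PAll f) => // r /=; split=> h x; apply/e.
- by exists (PEx f) => // r /=; split=> -[x h]; exists x; apply/e.
- by exists f => // r; rewrite e.
Qed.

Definition eqv x y := R x y /\ R y x.
Definition slt x y := R x y /\ ~ R y x.
Definition mini x := forall y, R y x -> R x y.
Definition lub y z w := R y w /\ R z w /\ forall v, R y v -> R z v -> R w v.
Definition irr x := forall y z w, lub y z w -> R x w -> R x y \/ R x z.
(** This keeps labels simple: by [no_cover], the node labelled by a two-element chain is an
    irreducible element without a greatest strict predecessor. *)
Definition std x := forall y, R y x -> irr y -> mini y \/ exists z, slt z y /\ forall w, slt w y -> R w z.
Definition labs a b x := forall m, mini m -> R m x -> eqv m a \/ eqv m b.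
(* Among forests, [num] holds of the joins of the two alternating chains of equal length with labels
   [a] and [b]. *)
Definition num a b x := labs a b x /\ ~ irr x /\ std x.
Definition succ a b x y := num a b y /\ slt x y /\ forall z, num a b z -> slt x z -> R y z.
Definition least a b o := num a b o /\ forall w, num a b w -> R o w.
(* An element [S] codes the set of pairs [(x, y)] with a common irreducible upper bound below [S];
   it is a union of rectangles, and [hh] is its upper boundary, a decreasing function. *)
Definition dd S x y := exists t, irr t /\ R t S /\ R x t /\ R y t.
Definition hh a c S x y := dd S x y /\ forall y', succ a c y y' -> ~ dd S x y'.
(** Here [y] belongs to the first copy, [x] and [z] to the second. The function coded by [S] has
    value [x] at [y] and gains 1 with each step down, so its value at 0 is the sum. *)
Definition addK a b c y x z := exists S, (exists o, least a b o /\ hh a c S o z) /\ hh a c S y x /\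
  forall i, num a b i -> slt i y -> exists i', exists j, exists j', succ a b i i' /\ num a c j /\
    succ a c j j' /\ hh a c S i' j /\ hh a c S i j'.
Definition convert a b c y z := exists o, least a c o /\ addK a b c y o z.
(** Now [x] belongs to the first copy too: it is the increment, added by [addK] at each step down
    from the value 0 at [y]. *)
Definition mulK a b c y x z := exists S, (exists o, least a b o /\ hh a c S o z) /\
  (exists o, least a c o /\ hh a c S y o) /\
  forall i, num a b i -> slt i y -> exists i', exists j, exists j', succ a b i i' /\ num a c j /\
    num a c j' /\ addK a b c x j j' /\ hh a c S i' j /\ hh a c S i j'.
(** All three arguments are in the first copy; [convert] carries a summand and the result to the
    second, where [addK] expects them. *)
Definition addJ a b c y x z := exists x', exists z', num a c x' /\ num a c z' /\
  convert a b c x x' /\ convert a b c z z' /\ addK a b c y x' z'.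
Definition mulJ a b c y x z := exists z', num a c z' /\ convert a b c z z' /\ mulK a b c y x z'.
Definition params a b c := mini a /\ mini b /\ mini c /\ ~ R a b /\ ~ R a c /\ ~ R b c.

Hint Resolve D_R : ddb.
Ltac ren_tac ::= exact (@poset_ren).
Lemma D_eqv : DefP 2 (fun r => eqv (r 0) (r 1)). Proof. by rewrite /eqv; dtac. Qed.
Lemma D_slt : DefP 2 (fun r => slt (r 0) (r 1)). Proof. by rewrite /slt; dtac. Qed.
Lemma D_mini : DefP 1 (fun r => mini (r 0)). Proof. by rewrite /mini; dtac. Qed.
Lemma D_lub : DefP 3 (fun r => lub (r 0) (r 1) (r 2)). Proof. by rewrite /lub; dtac. Qed.
Hint Resolve D_eqv D_slt D_mini D_lub : ddb.
Lemma D_irr : DefP 1 (fun r => irr (r 0)). Proof. by rewrite /irr; dtac. Qed.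
Hint Resolve D_irr : ddb.
Lemma D_std : DefP 1 (fun r => std (r 0)). Proof. by rewrite /std; dtac. Qed.
Lemma D_labs : DefP 3 (fun r => labs (r 0) (r 1) (r 2)). Proof. by rewrite /labs; dtac. Qed.
Hint Resolve D_std D_labs : ddb.
Lemma D_num : DefP 3 (fun r => num (r 0) (r 1) (r 2)). Proof. by rewrite /num; dtac. Qed.
Hint Resolve D_num : ddb.
Lemma D_psucc : DefP 4 (fun r => succ (r 0) (r 1) (r 2) (r 3)). Proof. by rewrite /succ; dtac. Qed.
Lemma D_least : DefP 3 (fun r => least (r 0) (r 1) (r 2)). Proof. by rewrite /least; dtac. Qed.
Lemma D_dd : DefP 3 (fun r => dd (r 0) (r 1) (r 2)). Proof. by rewrite /dd; dtac. Qed.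
Hint Resolve D_psucc D_least D_dd : ddb.
Lemma D_hh : DefP 5 (fun r => hh (r 0) (r 1) (r 2) (r 3) (r 4)). Proof. by rewrite /hh; dtac. Qed.
Hint Resolve D_hh : ddb.
Lemma D_addK : DefP 6 (fun r => addK (r 0) (r 1) (r 2) (r 3) (r 4) (r 5)).
Proof. by rewrite /addK; dtac. Qed.
Hint Resolve D_addK : ddb.
Lemma D_convert : DefP 5 (fun r => convert (r 0) (r 1) (r 2) (r 3) (r 4)).
Proof. by rewrite /convert; dtac. Qed.
Lemma D_mulK : DefP 6 (fun r => mulK (r 0) (r 1) (r 2) (r 3) (r 4) (r 5)).
Proof. by rewrite /mulK; dtac. Qed.
Hint Resolve D_convert D_mulK : ddb.
Lemma D_addJ : DefP 6 (fun r => addJ (r 0) (r 1) (r 2) (r 3) (r 4) (r 5)).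
Proof. by rewrite /addJ; dtac. Qed.
Lemma D_mulJ : DefP 6 (fun r => mulJ (r 0) (r 1) (r 2) (r 3) (r 4) (r 5)).
Proof. by rewrite /mulJ; dtac. Qed.
Lemma D_params : DefP 3 (fun r => params (r 0) (r 1) (r 2)).
Proof. by rewrite /params; dtac. Qed.

Section Semantics.
Hypotheses (R_refl : forall x, R x x) (R_trans : forall y x z, R x y -> R y z -> R x z).
Variables (a b c : X) (Jn Kn : nat -> X).
Hypotheses (numJ : forall x, num a b x <-> exists i, eqv x (Jn i))
  (numK : forall x, num a c x <-> exists i, eqv x (Kn i))
  (J_le : forall i j, R (Jn i) (Jn j) <-> i <= j) (K_le : forall i j, R (Kn i) (Kn j) <-> i <= j).
Hypothesis real : forall m f, (forall i j, i <= j -> f j <= f i) ->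
  exists S, forall i j, dd S (Jn i) (Kn j) <-> i <= m /\ j <= f i.

Lemma eqv_l x y z : eqv x y -> (R x z <-> R y z).
Proof. by move=> [h1 h2]; split; apply: R_trans. Qed.
Lemma eqv_r x y z : eqv x y -> (R z x <-> R z y).
Proof. by move=> [h1 h2]; split=> h; [apply: R_trans h h1|apply: R_trans h h2]. Qed.
Lemma eqv_refl x : eqv x x. Proof. by split; apply: R_refl. Qed.
Section Copy.
Variables (b' : X) (M : nat -> X).
Hypotheses (numM : forall x, num a b' x <-> exists i, eqv x (M i))
  (M_le : forall i j, R (M i) (M j) <-> i <= j).

Lemma slt_M x y i j : eqv x (M i) -> eqv y (M j) -> (slt x y <-> i < j).
Proof.
move=> ex ey; rewrite /slt (eqv_l _ ex) (eqv_r _ ey) (eqv_l _ ey) (eqv_r _ ex) !M_le.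
by rewrite ltnNge; split=> [[_ /negP]|/[dup] /negP h h']; [|split=> //; lia].
Qed.

Lemma succ_M x i : eqv x (M i) -> forall y, succ a b' x y <-> eqv y (M i.+1).
Proof.
move=> ex y; split=> [[/numM [j ey] [/(slt_M ex ey) ij h]]|ey].
  have h1 : slt x (M i.+1) by apply/(slt_M ex (eqv_refl _)).
  have h2 : num a b' (M i.+1) by apply/numM; exists i.+1; apply: eqv_refl.
  have := h _ h2 h1; rewrite (eqv_l _ ey) M_le => ji.
  by have -> : i.+1 = j by lia.
split; first by apply/numM; exists i.+1.
split; first by apply/(slt_M ex ey).
move=> z /numM [j ez] /(slt_M ex ez) ij.
by apply/(eqv_l _ ey)/(eqv_r _ ez)/M_le.
Qed.

Lemma least_M o : least a b' o <-> eqv o (M 0).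
Proof.
split=> [[/numM [i ei] h]|e].
  have /h : num a b' (M 0) by apply/numM; exists 0; apply: eqv_refl.
  by rewrite (eqv_l _ ei) M_le leqn0 => /eqP i0; rewrite -i0.
split; first by apply/numM; exists 0.
by move=> w /numM [i ei]; apply/(eqv_l _ e)/(eqv_r _ ei)/M_le.
Qed.

End Copy.

Lemma dd_down S x y x' y' : R x' x -> R y' y -> dd S x y -> dd S x' y'.
Proof.
by move=> hx hy [t [h1 [h2 [h3 h4]]]]; exists t; do !split=> //; [apply: R_trans hx h3|apply: R_trans hy h4].
Qed.

Definition hn S i j := dd S (Jn i) (Kn j) /\ ~ dd S (Jn i) (Kn j.+1).

Lemma hh_E S x y i j : eqv x (Jn i) -> eqv y (Kn j) -> (hh a c S x y <-> hn S i j).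
Proof.
move=> [x1 x2] ey; have [y1 y2] := ey; split=> -[h1 h2]; split.
- exact: dd_down h1.
- move=> h; apply: (h2 (Kn j.+1)); last exact: dd_down h.
  by apply/(succ_M numK K_le ey); apply: eqv_refl.
- exact: dd_down h1.
- move=> y' /(succ_M numK K_le ey) [h3 h4] h; apply: h2; exact: dd_down h.
Qed.

Lemma hn_fun S i j j' : hn S i j -> hn S i j' -> j = j'.
Proof.
move=> [h1 h2] [h1' h2']; case: (ltngtP j j') => // lt.
  by case: h2; apply: dd_down h1' => //; apply/K_le.
by case: h2'; apply: dd_down h1 => //; apply/K_le.
Qed.

Lemma walk S m q p d : hn S 0 q -> hn S m p ->
  (forall i, i < m -> exists j, hn S i.+1 j /\ hn S i (j + d)) -> q = p + m * d.
Proof.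
move=> h0 hm hs; have : forall i, i <= m -> exists2 j, hn S i j & q = j + i * d.
  elim=> [|i IH] im; first by exists q => //; rewrite addn0.
  have [j hj ->] := IH (ltnW im); have [j' [h1 h2]] := hs i im.
  by exists j' => //; rewrite (hn_fun hj h2) mulSn addnA.
by move/(_ m (leqnn m)) => [j hj ->]; rewrite (hn_fun hj hm).
Qed.

Lemma walk_ex m p d : exists S, [/\ hn S 0 (p + m * d), hn S m p &
  forall i, i < m -> exists j, hn S i.+1 j /\ hn S i (j + d)].
Proof.
have [|S hS] := @real m (fun i => p + (m - i) * d).
  by move=> i j ij; rewrite leq_add2l leq_mul2r; apply/orP; right; lia.
have hnS i : i <= m -> hn S i (p + (m - i) * d).
  by move=> im; split; [apply/hS; rewrite leqnn|move/hS; lia].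
exists S; split.
- by have := hnS 0 (leq0n _); rewrite subn0.
- by have := hnS m (leqnn _); rewrite subnn mul0n addn0.
- move=> i im; exists (p + (m - i.+1) * d); split; first exact: hnS.
  have := hnS i (ltnW im); congr (hn S i _); rewrite -addnA; congr (_ + _).
  by have -> : m - i = (m - i.+1).+1 by [lia]; rewrite mulSn addnC.
Qed.

Lemma addK_E y x z m p q : eqv y (Jn m) -> eqv x (Kn p) -> eqv z (Kn q) ->
  (addK a b c y x z <-> q = m + p).
Proof.
move=> ey ex ez; split=> [[S [[o [/(least_M numJ J_le) eo /(hh_E _ eo ez) h0]] [/(hh_E _ ey ex) hm hs]]]|?]; last subst q.
  rewrite (@walk S m q p 1 h0 hm) ?muln1 1?addnC // => i im.
  have ni : num a b (Jn i) by apply/numJ; exists i; apply: eqv_refl.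
  have [|i' [j [j' [/(succ_M numJ J_le (eqv_refl _)) ei [/numK [l ej] [s [h1 h2]]]]]]] := hs _ ni.
    by apply/(slt_M J_le (eqv_refl _) ey).
  have ej' : eqv j' (Kn l.+1) by apply/(succ_M numK K_le ej).
  by exists l; split; [apply/(hh_E _ ei ej)|rewrite addn1; apply/(hh_E _ (eqv_refl _) ej')].
have [S [h0 hm hs]] := walk_ex m p 1; exists S; split; last split.
- exists (Jn 0); split; first by apply/(least_M numJ J_le); apply: eqv_refl.
  apply/(hh_E _ (eqv_refl _) (_ : eqv z (Kn (p + m * 1)))) => //.
  by rewrite muln1 addnC.
- exact/(hh_E _ ey ex).
- move=> i /numJ [i0 ei] /(slt_M J_le ei ey) /hs [j [h1 h2]].
  exists (Jn i0.+1), (Kn j), (Kn j.+1); split; first by apply/(succ_M numJ J_le ei); apply: eqv_refl.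
  split; first by apply/numK; exists j; apply: eqv_refl.
  split; first by apply/(succ_M numK K_le (eqv_refl _)); apply: eqv_refl.
  split; first exact/(hh_E _ (eqv_refl _) (eqv_refl _)).
  by apply/(hh_E _ ei (eqv_refl _)); rewrite -addn1.
Qed.

Lemma convert_E y z m q : eqv y (Jn m) -> eqv z (Kn q) -> (convert a b c y z <-> q = m).
Proof.
move=> ey ez; split=> [[o [/(least_M numK K_le) eo /(addK_E ey eo ez)]]|e]; first by rewrite addn0.
exists (Kn 0); split; first by apply/(least_M numK K_le); apply: eqv_refl.
by apply/(addK_E ey (eqv_refl _) ez); rewrite addn0.
Qed.

Lemma mulK_E y x z m p q : eqv y (Jn m) -> eqv x (Jn p) -> eqv z (Kn q) ->
  (mulK a b c y x z <-> q = m * p).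
Proof.
move=> ey ex ez; split=> [[S [[o [/(least_M numJ J_le) eo /(hh_E _ eo ez) h0]]
    [[o' [/(least_M numK K_le) eo' /(hh_E _ ey eo') hm]] hs]]]|?]; last subst q.
  rewrite (@walk S m q 0 p h0 hm) // => i im.
  have ni : num a b (Jn i) by apply/numJ; exists i; apply: eqv_refl.
  have [|i' [j [j' [/(succ_M numJ J_le (eqv_refl _)) ei [/numK [l ej] [/numK [l' ej'] [s [h1 h2]]]]]]]] := hs _ ni.
    by apply/(slt_M J_le (eqv_refl _) ey).
  move/(addK_E ex ej ej'): s => e.
  by exists l; split; [apply/(hh_E _ ei ej)|rewrite addnC -e; apply/(hh_E _ (eqv_refl _) ej')].
have [S [h0 hm hs]] := walk_ex m 0 p; exists S; split; last split.
- exists (Jn 0); split; first by apply/(least_M numJ J_le); apply: eqv_refl.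
  exact/(hh_E _ (eqv_refl _) ez).
- exists (Kn 0); split; first by apply/(least_M numK K_le); apply: eqv_refl.
  exact/(hh_E _ ey (eqv_refl _)).
- move=> i /numJ [i0 ei] /(slt_M J_le ei ey) /hs [j [h1 h2]].
  exists (Jn i0.+1), (Kn j), (Kn (j + p)); split; first by apply/(succ_M numJ J_le ei); apply: eqv_refl.
  split; first by apply/numK; exists j; apply: eqv_refl.
  split; first by apply/numK; exists (j + p); apply: eqv_refl.
  split; first by apply/(addK_E ex (eqv_refl _) (eqv_refl _)); rewrite addnC.
  split; first exact/(hh_E _ (eqv_refl _) (eqv_refl _)).
  exact/(hh_E _ ei (eqv_refl _)).
Qed.

Lemma addJ_E y x z m p q : eqv y (Jn m) -> eqv x (Jn p) -> eqv z (Jn q) ->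
  (addJ a b c y x z <-> q = m + p).
Proof.
move=> ey ex ez; split=> [[x' [z' [/numK [i ei] [/numK [j ej] [/(convert_E ex ei) e1
    [/(convert_E ez ej) e2 /(addK_E ey ei ej)]]]]]]|e]; first by rewrite e1 e2.
have nK i : num a c (Kn i) by apply/numK; exists i; apply: eqv_refl.
exists (Kn p), (Kn q); do !split=> //.
- exact/(convert_E ex (eqv_refl _)).
- exact/(convert_E ez (eqv_refl _)).
- exact/(addK_E ey (eqv_refl _) (eqv_refl _)).
Qed.

Lemma mulJ_E y x z m p q : eqv y (Jn m) -> eqv x (Jn p) -> eqv z (Jn q) ->
  (mulJ a b c y x z <-> q = m * p).
Proof.
move=> ey ex ez; split=> [[z' [/numK [j ej] [/(convert_E ez ej) e2 /(mulK_E ey ex ej)]]]|e].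
  by rewrite e2.
exists (Kn q); split; [by apply/numK; exists q; apply: eqv_refl|split].
- exact/(convert_E ez (eqv_refl _)).
- exact/(mulK_E ey ex (eqv_refl _)).
Qed.

End Semantics.
End PosetFormulas.

(** * The copies of the natural numbers among forests *)

Section Standard.
Variables (k : nat) (n : onat).
Hypothesis n0 : n <> ofin 0.
Let X := pst k n.
Notation R := (@pst_le k n).
Implicit Types x y z : X.

Lemma eqv_feq x y : eqv R x y <-> feq (sval x) (sval y).
Proof. by rewrite /eqv /pst_le /feq; split=> [[-> ->]|/andP]. Qed.

Lemma tree_pst t : istree t -> okn k n t -> okn k n t && ~~ fle t E.
Proof. by move=> ht ->; rewrite fle_treeE. Qed.

Lemma L_ok p : p < k -> okn k n (L p).
Proof. by rewrite /okn /= => ->; case: n. Qed.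

Lemma label_ex u : okn k n u -> ~~ fle u E -> exists2 i, i < k & fle (L i) u.
Proof.
move=> ok nE; case: (pselect (exists2 i, i < k & fle (L i) u)) => // no; case/negP: nE.
elim: u ok no => [|i|t _ f _|f IHf g IHg] ok no //.
- by case: no; apply: tree_label ok.
- by case: no; apply: tree_label ok.
- move: ok; rewrite okn_J fleJ => /andP [okf okg]; rewrite IHf ?IHg //.
    by move=> [i hi le]; apply: no; exists i => //; apply: fle_Jr.
  by move=> [i hi le]; apply: no; exists i => //; apply: fle_Jl.
Qed.

Lemma mini_E x : mini R x <-> exists2 i, i < k & feq (sval x) (L i).
Proof.
split=> [h|[i hi e] y yx].
  have /andP [ok nE] := svalP x; have [i hi le] := label_ex ok nE.
  exists i => //; rewrite /feq le andbT.
  by apply: (h (Pst (tree_pst (t := L i) isT (L_ok hi)))).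
have /andP [ok nE] := svalP y; have [j hj le] := label_ex ok nE.
rewrite /pst_le in yx *; rewrite (fle_feqr _ e) in yx; rewrite (fle_feql _ e).
by have := fle_trans le yx; rewrite fleLL => /eqP <-.
Qed.

Lemma lub_E y z w : lub R y z w <-> feq (sval w) (J (sval y) (sval z)).
Proof.
have /andP [ok1 nE1] := svalP y; have /andP [ok2 nE2] := svalP z.
have hJ : okn k n (J (sval y) (sval z)) && ~~ fle (J (sval y) (sval z)) E.
  by rewrite okn_J ok1 ok2 fleJ (negPf nE1).
split=> [[h1 [h2 h3]]|e].
  rewrite /feq fleJ; apply/andP; split; last by apply/andP; split.
  by apply: (h3 (Pst hJ)); rewrite /pst_le; [apply: fle_Jl|apply: fle_Jr]; apply: fle_refl.
rewrite /lub /pst_le !(fle_feqr _ e) fle_Jl ?fle_refl // fle_Jr ?fle_refl //; split=> //; split=> //.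
by move=> v h1 h2; rewrite (fle_feql _ e) fleJ h1 h2.
Qed.

Lemma irr_E x : irr R x <-> exists t, [/\ istree t, okn k n t & feq (sval x) t].
Proof.
split=> [h|[t [ht ok e]] y z w /lub_E ew]; last first.
  by rewrite /pst_le !(fle_feql _ e) (fle_feqr _ ew) fle_treeJ // => /orP.
have /andP [ok nE] := svalP x; apply: tree_le_J ok nE _ => y z hy hz le.
have hJ : okn k n (J y z) && ~~ fle (J y z) E.
  by case/andP: hy => h1 h2; case/andP: hz => h3 h4; rewrite okn_J h1 h3 fleJ (negPf h2).
by apply: (h (Pst hy) (Pst hz) (Pst hJ)) => //; apply/lub_E; apply: feq_refl.
Qed.

Section Num.
Variables (p q : nat) (a b : X).
Hypotheses (pk : p < k) (qk : q < k) (pq : p <> q)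
  (ap : feq (sval a) (L p)) (bq : feq (sval b) (L q)).

Let qp : q <> p. Proof. by congruence. Qed.

Lemma jt_pst i : okn k n (jt p q i.+1) && ~~ fle (jt p q i.+1) E.
Proof. by rewrite /jt okn_J !al_ok //= fleJ fle_treeE. Qed.

(** The shift by one is due to chains of length 0 being empty, while the poset consists of nonempty
    forests. *)
Definition Jst i : X := Pst (jt_pst i).

Lemma jt_le i j : fle (jt p q i.+1) (jt p q j.+1) = (i <= j).
Proof.
apply/idP/idP => [|ij].
  rewrite /jt fleJ fle_treeJ // => /andP [/orP [] h _]; by have := al_le_size pq h.
by rewrite /jt fleJ fle_Jl ?fle_Jr // al_mono.
Qed.

(** At level 1 all labels are leaves. So a node labelled by a chain can lie below an element only
    from level 2 on, and there it is itself an element of the poset. *)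
Lemma no_nested u p' q' : p' <> q' -> okn k n u -> fle (N (al p' q' 2) E) u ->
  p' < k -> q' < k -> okn k n (N (al p' q' 2) E).
Proof.
move=> pq' oku le hp hq.
have key : n <> ofin 1.
  move=> e; rewrite e in oku *; move/negP: isT; apply.
  elim: u oku le => [|i|t _ f IHf|f IHf g IHg] //.
  - by rewrite fleNL /= fleNL fleLL fleNL fleLL => _ /andP [/and3P [/eqP e1 /eqP e2 _] _]; congruence.
  - move=> ok; have [_ _ okf] := okn_N ok.
    rewrite fleNN => /orP [/andP [h _]|/(IHf okf) //].
    move: ok; rewrite /okn /= => /andP [/and3P [tt _ _]]; rewrite geq_max => /andP [r _].
    case: t tt r h => // [i|t1 f1] _.
      by rewrite /= fleNL fleLL fleNL fleLL => _ /and3P [/eqP e1 /eqP e2 _]; congruence.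
    by rewrite /=; lia.
  - by rewrite okn_J fle_treeJ // => /andP [okf okg] /orP [/(IHf okf)|/(IHg okg)].
rewrite /okn /= hp hq /=; move: key n0; case: (n) => // -[|[|m]] // _ _.
Qed.

(** The greatest strict predecessor [z] granted by [std] contradicts [no_cover]: the forest
    [N (L c) (sval z)] is again strictly below the nested node, but not below [z]. *)
Lemma std_no_nested x p' q' : p' < k -> q' < k -> p' <> q' -> std R x ->
  ~~ fle (N (al p' q' 2) E) (sval x).
Proof.
move=> hp hq pq' st; apply/negP => le; have /andP [okx _] := svalP x.
have ok := no_nested pq' okx le hp hq.
pose y : X := Pst (tree_pst (t := N (al p' q' 2) E) isT ok).
have [||/mini_E [i _ /andP [h _]]|[z [[zy nyz] hz]]] := st y.
- exact: le.
- by apply/irr_E; exists (sval y); split=> //; apply: feq_refl.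
- by move: h; rewrite /= !fleNL !fleLL => /andP [/and3P [/eqP e1 /eqP e2 _] _]; congruence.
have /andP [okz nEz] := svalP z.
have [c [hc h1 h2 h3]] := no_cover pq' okz zy (introN idP nyz).
have okN : okn k n (N (L c) (sval z)).
  move: okz; rewrite /okn /= => /andP [-> hr].
  have -> : c < k by case: hc => ->.
  by move: hr n0; move: (sval z) => u; case: (n) => // -[|m] //= hr _; rewrite geq_max hr.
case/negP: h3; apply: (hz (Pst (tree_pst (t := N (L c) (sval z)) isT okN))).
by split=> //; apply/negP.
Qed.

(** A number has a normal form as a join of two chains. If the lengths differ, the longer chain
    contains the other and the join is irreducible, so they are equal. Conversely, the irreducible
    elements below such a join are alternating chains. *)
Lemma num_E x : num R a b x <-> exists i, eqv R x (Jst i).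
Proof.
have /andP [okx nEx] := svalP x; split=> [[lab [nirr st]]|[i /eqv_feq e]].
  have plab : pqlab p q (sval x).
    move=> i hi; have /andP [okL _] : okn k n (L i) && ~~ fle (L i) E.
      move: okx hi; clear -n0; move: (sval x) => u.
      elim: u => [|j|t IHt f IHf|f IHf g IHg] //.
      - by rewrite fleLL => ok /eqP ->; rewrite ok fle_treeE.
      - by move=> /okn_N [_ ok1 ok2]; rewrite fleLN => /orP [/(IHt ok1)|/(IHf ok2)].
      - by rewrite okn_J => /andP [ok1 ok2]; rewrite fle_treeJ // => /orP [/(IHf ok1)|/(IHg ok2)].
    have ik : i < k by move: okL => /andP [].
    have m : mini R (Pst (tree_pst (t := L i) isT okL)) by apply/mini_E; exists i => //; apply: feq_refl.
    have := lab _ m hi; rewrite !eqv_feq /= => -[] /andP [h _].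
      by left; move: h; rewrite (fle_feqr _ ap) fleLL => /eqP.
    by right; move: h; rewrite (fle_feqr _ bq) fleLL => /eqP.
  have [i [j e]] := al_normal pq okx plab (std_no_nested pk qk pq st) (std_no_nested qk pk qp st).
  case: (ltngtP i j) => ij.
  - case: nirr; apply/irr_E; exists (al q p j); split; [by case: j ij {e}|exact: al_ok|].
    by apply: feq_trans e _; rewrite /feq fleJ al_swap // fle_Jr fle_refl.
  - case: nirr; apply/irr_E; exists (al p q i); split; [by case: i ij {e}|exact: al_ok|].
    by apply: feq_trans e _; rewrite /feq fleJ al_swap // fle_Jl fle_refl.
  - case: i ij e => [<- /andP [e _]|i <- e]; last by exists i; apply/eqv_feq.
    by case/negP: nEx; apply: fle_trans e _.
split; [|split].
- move=> m /mini_E [j jk ej]; rewrite /pst_le (fle_feql _ ej) (fle_feqr _ e) /= fle_treeJ //.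
  by case/orP => /al_label [] jE; [left|right|right|left]; apply/eqv_feq; apply: feq_trans ej _;
    rewrite jE feq_sym.
- move=> /irr_E [t [tt okt et]].
  have : feq t (jt p q i.+1) by rewrite feq_sym; apply: feq_trans et; rewrite feq_sym.
  case/andP; rewrite fle_treeJ // => /orP [] h; rewrite fleJ => /andP [h1 h2].
    by have := al_swap_lt qp (ltn0Sn _) (fle_trans h2 h); rewrite ltnn.
  by have := al_swap_lt pq (ltn0Sn _) (fle_trans h1 h); rewrite ltnn.
- move=> y; rewrite /pst_le (fle_feqr _ e) => yx /irr_E [t [tt okt et]].
  have aux p' q' : p' <> q' -> p' < k -> q' < k -> (forall l, feq (jt p q l) (jt p' q' l)) ->
      fle t (al p' q' i.+1) -> mini R y \/ exists z, slt R z y /\ forall w, slt R w y -> R w z.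
    move=> pq' pk' qk' jE; have qp' : q' <> p' by congruence.
    move=> /(al_normal_below pq' okt) /(al_normal_tree tt) [l hl].
    have aux2 p1 q1 : p1 <> q1 -> p1 < k -> q1 < k -> (forall l, feq (jt p q l) (jt p1 q1 l)) ->
      feq t (al p1 q1 l.+1) -> mini R y \/ exists z, slt R z y /\ forall w, slt R w y -> R w z.
      move=> pq1 pk1 qk1 jE1 tl; have ty := feq_trans et tl.
      case: l {hl tl} ty => [|l] ty.
        left; apply/mini_E; exists p1 => //; apply: feq_trans ty _.
        by have := L_al p1 q1; rewrite feq_sym.
      (* The greatest element strictly below a chain of length [l.+2] is the join of both chains of
         length [l.+1]. *)
      right; exists (Jst l); split.
        rewrite /slt /pst_le (fle_feqr _ ty) (fle_feql _ ty) (fle_feql _ (jE1 _)) (fle_feqr _ (jE1 _)).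
        split; first by rewrite /jt fleJ al_mono ?al_swap.
        by rewrite /jt fle_treeJ // => /orP [] /(al_le_size pq1); rewrite ltnn.
      move=> w; rewrite /slt /pst_le (fle_feqr _ ty) (fle_feql _ ty) (fle_feqr _ (jE1 _)) => -[w1 w2].
      have /andP [okw _] := svalP w.
      have [i0 [j0 /andP [e0 e1]]] := al_normal_below pq1 okw w1.
      move: e1; rewrite fleJ => /andP [e1 e2].
      apply: fle_trans e0 _; rewrite fleJ /jt; apply/andP; split.
        apply: fle_Jl; apply: al_mono; have := al_le_size pq1 (fle_trans e1 w1).
        rewrite leq_eqVlt => /orP [/eqP ei|]; last by rewrite ltnS.
        by case: w2; rewrite -ei.
      case: j0 e2 => // j0 e2; apply: fle_Jr; apply: al_mono.
      have qp1 : q1 <> p1 by congruence.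
      by have := al_swap_lt qp1 (ltn0Sn _) (fle_trans e2 w1).
    by case: hl; apply: aux2 => // l'; apply: feq_trans (jE l') _; apply: feq_JC; apply: feq_refl.
  have := fle_trans (proj2 (andP et)) yx; rewrite fle_treeJ // => /orP []; apply: aux => //.
    by move=> l; apply: feq_refl.
  by move=> l; apply: feq_JC; apply: feq_refl.
Qed.

End Num.

(** The chain that starts with [q] avoids the root, labelled [p], and the second branch, which has
    no [q]; so it must fit into the first branch. The chain that starts with [p] may put its first
    node at the root. *)
Lemma rect_le p q r i i' j' : p <> q -> q <> r ->
  fle (jt p q i.+1) (N (L p) (J (al q p i'.+1) (al r p j'.+1))) = (i <= i').
Proof.
move=> pq qr; have qp : q <> p by congruence.
apply/idP/idP => [|ii].
  rewrite /jt fleJ => /andP [_]; rewrite -[al q p i.+1]/(N (L q) (al p q i)) fleNN fleLL.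
  have -> : (q == p) = false by apply/eqP.
  rewrite andFb orFb -[N (L q) (al p q i)]/(al q p i.+1) fle_treeJ // => /orP [/(al_le_size qp) //|h].
  have : fle (L q) (al r p j'.+1) by apply: fle_trans h; rewrite /= fleLN fleLL eqxx.
  by case/al_label; congruence.
rewrite /jt fleJ; apply/andP; split; last by apply: fle_N; apply: fle_Jl; apply: al_mono.
rewrite /= fleNN fle_refl /=; apply/orP; left; apply: fle_N; apply: fle_Jl.
by rewrite -/(al q p i'.+1); apply: al_mono; apply: leqW.
Qed.

Lemma rect_le' p q r i i' j' : p <> r -> q <> r ->
  fle (jt p r i.+1) (N (L p) (J (al q p j'.+1) (al r p i'.+1))) = (i <= i').
Proof.
move=> pr qr; have rq : r <> q by congruence.
rewrite -(rect_le i i' j' pr rq); apply: fle_feqr.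
have /andP [e1 e2] := feq_JC (al q p j'.+1) (feq_refl (al r p i'.+1)).
by rewrite /feq !fleNN fle_refl !fle_N.
Qed.

(** The forest joins the rectangles with corners [(i, f i)] for [i <= m]; as [f] is decreasing,
    their union is the region below its graph. *)
Lemma rect_real p q r (pk : p < k) (qk : q < k) (rk : r < k) (pq : p <> q) (pr : p <> r) m f :
  q <> r -> (forall i j, i <= j -> f j <= f i) ->
  exists S, forall i j, dd R S (Jst pk qk i) (Jst pk rk j) <-> i <= m /\ j <= f i.
Proof.
move=> qr fdec; pose t i := N (L p) (J (al q p i.+1) (al r p (f i).+1)).
have okt i : okn k n (t i).
  have h : okn k n (J (al q p i.+1) (al r p (f i).+1)) by rewrite okn_J !al_ok.
  move: h; rewrite /t /okn; move: (J _ _) => u /= /andP [-> hr]; rewrite pk /=.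
  by move: hr n0; case: (n) => // -[|l] //= hr _; rewrite geq_max hr.
pose s m := bigJ [seq t i | i <- iota 0 m.+1].
have oks : okn k n (s m) && ~~ fle (s m) E.
  have h l : okn k n (bigJ (map t l)) by elim: l => [|i l IH] /=; [exact: okn_E|rewrite okn_J okt].
  by rewrite h /s [iota _ _]/= map_cons [bigJ _]/= fleJ fle_treeE.
exists (Pst oks) => i j; split=> [[t0 [/irr_E [t1 [tt ok1 e1]] [h1 [h2 h3]]]]|[im jf]].
  move: h1 h2 h3; rewrite /pst_le (fle_feql _ e1) !(fle_feqr _ e1) /= fle_bigJ // has_map.
  case/hasP => i'; rewrite mem_iota add0n ltnS => /andP [_ im] /= h1 h2 h3.
  have := fle_trans h2 h1; rewrite rect_le // => ii.
  have := fle_trans h3 h1; rewrite rect_le' // => jf.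
  by split; [apply: leq_trans ii im|apply: leq_trans jf (fdec _ _ ii)].
exists (Pst (tree_pst (t := t i) isT (okt i))); split; first by apply/irr_E; exists (t i); split; rewrite ?feq_refl.
split; last by rewrite /pst_le /= rect_le // rect_le'.
rewrite /pst_le [sval _]/= [sval (Pst oks)]/= fle_bigJ // has_map; apply/hasP; exists i; last exact: fle_refl.
by rewrite mem_iota add0n.
Qed.

Lemma pst_interp a b c : params R a b c -> exists Jn : nat -> X,
  [/\ forall x, num R a b x <-> exists i, eqv R x (Jn i),
      forall i j, eqv R (Jn i) (Jn j) -> i = j,
      forall y x z m p q, eqv R y (Jn m) -> eqv R x (Jn p) -> eqv R z (Jn q) ->
        (addJ R a b c y x z <-> q = m + p) &
      forall y x z m p q, eqv R y (Jn m) -> eqv R x (Jn p) -> eqv R z (Jn q) ->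
        (mulJ R a b c y x z <-> q = m * p)].
Proof.
move=> [/mini_E [p pk ap] [/mini_E [q qk bq] [/mini_E [r rk cr] [ab [ac bc]]]]].
have pq : p <> q by move=> e; apply: ab; rewrite /pst_le (fle_feql _ ap) (fle_feqr _ bq) e fle_refl.
have pr : p <> r by move=> e; apply: ac; rewrite /pst_le (fle_feql _ ap) (fle_feqr _ cr) e fle_refl.
have qr : q <> r by move=> e; apply: bc; rewrite /pst_le (fle_feql _ bq) (fle_feqr _ cr) e fle_refl.
have R_refl x : R x x by apply: fle_refl.
have R_trans y x z : R x y -> R y z -> R x z by apply: fle_trans.
have hJ := num_E pk qk pq ap bq; have hK := num_E pk rk pr ap cr.
have J_le i j : R (Jst pk qk i) (Jst pk qk j) <-> i <= j by rewrite /pst_le jt_le.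
have K_le i j : R (Jst pk rk i) (Jst pk rk j) <-> i <= j by rewrite /pst_le jt_le.
have hr m f := @rect_real p q r pk qk rk pq pr m f qr.
exists (Jst pk qk); split=> //.
- by move=> i j [/J_le h1 /J_le h2]; apply/eqP; rewrite eqn_leq h1.
- by move=> *; apply: (addJ_E R_refl R_trans hJ hK J_le K_le hr).
- by move=> *; apply: (mulJ_E R_refl R_trans hJ hK J_le K_le hr).
Qed.

Lemma params_ex : 2 < k -> exists a b c, params R a b c.
Proof.
move=> k3; have h i : i < 3 -> okn k n (L i) && ~~ fle (L i) E.
  by move=> hi; apply: tree_pst => //; apply: L_ok; lia.
exists (Pst (h 0 isT)), (Pst (h 1 isT)), (Pst (h 2 isT)).
rewrite /params /pst_le /= !fleLL; do !split=> //; apply/mini_E; eexists; try exact: feq_refl; lia.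
Qed.

End Standard.

(** * Reduction of arithmetic *)

Section Rebind.
Variables (X : Type) (R : X -> X -> Prop).
Hypotheses (R_refl : forall x, R x x) (R_trans : forall y x z, R x y -> R y z -> R x z).

Lemma gsat_eqv r r' f : (forall i, eqv R (r i) (r' i)) -> (gsat R r f <-> gsat R r' f).
Proof.
move=> h; apply: (gsat_transfer (sim := eqv R)) => //.
- by move=> x; exists x.
- by move=> x; exists x.
- move=> x y x' y' [h1 h2] [h3 h4]; split=> h5.
    exact: R_trans h2 (R_trans h5 h3).
  exact: R_trans h1 (R_trans h5 h4).
Qed.

(* [phi] with its six variables set equal to given ones: quantifying over copies of these takes
   the place of a substitution. *)
Definition rb phi e i j l := PEx (PEx (PEx (PEx (PEx (PEx
  (PAnd (PEq 0 (e + 6)) (PAnd (PEq 1 (e + 7)) (PAnd (PEq 2 (e + 8)) (PAnd (PEq 3 (i + 6))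
  (PAnd (PEq 4 (j + 6)) (PAnd (PEq 5 (l + 6)) phi))))))))))).

Definition env6 (x0 x1 x2 x3 x4 x5 : X) r :=
  scons x0 (scons x1 (scons x2 (scons x3 (scons x4 (scons x5 r))))).

Lemma env6E x0 x1 x2 x3 x4 x5 r i : env6 x0 x1 x2 x3 x4 x5 r (i + 6) = r i.
Proof. by rewrite !addnS addn0. Qed.

Lemma rbE phi e i j l r :
  gsat R r (rb phi e i j l) <-> gsat R (env6 (r e) (r e.+1) (r e.+2) (r i) (r j) (r l) r) phi.
Proof.
have e6 x0 x1 x2 x3 x4 x5 p : scons x0 (scons x1 (scons x2 (scons x3 (scons x4 (scons x5 r))))) (p + 6) = r p.
  exact: env6E.
have e7 x0 x1 x2 x3 x4 x5 p : scons x0 (scons x1 (scons x2 (scons x3 (scons x4 (scons x5 r))))) (p + 7) = r p.+1.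
  by have -> : p + 7 = p.+1 + 6 by [lia]; apply: e6.
have e8 x0 x1 x2 x3 x4 x5 p : scons x0 (scons x1 (scons x2 (scons x3 (scons x4 (scons x5 r))))) (p + 8) = r p.+2.
  by have -> : p + 8 = p.+2 + 6 by [lia]; apply: e6.
split=> [|h].
  move=> /= [x5 [x4 [x3 [x2 [x1 [x0]]]]]]; rewrite !e6 e7 e8.
  move=> [h0 [h1 [h2 [h3 [h4 [h5]]]]]].
  apply: (proj1 (gsat_eqv _ _)); case=> [|[|[|[|[|[|p]]]]]] //=.
exists (r l), (r j), (r i), (r e.+2), (r e.+1), (r e) => /=.
by rewrite !e6 e7 e8; do !split.
Qed.

Lemma pbound_mono m m' f : m <= m' -> pbound m f -> pbound m' f.
Proof. by rewrite !pbndP; lia. Qed.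

Lemma rb_bound phi e i j l m : pbound 6 phi -> e.+2 < m -> i < m -> j < m -> l < m ->
  pbound m (rb phi e i j l).
Proof. by move=> hp *; rewrite /=; do !split; try lia; apply: pbound_mono hp; lia. Qed.
End Rebind.

Definition rbC (phi e i j l : nat) := cpair 7 (cpair 7 (cpair 7 (cpair 7 (cpair 7 (cpair 7
  (cpair 3 (cpair (cpair 1 (cpair 0 (e + 6))) (cpair 3 (cpair (cpair 1 (cpair 1 (e + 7)))
  (cpair 3 (cpair (cpair 1 (cpair 2 (e + 8))) (cpair 3 (cpair (cpair 1 (cpair 3 (i + 6)))
  (cpair 3 (cpair (cpair 1 (cpair 4 (j + 6))) (cpair 3 (cpair (cpair 1 (cpair 5 (l + 6))) phi))))))))))))))))).

Definition opC phi e := rbC (pcode phi) e 1 0 2.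
Definition numC phi e := rbC (pcode phi) e 0 0 0.

Lemma C_opC phi : C1 (opC phi).
Proof. by rewrite /opC /rbC; ctac. Qed.

Lemma C_numC phi : C1 (numC phi).
Proof. by rewrite /numC /rbC; ctac. Qed.
#[local] Hint Resolve C_opC C_numC : cdb.

Section A2P.
Variables NUM ADD MUL PAR : pform.

(* Variable [i] of the arithmetic formula is at index [i + s], the three parameters are at
   [D + s, D + s + 1, D + s + 2], and the value of the term is at index [0]. *)
Fixpoint t2p s D t := match t with
  | AVar i => PEq 0 (i + s)
  | AAdd u v => PEx (PAnd (t2p s.+1 D u) (PEx (PAnd (t2p s.+2 D v) (rb ADD (D + s.+2) 1 0 2))))
  | AMul u v => PEx (PAnd (t2p s.+1 D u) (PEx (PAnd (t2p s.+2 D v) (rb MUL (D + s.+2) 1 0 2))))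
  end.

Fixpoint a2p D f := match f with
  | AEq t u => PEx (PAnd (t2p 1 D t) (t2p 1 D u))
  | ANot a => PNot (a2p D a)
  | AAnd a b => PAnd (a2p D a) (a2p D b)
  | AOr a b => POr (a2p D a) (a2p D b)
  | AImp a b => PImp (a2p D a) (a2p D b)
  | AAll a => PAll (PImp (rb NUM D.+1 0 0 0) (a2p D.+1 a))
  | AEx a => PEx (PAnd (rb NUM D.+1 0 0 0) (a2p D.+1 a)) end.

Definition t2pG h c d := let s := cfst d in let D := csnd d in
  let u := h (cfst (csnd c)) (cpair s.+1 D) in let v := h (csnd (csnd c)) (cpair s.+2 D) in
  if cfst c == 0 then cpair 1 (cpair 0 (csnd c + s))
  else cpair 7 (cpair 3 (cpair u (cpair 7 (cpair 3 (cpair v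
    (if cfst c == 1 then opC ADD (D + s.+2) else opC MUL (D + s.+2))))))).

(** Each operation opens two quantifiers, so the offset [s] grows by up to 2 in the calls; this is
    where [rec2] needs an increasing parameter. *)
Lemma t2p_code : exists h, C2 h /\ forall t s D, h (tcode t) (cpair s D) = pcode (t2p s D t).
Proof.
have [||//|h [hC hE]] := @rec2 t2pG (fun d => cpair (cfst d).+2 (csnd d)).
- rewrite /t2pG; cbv zeta; ctac.
- by ctac.
- move=> c d f f' ff'; rewrite /t2pG; case: eqP => // /eqP; rewrite -lt0n => /ltn_csnd lt.
  rewrite !ff' //; try exact: leq_cpair.
    exact: leq_ltn_trans (leq_csnd _) lt.
  exact: leq_ltn_trans (leq_cfst _) lt.
exists h; split=> //.
by elim=> [i|u IHu v IHv|u IHu v IHv] s D; rewrite hE /t2pG !cfst_cpair !csnd_cpair /=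
  ?cfst_cpair ?csnd_cpair ?IHu ?IHv.
Qed.

Section Code.
Variable T : nat -> nat -> nat.
Hypotheses (TC : C2 T) (TE : forall t s D, T (tcode t) (cpair s D) = pcode (t2p s D t)).

Definition a2pG h c D := let i := cfst (csnd c) in let j := csnd (csnd c) in let b := csnd c in
  if cfst c == 0 then cpair 7 (cpair 3 (cpair (T i (cpair 1 D)) (T j (cpair 1 D))))
  else if cfst c == 1 then cpair 2 (h b D)
  else if cfst c == 2 then cpair 3 (cpair (h i D) (h j D))
  else if cfst c == 3 then cpair 4 (cpair (h i D) (h j D))
  else if cfst c == 4 then cpair 5 (cpair (h i D) (h j D))
  else if cfst c == 5 then cpair 6 (cpair 5 (cpair (numC NUM D.+1) (h b D.+1)))
  else cpair 7 (cpair 3 (cpair (numC NUM D.+1) (h b D.+1))).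

Lemma a2p_code : exists h, C1 h /\ forall f, h (acode f) = pcode (a2p 0 f).
Proof.
have [||//|h [hC hE]] := @rec2 a2pG S.
- rewrite /a2pG; cbv zeta; ctac.
- by ctac.
- move=> c d f f' ff'; rewrite /a2pG; case: eqP => // /eqP; rewrite -lt0n => /ltn_csnd lt.
  have l1 := leq_ltn_trans (leq_csnd (csnd c)) lt; have l2 := leq_ltn_trans (leq_cfst (csnd c)) lt.
  by rewrite !ff' //.
exists (fun c => h c 0); split; first by ctac.
move=> f; move: 0 => D.
elim: f D => [t u|f IH|f If g Ig|f If g Ig|f If g Ig|f IH|f IH] D;
  rewrite hE /a2pG !cfst_cpair !csnd_cpair /= ?cfst_cpair ?csnd_cpair ?IH ?If ?Ig ?TE //.
Qed.
End Code.

Section Correct.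
Variables (X : Type) (R : X -> X -> Prop).
Hypotheses (R_refl : forall x, R x x) (R_trans : forall y x z, R x y -> R y z -> R x z).
Hypotheses (NUMb : pbound 6 NUM) (ADDb : pbound 6 ADD) (MULb : pbound 6 MUL) (PARb : pbound 3 PAR)
  (NUM_E : forall r, gsat R r NUM <-> num R (r 0) (r 1) (r 3))
  (ADD_E : forall r, gsat R r ADD <-> num R (r 0) (r 1) (r 5) /\ addJ R (r 0) (r 1) (r 2) (r 3) (r 4) (r 5))
  (MUL_E : forall r, gsat R r MUL <-> num R (r 0) (r 1) (r 5) /\ mulJ R (r 0) (r 1) (r 2) (r 3) (r 4) (r 5))
  (PAR_E : forall r, gsat R r PAR <-> params R (r 0) (r 1) (r 2)).

Lemma t2p_bound s D t : tbound D t -> 0 < s -> pbound (D + s + 3) (t2p s D t).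
Proof.
elim: t s => [i|u IHu v IHv|u IHu v IHv] s; first by rewrite /=; lia.
  move=> [hu hv] hs; have h1 := IHu s.+1 hu isT; have h2 := IHv s.+2 hv isT.
  split; [apply: pbound_mono h1; lia|split; [apply: pbound_mono h2; lia|apply: rb_bound ADDb _ _ _ _; lia]].
move=> [hu hv] hs; have h1 := IHu s.+1 hu isT; have h2 := IHv s.+2 hv isT.
split; [apply: pbound_mono h1; lia|split; [apply: pbound_mono h2; lia|apply: rb_bound MULb _ _ _ _; lia]].
Qed.

Lemma a2p_bound D f : abound D f -> pbound (D + 3) (a2p D f).
Proof.
elim: f D => [t u|f IH|f If g Ig|f If g Ig|f If g Ig|f IH|f IH] D.
- case=> ht hu; have h1 := t2p_bound ht (ltn0Sn 0); have h2 := t2p_bound hu (ltn0Sn 0).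
  by split; rewrite -[X in pbound X]/(D.+1 + 3) -addn1.
- exact: IH.
- by case=> /If hf /Ig hg; split.
- by case=> /If hf /Ig hg; split.
- by case=> /If hf /Ig hg; split.
- by move/IH => h; split; last exact: h; apply: rb_bound NUMb _ _ _ _; lia.
- by move/IH => h; split; last exact: h; apply: rb_bound NUMb _ _ _ _; lia.
Qed.

Variables (a b c : X) (Jn : nat -> X).
Hypotheses (numJ : forall x, num R a b x <-> exists i, eqv R x (Jn i))
  (J_inj : forall i j, eqv R (Jn i) (Jn j) -> i = j)
  (addJJ : forall y x z m p q, eqv R y (Jn m) -> eqv R x (Jn p) -> eqv R z (Jn q) ->
        (addJ R a b c y x z <-> q = m + p))
  (mulJJ : forall y x z m p q, eqv R y (Jn m) -> eqv R x (Jn p) -> eqv R z (Jn q) ->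
        (mulJ R a b c y x z <-> q = m * p)).

Definition good_env (r : nat -> X) rho s D :=
  (forall i, i < D -> eqv R (r (i + s)) (Jn (rho i))) /\
  [/\ r (D + s) = a, r (D + s).+1 = b & r (D + s).+2 = c].

Lemma good_env_cons r rho s D x : good_env r rho s D -> good_env (scons x r) rho s.+1 D.
Proof. by move=> [h1 h2]; split; rewrite ?addnS // => i hi; rewrite addnS; apply: h1. Qed.

Let eqvR x : eqv R x x. Proof. by split. Qed.
Let eqvS x y : eqv R x y -> eqv R y x. Proof. by case. Qed.
Let eqvT y x z : eqv R x y -> eqv R y z -> eqv R x z.
Proof. by move=> [h1 h2] [h3 h4]; split; [apply: R_trans h1 h3|apply: R_trans h4 h2]. Qed.

Lemma t2pE t r rho s D : tbound D t -> good_env r rho s D ->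
  (gsat R r (t2p s D t) <-> eqv R (r 0) (Jn (aeval rho t))).
Proof.
elim: t r s => [i|t1 IH1 t2 IH2|t1 IH1 t2 IH2] r s.
- move=> hi [h1 _]; rewrite [gsat _ _ _]/= -/(eqv R (r 0) (r (i + s))).
  have ei := h1 i hi; split=> h; first exact: eqvT h ei.
  exact: eqvT h (eqvS ei).
- move=> [b1 b2] g; have E1 x := IH1 (scons x r) _ b1 (good_env_cons x g).
  have E2 x y := IH2 (scons y (scons x r)) _ b2 (good_env_cons y (good_env_cons x g)).
  have E3 x y : gsat R (scons y (scons x r)) (rb ADD (D + s.+2) 1 0 2) <->
      num R a b (r 0) /\ addJ R a b c x y (r 0).
    by rewrite (rbE R_refl R_trans) ADD_E /= !addnS /=; have [_ [-> -> ->]] := g.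
  split=> [[x [/E1 ex [y [/E2 ey /E3 [/numJ [m em] /(addJJ ex ey em) e]]]]]|ez].
    by rewrite /= -[Nat.add _ _]/(_ + _) -e.
  exists (Jn (aeval rho t1)); split; first by apply/E1; apply: eqvR.
  exists (Jn (aeval rho t2)); split; first by apply/E2; apply: eqvR.
  apply/E3; split; first by apply/numJ; eexists; exact: ez.
  by apply/(addJJ (eqvR _) (eqvR _) ez).
- move=> [b1 b2] g; have E1 x := IH1 (scons x r) _ b1 (good_env_cons x g).
  have E2 x y := IH2 (scons y (scons x r)) _ b2 (good_env_cons y (good_env_cons x g)).
  have E3 x y : gsat R (scons y (scons x r)) (rb MUL (D + s.+2) 1 0 2) <->
      num R a b (r 0) /\ mulJ R a b c x y (r 0).
    by rewrite (rbE R_refl R_trans) MUL_E /= !addnS /=; have [_ [-> -> ->]] := g.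
  split=> [[x [/E1 ex [y [/E2 ey /E3 [/numJ [m em] /(mulJJ ex ey em) e]]]]]|ez].
    by rewrite /= -[Nat.mul _ _]/(_ * _) -e.
  exists (Jn (aeval rho t1)); split; first by apply/E1; apply: eqvR.
  exists (Jn (aeval rho t2)); split; first by apply/E2; apply: eqvR.
  apply/E3; split; first by apply/numJ; eexists; exact: ez.
  by apply/(mulJJ (eqvR _) (eqvR _) ez).
Qed.

Lemma good_env_bind r rho D x m : good_env r rho 0 D -> eqv R x (Jn m) ->
  good_env (scons x r) (scons m rho) 0 D.+1.
Proof. by move=> [h1 h2] ex; split=> // -[|i] // hi; apply: h1. Qed.

Lemma a2pE f r rho D : abound D f -> good_env r rho 0 D -> (gsat R r (a2p D f) <-> asat rho f).
Proof.
elim: f r rho D => [t u|f IH|f If g Ig|f If g Ig|f If g Ig|f IH|f IH] r rho D.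
- move=> [ht hu] g.
  have E x := t2pE ht (good_env_cons x g); have E' x := t2pE hu (good_env_cons x g).
  split=> [[x [/E e1 /E' e2]]|e]; first by apply: J_inj; apply: eqvT (eqvS e1) e2.
  by exists (Jn (aeval rho t)); split; [apply/E|apply/E'; rewrite -e]; apply: eqvR.
- by move=> h e; rewrite /= (IH r rho).
- by move=> [h1 h2] e; rewrite /= (If r rho) // (Ig r rho).
- by move=> [h1 h2] e; rewrite /= (If r rho) // (Ig r rho).
- by move=> [h1 h2] e; rewrite /= (If r rho) // (Ig r rho).
- move=> hf g.
  have E x : gsat R (scons x r) (rb NUM D.+1 0 0 0) <-> num R a b x.
    by rewrite (rbE R_refl R_trans) NUM_E /=; have [_] := g; rewrite !addn0 => -[-> -> _].
  split=> [h m|h x /E /numJ [m em]].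
    apply/(IH _ _ _ hf (good_env_bind g (eqvR (Jn m)))).
    by apply: h; apply/E/numJ; exists m; apply: eqvR.
  exact/(IH _ _ _ hf (good_env_bind g em)).
- move=> hf g.
  have E x : gsat R (scons x r) (rb NUM D.+1 0 0 0) <-> num R a b x.
    by rewrite (rbE R_refl R_trans) NUM_E /=; have [_] := g; rewrite !addn0 => -[-> -> _].
  split=> [[x [/E /numJ [m em] h]]|[m h]].
    by exists m; apply/(IH _ _ _ hf (good_env_bind g em)).
  exists (Jn m); split; first by apply/E/numJ; exists m; apply: eqvR.
  exact/(IH _ _ _ hf (good_env_bind g (eqvR (Jn m)))).
Qed.
End Correct.
End A2P.

Theorem arith_to_poset k n : 2 < k -> n <> ofin 0 -> exists h, C1 h /\
  forall c, Th_arith c <-> Th_poset (@FFk_le k n) (h c).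
Proof.
move=> k3 n0; pose R := @pst_le k n.
have R_refl x : R x x by apply: fle_refl.
have R_trans y x z : R x y -> R y z -> R x z by apply: fle_trans.
have ren := @poset_ren _ R.
have [NUM NUMb NUM_E] : exists2 f, pbound 6 f & forall r, gsat R r f <-> num R (r 0) (r 1) (r 3).
  by apply: DefP_form; apply: (@D_rel3 _ _ ren (num R)) => //; apply: D_num.
(* The conjunct [num] confines the value to the first copy, as [addJ_E] presupposes. *)
have [ADD ADDb ADD_E] : exists2 f, pbound 6 f & forall r, gsat R r f <->
    num R (r 0) (r 1) (r 5) /\ addJ R (r 0) (r 1) (r 2) (r 3) (r 4) (r 5).
  apply: DefP_form; apply: D_and; last exact: D_addJ.
  by apply: (@D_rel3 _ _ ren (num R)) => //; apply: D_num.
have [MUL MULb MUL_E] : exists2 f, pbound 6 f & forall r, gsat R r f <->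
    num R (r 0) (r 1) (r 5) /\ mulJ R (r 0) (r 1) (r 2) (r 3) (r 4) (r 5).
  apply: DefP_form; apply: D_and; last exact: D_mulJ.
  by apply: (@D_rel3 _ _ ren (num R)) => //; apply: D_num.
have [PAR PARb PAR_E] : exists2 f, pbound 3 f & forall r, gsat R r f <-> params R (r 0) (r 1) (r 2).
  by apply: DefP_form; apply: D_params.
have [T [TC TE]] := t2p_code ADD MUL.
have [h [hC hE]] := a2p_code NUM TC TE.
have [b [bC bE]] := closed_aform_C1.
(* All choices of parameters give the same truth value, so they can be quantified existentially. *)
pose w f := PEx (PEx (PEx (PAnd PAR f))).
pose wC c := cpair 7 (cpair 7 (cpair 7 (cpair 3 (cpair (pcode PAR) c)))).
pose fls := PAll (PNot (PEq 0 0)).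
exists (fun c => if b c then wC (h c) else pcode fls); split; first by rewrite /wC; ctac.
have [x0 _] := params_ex n k3; pose r0 : nat -> pst k n := fun=> x0.
move=> c; case: (boolP (b c)) => [/bE [f hf <-]|nb].
  have wb : pbound 0 (w (a2p NUM ADD MUL 0 f)).
    by split=> //; apply: (a2p_bound NUMb ADDb MULb hf).
  rewrite hE -[wC _]/(pcode (w (a2p NUM ADD MUL 0 f))) (Th_posetE r0 wb) (Th_arithE id hf).
  have E x y z : params R x y z -> gsat R (scons x (scons y (scons z r0))) (a2p NUM ADD MUL 0 f) <-> asat id f.
    move=> /(pst_interp n0) [Jn [numJ J_inj addJJ mulJJ]].
    by apply: (a2pE R_refl R_trans NUM_E ADD_E MUL_E numJ J_inj addJJ mulJJ hf).
  split=> [hs|[z [y [x [/PAR_E /E e /e]]]]] //.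
  have [x [y [z p]]] := params_ex n k3; exists z, y, x; split; first exact/PAR_E.
  by apply/E.
split=> [[f [hf [e _]]]|]; first by case/negP: nb; apply/bE; exists f.
have hfls : pbound 0 fls by [].
by rewrite (Th_posetE r0 hfls) => /(_ x0); case; split; apply: R_refl.
Qed.

Theorem undecidable_part k n : 2 < k -> n <> ofin 0 ->
  ~ decidable_set (Th_poset (@FFk_le k n)) /\ comp_iso (Th_poset (@FFk_le k n)) Th_arith.
Proof.
move=> k3 n0; have [h [hC hE]] := arith_to_poset k3 n0.
split; first by move=> d; apply: Th_arith_undecidable; apply: decidable_reduce hC hE d.
have [g [gC gE]] := poset_to_arith n (ltn_trans (ltn0Sn 1) k3).
have [f1 [c1 i1 e1 E1]] := poset_pad hC hE; have [f2 [c2 i2 e2 E2]] := arith_pad gC gE.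
exact: (comp_iso_reductions c2 c1 i2 i1 e2 e1 E2 E1).
Qed.

(** * Two labels: ordinal values *)

(* [W b a] stands for [omega^b + a]: an ordinal is the list of its exponents. *)
Inductive on := Z | W of on & on.

Fixpoint oeqb x y := match x, y with
  | Z, Z => true | W b a, W b' a' => oeqb b b' && oeqb a a' | _, _ => false end.

Lemma oeqP : Equality.axiom oeqb.
Proof.
elim=> [|b IHb a IHa] [|b' a'] /=; try by constructor.
by apply: (iffP andP) => [[/IHb -> /IHa ->]|[eb ea]] //; split; [apply/IHb|apply/IHa].
Qed.
HB.instance Definition _ := hasDecEq.Build on oeqP.

Fixpoint olt x y := match x, y with
  | _, Z => false | Z, W _ _ => true
  | W b a, W b' a' => olt b b' || (b == b') && olt a a' end.
Definition ole x y := olt x y || (x == y).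

Lemma olt_irr x : olt x x = false.
Proof. by elim: x => //= b -> a ->; rewrite andbF. Qed.

Lemma olt_trans y x z : olt x y -> olt y z -> olt x z.
Proof.
elim: y x z => [|b IHb a IHa] [|b1 a1] [|b2 a2] //=.
case/orP => [h1|/andP [/eqP -> h1]] /orP [h2|/andP [/eqP <- h2]].
- by rewrite (IHb _ _ h1 h2).
- by rewrite h1.
- by rewrite h2.
- by rewrite eqxx (IHa _ _ h1 h2) orbT.
Qed.

Lemma olt_total x y : [|| olt x y, x == y | olt y x].
Proof.
elim: x y => [|b IHb a IHa] [|b' a'] //=.
case/or3P: (IHb b') => [->|/eqP ->|->]; rewrite ?orbT // !eqxx olt_irr /=.
case/or3P: (IHa a') => [->|/eqP ->|->]; by rewrite ?eqxx ?orbT.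
Qed.

Lemma olt_nge x y : olt x y = ~~ ole y x.
Proof.
rewrite /ole; case/or3P: (olt_total x y) => [h|/eqP ->|h]; last 2 first.
- by rewrite olt_irr eqxx orbT.
- by rewrite h; apply/negbTE/negP => h'; have := olt_trans h h'; rewrite olt_irr.
rewrite h; apply/esym; rewrite negb_or; apply/andP; split.
  by apply/negP => h'; have := olt_trans h h'; rewrite olt_irr.
by apply/eqP => e; rewrite e olt_irr in h.
Qed.

Lemma ole_refl x : ole x x. Proof. by rewrite /ole eqxx orbT. Qed.
Lemma oltW x y : olt x y -> ole x y. Proof. by rewrite /ole => ->. Qed.
Lemma ole_trans y x z : ole x y -> ole y z -> ole x z.
Proof.
by rewrite /ole => /orP [h1|/eqP ->] // /orP [h2|/eqP <-]; rewrite ?h1 // (olt_trans h1 h2).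
Qed.
Lemma olt_le_trans y x z : olt x y -> ole y z -> olt x z.
Proof. by move=> h /orP [/(olt_trans h)|/eqP <-]. Qed.
Lemma ole_lt_trans y x z : ole x y -> olt y z -> olt x z.
Proof. by move=> /orP [/olt_trans h /h|/eqP ->]. Qed.
Lemma ole_W b a b' a' : ole (W b a) (W b' a') = olt b b' || (b == b') && ole a a'.
Proof.
rewrite /ole [olt _ _]/=.
have -> : (W b a == W b' a') = (b == b') && (a == a').
  by apply/eqP/andP => [[-> ->]|[/eqP -> /eqP ->]]; rewrite ?eqxx.
by case: (olt b b') => //=; case: (b == b').
Qed.
Lemma ole_Z x : ole Z x. Proof. by case: x. Qed.

Fixpoint allb (p : on -> bool) x := if x is W b a then p b && allb p a else true.

(** Ordinal addition of [omega^b] on the right: in a normal form it swallows all terms with smaller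
    exponents. *)
Fixpoint addw x b := if x is W c a then if olt c b then W b Z else W c (addw a b) else W b Z.

Lemma addw_ge x b : allb (ole b) (addw x b).
Proof.
elim: x => [|c _ a IH] /=; first by rewrite ole_refl.
by case: ifP => h /=; rewrite ?ole_refl // IH andbT; move: h; rewrite olt_nge => /negbFE.
Qed.

Lemma addw_gt x b : allb (olt b) (addw x b) = false.
Proof.
by elim: x => [|c _ a IH] /=; rewrite ?olt_irr //; case: ifP => h /=; rewrite ?olt_irr // IH andbF.
Qed.

Lemma addw_lt x b : olt x (addw x b).
Proof. by elim: x => [|c _ a IH] //=; case: ifP => h /=; rewrite ?h // eqxx IH orbT. Qed.

(** With [addw_lt] and [addw_ge]: adding [omega^b] leads to the next multiple of [omega^b]. *)
Lemma addw_least x b y : olt x y -> allb (ole b) y -> ole (addw x b) y.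
Proof.
elim: x y => [|c _ a IH] [|c' a'] //=.
  by move=> _ /andP [h _]; rewrite ole_W ole_Z andbT.
move=> h /andP [h1 h2]; case: ifP => cb; first by rewrite ole_W ole_Z andbT.
rewrite ole_W; case/orP: h => [->//|/andP [/eqP <- h]].
by rewrite eqxx (IH a') ?orbT.
Qed.

Lemma addw_neqZ x b : addw x b <> Z.
Proof. by case: x => [|c a] //=; case: ifP. Qed.

Definition fin x := allb (pred1 Z) x.
(* Predecessor on finite ordinals, identity on infinite ones. *)
Definition pr x := if fin x then if x is W _ a then a else Z else x.

Lemma fin_lt x y : fin x -> ~~ fin y -> olt x y.
Proof.
rewrite /fin; elim: x y => [|b _ a IH] [|b' a'] //=.
move=> /andP [/eqP -> ha]; rewrite negb_and; case: b' => [|b1 a1] //= h.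
by rewrite IH.
Qed.

Lemma pr_mono x y : x <> Z -> olt x y -> olt (pr x) (pr y).
Proof.
rewrite /pr => xZ xy; case: ifP => fx; case: ifP => fy //.
- case: x xZ fx xy => // b a _; case: y fy => // b' a'; rewrite /fin /=.
  by move=> /andP [/eqP -> _] /andP [/eqP -> _] /=.
- have /negbT ny := fy.
  case: x xZ fx xy => // b a _; rewrite /fin /= => /andP [_ fa] _.
  exact: (@fin_lt a y).
- by have := fin_lt fy (negbT fx); rewrite olt_nge => /negP []; apply: oltW.
Qed.

(** A set of signs, one sign for each label: a singleton for a tree, both for a join of two
    incomparable trees of equal ordinal, empty for the empty forest. *)
Definition sgn := (bool * bool)%type.
Definition subs (s t : sgn) := (s.1 ==> t.1) && (s.2 ==> t.2).
Definition single (s : sgn) := s.1 != s.2.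

Definition vle (x y : on * sgn) := olt x.1 y.1 || (x.1 == y.1) && subs x.2 y.2.
Definition vjoin (x y : on * sgn) := if olt x.1 y.1 then y else if olt y.1 x.1 then x
  else (x.1, (x.2.1 || y.2.1, x.2.2 || y.2.2)).
(* [absorbs (pr b) s x]: a root with label value [(b, s)] can be added below a tree of value [x]
   without changing it. The tree [N t f] is the least one above [f] that absorbs its root label. *)
Definition absorbs b s (x : on * sgn) :=
  single x.2 && (allb (olt b) x.1 || allb (ole b) x.1 && (x.2 == s)).
Definition vN (t f : on * sgn) := if absorbs (pr t.1) t.2 f then f else (addw f.1 (pr t.1), t.2).

Fixpoint val x := match x with
  | E => (Z, (false, false))
  | L i => (W Z Z, (i == 0, i == 1))
  | N t f => vN (val t) (val f)
  | J f g => vjoin (val f) (val g) end.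

Definition valid_v (x : on * sgn) := (x.1 == Z) == (x.2 == (false, false)).

Lemma subs_refl s : subs s s. Proof. by case: s => [[] []]. Qed.

Lemma vle_refl x : vle x x. Proof. by rewrite /vle eqxx subs_refl orbT. Qed.

Lemma vle_trans y x z : vle x y -> vle y z -> vle x z.
Proof.
case: x y z => [a s] [b t] [c u]; rewrite /vle /=.
case/orP => [h1|/andP [/eqP -> h1]] /orP [h2|/andP [/eqP <- h2]].
- by rewrite (olt_trans h1 h2).
- by rewrite h1.
- by rewrite h2.
- by rewrite eqxx; move: s t u h1 h2 => [[] []] [[] []] [[] []]; rewrite ?orbT.
Qed.

Lemma vjoin_lub x y z : vle (vjoin x y) z = vle x z && vle y z.
Proof.
rewrite /vjoin; case/or3P: (olt_total x.1 y.1) => [h|/eqP h|h].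
- rewrite h; apply/idP/andP => [h1|[]//]; split=> //; apply: vle_trans h1.
  by rewrite /vle h.
- rewrite h olt_irr; case: x y z h => [a s] [b t] [c u] /= ->; rewrite /vle /=.
  by case: (olt b c) => //=; case: (b == c) => //=; move: s t u => [[] []] [[] []] [[] []].
- have -> : olt x.1 y.1 = false by rewrite olt_nge (oltW h).
  rewrite h; apply/idP/andP => [h1|[]//]; split=> //; apply: vle_trans h1.
  by rewrite /vle h.
Qed.

Lemma vjoin_single x y z : single x.2 -> vle x (vjoin y z) = vle x y || vle x z.
Proof.
move=> sx; apply/idP/orP; last first.
  have := vle_refl (vjoin y z); rewrite vjoin_lub => /andP [h1 h2].
  by case=> /vle_trans; apply.
rewrite /vjoin; case: ifP => h1; first by right.
case: ifP => h2; first by left.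
have e : y.1 = z.1.
  by case/or3P: (olt_total y.1 z.1) => [|/eqP//|]; rewrite ?h1 ?h2.
rewrite /vle /= -e; case: (olt x.1 y.1) => /=; first by left.
case: (x.1 == y.1) => //=; move: sx; case: x y z e {h1 h2} => [a s] [b t] [c u] /= _.
by move: s t u => [[] []] [[] []] [[] []] //= _ _; by [left|right].
Qed.

Lemma valid_join x y : valid_v x -> valid_v y -> valid_v (vjoin x y).
Proof.
rewrite /vjoin; case: ifP => // h1; case: ifP => // h2.
have e : x.1 = y.1.
  by case/or3P: (olt_total x.1 y.1) => [|/eqP//|]; rewrite ?h1 ?h2.
case: x y e {h1 h2} => [a s] [b t] /= ->; rewrite /valid_v /=.
by case: (b == Z); move: s t => [[] []] [[] []].
Qed.

Lemma single_valid x : valid_v x -> single x.2 -> x.1 <> Z.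
Proof. by case: x => [a s] /= v h e; move: v h; rewrite /valid_v /= e; move: s => [[] []]. Qed.

Lemma vN_valid t f : valid_v t -> single t.2 -> valid_v f -> valid_v (vN t f) /\ single (vN t f).2.
Proof.
move=> vt st vf; rewrite /vN; case: ifP => [/andP [] //|_]; split=> //=.
rewrite /valid_v /=; have -> : (addw f.1 (pr t.1) == Z) = false by apply/eqP; apply: addw_neqZ.
by move: st; case: t.2 => [[] []].
Qed.

Lemma absorbs_vN t f : single t.2 -> absorbs (pr t.1) t.2 (vN t f).
Proof.
by move=> st; rewrite /vN; case: ifP => // _; rewrite /absorbs /= st addw_ge eqxx orbT.
Qed.

Lemma vle_vN t f : vle f (vN t f).
Proof.
by rewrite /vN; case: ifP => _; [apply: vle_refl|rewrite /vle /= addw_lt].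
Qed.

Lemma single_sub s t : single s -> t <> (false, false) -> ~~ subs s t -> single t /\ t = (~~ s.1, ~~ s.2).
Proof. by move: s t => [[] []] [[] []]. Qed.

(** If the ordinal of [w] exceeds that of [f], [addw_least] applies; in case of equality there, the
    exponent [pr t.1] occurs in [w] and forces its sign. If the ordinals of [f] and [w] agree, then
    [f = w], since [w] has a single sign, and [f] already absorbs the root. *)
Lemma vN_least t f w : valid_v f -> valid_v w -> absorbs (pr t.1) t.2 w -> vle f w -> vle (vN t f) w.
Proof.
move=> vf vw aw fw; rewrite /vN; case: ifP => // /negbT nf.
move: (aw); rewrite /absorbs => /andP [sw /orP h].
have ge : allb (ole (pr t.1)) w.1.
  case: h => [|/andP [] //]; elim: (w.1) => //= b _ a IH /andP [h1 /IH ->].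
  by rewrite oltW.
move: fw; rewrite {1}/vle => /orP [lt|/andP [/eqP e sub]].
  have := addw_least lt ge; rewrite /ole /vle /= => /orP [->|/eqP e] //.
  rewrite e eqxx /=; case: h => [|/andP [_ /eqP ->]]; last by rewrite subs_refl orbT.
  by rewrite -e addw_gt.
case/negP: nf; have -> // : f = w.
have wZ := single_valid vw sw.
have fn : f.2 <> (false, false).
  by move: vf; rewrite /valid_v e => /eqP h' e'; apply: wZ; apply/eqP; rewrite h' e'.
case: f w e sub sw fn {vf vw aw h ge wZ} => [a s] [b u] /= ->.
by move: s u => [[] []] [[] []].
Qed.

Lemma allb_impl (p q : on -> bool) x : (forall b, p b -> q b) -> allb p x -> allb q x.
Proof. by move=> h; elim: x => //= b _ a IH /andP [/h -> /IH ->]. Qed.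

(** Passing to [pr] loses nothing on labels, because [pr] is strictly increasing on nonzero
    ordinals. *)
Lemma vle_labels t t' : valid_v t -> valid_v t' -> single t.2 -> single t'.2 ->
  vle t t' = olt (pr t.1) (pr t'.1) || (pr t.1 == pr t'.1) && (t.2 == t'.2).
Proof.
move=> vt vt' st st'; have tZ := single_valid vt st; have tZ' := single_valid vt' st'.
rewrite /vle; case/or3P: (olt_total t.1 t'.1) => [h|/eqP h|h].
- by rewrite h (pr_mono tZ h).
- rewrite h !eqxx !olt_irr /=; move: st st'; case: t.2 => [[] []]; by case: t'.2 => [[] []].
- have h' := pr_mono tZ' h.
  have -> : olt t.1 t'.1 = false by rewrite olt_nge (oltW h).
  have -> : olt (pr t.1) (pr t'.1) = false by rewrite olt_nge (oltW h').
  have -> : (t.1 == t'.1) = false by apply/eqP => e; rewrite e olt_irr in h.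
  by have -> : (pr t.1 == pr t'.1) = false by apply/eqP => e; rewrite e olt_irr in h'.
Qed.

(** The clause [fleNN] for values. In the hard case the left root label is not below the right one,
    and the right root is not absorbed. Then the exponents on the left all exceed [pr t'.1], or
    reach it with the other sign, which leaves no room strictly above the ordinal of [f']. So the
    left value is below [f'], or [f'] has the opposite sign and would have absorbed the root. *)
Lemma vN_le t f t' f' : valid_v t -> valid_v t' -> single t.2 -> single t'.2 ->
  valid_v f -> valid_v f' ->
  vle (vN t f) (vN t' f') = vle t t' && vle f (vN t' f') || vle (vN t f) f'.
Proof.
move=> vt vt' st st' vf vf'; have [vx sx] := vN_valid vt st vf; have [vy sy] := vN_valid vt' st' vf'.
have ax := absorbs_vN f st; have ay := absorbs_vN f' st'.
apply/idP/orP => [h|[/andP [h1 h2]|h]]; last 2 first.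
- apply: vN_least => //; move: ay h1; rewrite vle_labels // /absorbs sy /=.
  move=> /orP h3 /orP [h1|/andP [/eqP -> /eqP ->]]; last by case: h3 => ->; rewrite ?orbT.
  apply/orP; left; case: h3 => [|/andP [h3 _]]; first by apply: allb_impl => b; apply: olt_trans.
  by apply: allb_impl h3 => b; apply: olt_le_trans.
- exact: vle_trans h (vle_vN _ _).
case: (boolP (vle (vN t f) f')) => [|nx]; [by right|left].
rewrite (vle_trans (vle_vN _ _) h) andbT vle_labels //.
apply: contraT => hn.
move: (vN t f) h nx ax vx sx => x h nx ax vx sx.
move: h; rewrite /vN; case: ifP => [_ h|/negbT nf' h]; first by rewrite h in nx.
have H : allb (olt (pr t'.1)) x.1 \/ allb (ole (pr t'.1)) x.1 /\ x.2 <> t'.2.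
  move: hn ax; rewrite negb_or olt_nge negbK /ole /absorbs sx /= => /andP [/orP [lt|/eqP <-]].
    move=> _ /orP [h'|/andP [h' _]]; left; move: h'; apply: allb_impl => b; first exact: olt_trans lt.
    exact: olt_le_trans lt.
  by rewrite eqxx /= => /eqP ne /orP [|/andP [h' /eqP ->]]; [left|right].
have ge : allb (ole (pr t'.1)) x.1.
  by case: H => [|[] //]; apply: allb_impl => b; apply: oltW.
have lt : olt x.1 (addw f'.1 (pr t'.1)).
  move: h; rewrite {1}/vle => /orP [//|/andP [/eqP /= e sub]].
  case: H => [|[_ ne]]; first by rewrite e addw_gt.
  by case: ne; move: sub sx st'; case: (x.2) => [[] []]; case: (t'.2) => [[] []].
have le : ole x.1 f'.1.
  apply: contraT; rewrite -olt_nge => /addw_least /(_ ge).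
  by rewrite -[ole _ _]negbK -olt_nge lt.
case/negP: nx; move: le; rewrite /ole /vle => /orP [->|/eqP e] //; rewrite e eqxx olt_irr /=.
apply: contraT => nsub; case/negP: nf'.
have xZ := single_valid vx sx.
have fn : f'.2 <> (false, false).
  by move: vf'; rewrite /valid_v -e => /eqP h' e'; apply: xZ; apply/eqP; rewrite h' e'.
have [sf ef] := single_sub sx fn nsub.
rewrite /absorbs sf -e; case: H => [->|[-> ne]] //=.
rewrite ef; move: sx st' ne; case: (x.2) => [[] []]; case: (t'.2) => [[] []] //=; by rewrite ?orbT.
Qed.

Lemma val_valid k n x : okn k n x -> k <= 2 -> valid_v (val x) /\ (istree x -> single (val x).2).
Proof.
move=> ok k2; elim: x ok => [|i|t IHt f IHf|f IHf g IHg] //=.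
- rewrite /okn => /andP [/= hi _]; have : i < 2 by apply: leq_trans hi k2.
  by case: i {hi} => [|[|]].
- by move=> /okn_N [tt /IHt [vt /(_ tt) st] /IHf [vf _]]; have [-> ->] := vN_valid vt st vf.
- by rewrite okn_J => /andP [/IHf [vf _] /IHg [vg _]]; split=> //; apply: valid_join.
Qed.

Lemma vle_E x : valid_v x -> single x.2 -> vle x (val E) = false.
Proof. by case: x => [[|b a] s] //; rewrite /valid_v /vle /=; move: s => [[] []]. Qed.

Lemma fle_val n x y : okn 2 n x -> okn 2 n y -> fle x y = vle (val x) (val y).
Proof.
have [m] := ubnP (fsize x + fsize y); elim: m x y => // m IH x y hm okx oky.
(* A leaf has the value of the node that it labels, so its cases reduce to [vN_le]. *)
have VL i : i < 2 -> val (L i) = vN (val (L i)) (val E) by case: i => [|[|]].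
have vE : valid_v (val E) by [].
case: x hm okx => [|i|t f|f g] hm okx.
- rewrite /vle /=; have := val_valid oky isT; case: (val y) => [[|b a] s] [v _] //=.
- case: y hm oky => [|j|t' f'|f' g'] hm oky.
  + by rewrite fle_treeE // /vle.
  + rewrite fleLL /vle /= /subs /=; move: okx oky; rewrite /okn /= => /andP [hi _] /andP [hj _].
    by case: i hi {hm VL} => [|[|]] //; case: j hj => [|[|]].
  + have hi : i < 2 by move: okx; rewrite /okn => /andP [].
    have [vi /(_ isT) si] := val_valid okx isT.
    have [tt okt okf] := okn_N oky; have [vt /(_ tt) st] := val_valid okt isT.
    have [vf _] := val_valid okf isT.
    rewrite fleLN !IH //; try by clear -hm; move: hm => /=; lia.
    have -> : vle (val (L i)) (val (N t' f')) = vle (vN (val (L i)) (val E)) (vN (val t') (val f')).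
      by rewrite -VL.
    rewrite vN_le // -VL //; have -> : vle (val E) (vN (val t') (val f')) = true; last by rewrite andbT.
    by rewrite /vle /=; case: (vN _ _) => [[|b a] s].
  + have [_ /(_ isT) si] := val_valid okx isT.
    move: (oky); rewrite okn_J => /andP [okf okg].
    rewrite fle_treeJ // [val (J _ _)]/= vjoin_single // !IH //; by clear -hm; move: hm => /=; lia.
- have [tt okt okf] := okn_N okx; have [vt /(_ tt) st] := val_valid okt isT.
  have [vf _] := val_valid okf isT; have [vx /(_ isT) sx] := val_valid okx isT.
  case: y hm oky => [|j|t' f'|f' g'] hm oky.
  + by rewrite fle_treeE // vle_E.
  + have hj : j < 2 by move: oky; rewrite /okn => /andP [].
    have [vj /(_ isT) sj] := val_valid oky isT.
    rewrite fleNL !IH //; try by clear -hm; move: hm => /=; lia.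
    have -> : vle (val (N t f)) (val (L j)) = vle (vN (val t) (val f)) (vN (val (L j)) (val E)).
      by rewrite -VL.
    rewrite vN_le // -VL //.
    by rewrite vle_E // orbF.
  + have [tt' okt' okf'] := okn_N oky; have [vt' /(_ tt') st'] := val_valid okt' isT.
    have [vf' _] := val_valid okf' isT.
    rewrite fleNN [val (N t f)]/= [val (N t' f')]/= vN_le //.
    by rewrite (IH t t') ?(IH f (N t' f')) ?(IH (N t f) f') //; clear -hm; move: hm => /=; lia.
  + move: (oky); rewrite okn_J => /andP [okf' okg'].
    rewrite fle_treeJ // [val (J _ _)]/= vjoin_single // !IH //; by clear -hm; move: hm => /=; lia.
- move: okx; rewrite okn_J => /andP [okf okg].
  rewrite fleJ [val (J _ _)]/= vjoin_lub !IH //; by clear -hm; move: hm => /=; lia.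
Qed.

(** * Coefficients of Cantor normal forms *)

Fixpoint nf x := if x is W b a then allb (fun c => ole c b) a && nf a else true.
(** The finite ordinal [j], used as an exponent. Below, [trunc j] keeps the terms from [omega^j] on,
    and [cnt j] is the coefficient of [omega^j]. *)
Fixpoint oexp j := if j is i.+1 then W Z (oexp i) else Z.
Fixpoint trunc j x := if x is W b a then if olt b (oexp j) then Z else W b (trunc j a) else Z.
Fixpoint cnt j x := if x is W b a then (b == oexp j) + cnt j a else 0.

Lemma allb_addw p x b : allb p x -> p b -> allb p (addw x b).
Proof.
move=> hx hb; elim: x hx => [|c _ a IH] /=; first by rewrite hb.
by move=> /andP [hc ha]; case: ifP => _ /=; rewrite ?hb // hc IH.
Qed.

Lemma nf_addw x b : nf x -> nf (addw x b).
Proof.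
elim: x => [|c _ a IH] //= /andP [h1 h2]; case: ifP => // cb /=.
by rewrite IH // andbT allb_addw //; move: cb; rewrite olt_nge => /negbFE.
Qed.

Lemma olt_oexpS b j : olt b (oexp j.+1) = ole b (oexp j).
Proof.
elim: j b => [|j IH] [|c a]; rewrite ?ole_Z //; first by case: c => [|? ?]; case: a.
rewrite -[oexp j.+2]/(W Z (oexp j.+1)) [olt _ _]/= -[W Z (oexp j)]/(oexp j.+1) IH ole_W.
by case: c.
Qed.

Lemma cnt0 j x : allb (fun c => olt c (oexp j)) x -> cnt j x = 0.
Proof.
by elim: x => //= b _ a IH /andP [h /IH ->]; case: eqP h => // ->; rewrite olt_irr.
Qed.

Lemma trunc0 j x : allb (fun c => olt c (oexp j)) x -> trunc j x = Z.
Proof. by case: x => //= b a /andP [->]. Qed.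

(** Splits off one coefficient of a finite power from the lexicographic order; this is the axiom
    [tl_step] of towers. *)
Lemma trunc_step j x y : nf x -> nf y -> olt (trunc j x) (trunc j y) =
  olt (trunc j.+1 x) (trunc j.+1 y) || ~~ olt (trunc j.+1 y) (trunc j.+1 x) && (cnt j x < cnt j y).
Proof.
have le0 b a : allb (fun c => ole c b) a -> olt b (oexp j) -> allb (fun c => olt c (oexp j)) a.
  by move=> h1 h2; move: h1; apply: allb_impl => c h; apply: ole_lt_trans h h2.
have le1 b a : allb (fun c => ole c b) a -> ole b (oexp j) -> allb (fun c => olt c (oexp j.+1)) a.
  by move=> h1 h2; move: h1; apply: allb_impl => c h; rewrite olt_oexpS; apply: ole_trans h h2.
elim: x y => [|b _ a IH] [|b' a'].
- by [].
- move=> _ /= /andP [ha _].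
  case: (boolP (olt b' (oexp j))) => h1.
    rewrite (_ : olt b' (W Z (oexp j))) /=; last by rewrite -[W _ _]/(oexp j.+1) olt_oexpS oltW.
    by rewrite (cnt0 (le0 _ _ ha h1)) addn0; case: eqP h1 => // ->; rewrite olt_irr.
  case: ifP => //=; rewrite -[W _ _]/(oexp j.+1) olt_oexpS /ole (negPf h1) /= => /eqP ->.
  by rewrite eqxx.
- by move=> _ _; rewrite [trunc _ Z]/= !olt_nge !ole_Z /= ltn0 andbF.
move=> /= /andP [ha na] /andP [ha' na'].
have := IH a' na na'; rewrite -[W Z (oexp j)]/(oexp j.+1) !olt_oexpS => {}IH.
case: (boolP (ole b (oexp j))) => hb; case: (boolP (ole b' (oexp j))) => hb'.
- rewrite olt_irr /=; move: (hb) (hb').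
  rewrite {1}/ole => /orP [h|/eqP eb]; rewrite /ole => /orP [h'|/eqP eb'].
  + rewrite h h' olt_irr (cnt0 (le0 _ _ ha h)) (cnt0 (le0 _ _ ha' h')).
    have -> : (b == oexp j) = false by apply/eqP => e; rewrite e olt_irr in h.
    by have -> : (b' == oexp j) = false by apply/eqP => e; rewrite e olt_irr in h'.
  + rewrite h eb' olt_irr eqxx /= (cnt0 (le0 _ _ ha h)) addn0.
    by have -> : (b == oexp j) = false by apply/eqP => e; rewrite e olt_irr in h.
  + rewrite h' eb olt_irr /= (cnt0 (le0 _ _ ha' h')) addn0.
    have -> : (b' == oexp j) = false by apply/eqP => e; rewrite e olt_irr in h'.
    by rewrite ltn0.
  + rewrite eb eb' !olt_irr /= eqxx IH (trunc0 (le1 _ _ ha hb)) (trunc0 (le1 _ _ ha' hb')) olt_irr /=.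
    by rewrite ltn_add2l.
- have hlt : olt (oexp j) b' by rewrite olt_nge.
  have bb' : olt b b' by apply: ole_lt_trans hb hlt.
  have -> : olt b' (oexp j) = false by rewrite olt_nge (oltW hlt).
  by case: ifP => //= _; rewrite bb'.
- have hlt : olt (oexp j) b by rewrite olt_nge.
  have bb' : olt b' b by apply: ole_lt_trans hb' hlt.
  have -> : olt b (oexp j) = false by rewrite olt_nge (oltW hlt).
  rewrite /=; case: ifP => //= _; rewrite [olt b b']olt_nge (oltW bb') /=.
  by case: eqP bb' => // ->; rewrite olt_irr.
- have h1 : olt (oexp j) b by rewrite olt_nge.
  have h2 : olt (oexp j) b' by rewrite olt_nge.
  have -> : olt b (oexp j) = false by rewrite olt_nge (oltW h1).
  have -> : olt b' (oexp j) = false by rewrite olt_nge (oltW h2).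
  have -> : (b == oexp j) = false by apply/eqP => e; rewrite e olt_irr in h1.
  have -> : (b' == oexp j) = false by apply/eqP => e; rewrite e olt_irr in h2.
  rewrite /= !add0n IH.
  case/or3P: (olt_total b b') => [h|/eqP ->|h].
  + by rewrite h.
  + by rewrite eqxx olt_irr.
  + have -> : olt b b' = false by rewrite olt_nge (oltW h).
    have -> : (b == b') = false by apply/eqP => e; rewrite e olt_irr in h.
    by rewrite h.
Qed.

Lemma trunc_addw j x b : olt b (oexp j) -> trunc j (addw x b) = trunc j x.
Proof.
move=> hb; elim: x => [|c _ a IH] /=; first by rewrite hb.
case: ifP => h /=; first by rewrite hb (olt_trans h hb).
by rewrite IH.
Qed.

Lemma trunc_id j x : allb (ole (oexp j)) x -> trunc j x = x.
Proof. by elim: x => //= b _ a IH /andP [h /IH ->]; rewrite olt_nge h. Qed.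

Lemma cnt_addw j x : nf x -> cnt j (addw x (oexp j)) = (cnt j x).+1.
Proof.
elim: x => [|c _ a IH] /=; first by rewrite eqxx.
move=> /andP [h1 h2]; case: ifP => h /=.
  rewrite eqxx cnt0; first by case: eqP h => // ->; rewrite olt_irr.
  by move: h1; apply: allb_impl => d hd; apply: ole_lt_trans hd h.
by rewrite IH // addnS.
Qed.

Lemma olt_oexp j : olt (oexp j) (oexp j.+1). Proof. by rewrite olt_oexpS ole_refl. Qed.

Lemma trunc_ge j x : allb (ole (oexp j)) (trunc j x).
Proof. by elim: x => //= b _ a IH; case: ifP => //= h; rewrite IH andbT; move: h; rewrite olt_nge => /negbFE. Qed.

Lemma nf_trunc j x : nf x -> nf (trunc j x).
Proof.
elim: x => //= b _ a IH /andP [h1 h2]; case: ifP => //= _; rewrite IH // andbT.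
by elim: a h1 {IH h2} => //= c _ a IH /andP [h1 h2]; case: ifP => //= _; rewrite h1 IH.
Qed.

Lemma cnt_trunc j x : cnt j (trunc j.+1 x) = 0.
Proof.
have := trunc_ge j.+1 x; elim: (trunc j.+1 x) => //= b _ a IH /andP [h /IH ->].
by case: eqP h => // ->; rewrite -[W _ _]/(oexp j.+1) -[ole _ _]negbK -olt_nge olt_oexp.
Qed.

(** The coefficient of [omega^j] becomes [m], and all lower terms are deleted. *)
Definition upd j m x := iter m (fun y => addw y (oexp j)) (trunc j.+1 x).

Lemma upd_nf j m x : nf x -> nf (upd j m x).
Proof. by move=> h; elim: m => [|m IH]; [apply: nf_trunc|apply: nf_addw]. Qed.

Lemma upd_trunc j m x : trunc j.+1 (upd j m x) = trunc j.+1 x.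
Proof.
elim: m => [|m IH]; first by rewrite trunc_id // trunc_ge.
by rewrite /upd iterS trunc_addw ?olt_oexp.
Qed.

Lemma upd_cnt j m x : nf x -> cnt j (upd j m x) = m.
Proof.
move=> h; elim: m => [|m IH]; first exact: cnt_trunc.
by rewrite /upd iterS cnt_addw ?upd_nf // -/(upd j m x) IH.
Qed.

(** * Ordinals that occur as values of forests *)

Section Levels.
Variable n : onat.
Hypothesis n0 : n <> ofin 0.

Definition level x := exists2 f, okn 2 n f & (val f).1 = x.

Lemma level_Z : level Z. Proof. by exists E; rewrite ?okn_E. Qed.

Lemma level_nf x : level x -> nf x.
Proof.
move=> [f _ <-]; elim: f => //= [t _ f|f h1 g h2]; first by rewrite /vN; case: ifP => //= _; apply: nf_addw.
by rewrite /vjoin; case: ifP => // _; case: ifP.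
Qed.

(** Truncation is realized by leaving out nodes: a root that adds a small power is omitted, and a
    root that adds a large one leaves nothing to truncate. *)
Lemma level_trunc j x : level x -> level (trunc j x).
Proof.
move=> [f ok <-]; elim: f ok => [|i|t _ f IH|f IHf g IHg] ok.
- exact: level_Z.
- rewrite [val _]/=; case: j => [|j]; first by exists (L i).
  by rewrite /=; apply: level_Z.
- have [_ _ okf] := okn_N ok; have := IH okf; rewrite [val (N t f)]/= /vN.
  case: ifP => //= na; case: (boolP (olt (pr (val t).1) (oexp j))) => h; first by rewrite trunc_addw.
  move=> _; rewrite trunc_id; first by exists (N t f) => //=; rewrite /vN na.
  have := addw_ge (val f).1 (pr (val t).1); apply: allb_impl => b; apply: ole_trans.
  by move: h; rewrite olt_nge negbK.
- move: ok; rewrite okn_J => /andP [/IHf h1 /IHg h2] /=.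
  by rewrite /vjoin; case: ifP => // _; case: ifP.
Qed.

Fixpoint sw x := match x with E => E | L i => L (1 - i) | N t f => N (sw t) (sw f)
  | J f g => J (sw f) (sw g) end.
Definition flip (s : sgn) : sgn := (s.2, s.1).

Lemma sw_ok x : okn 2 n x -> okn 2 n (sw x).
Proof.
have h : rk (sw x) = rk x by elim: x => //= [t -> f ->|f -> g ->].
rewrite /okn h => /andP [ok ->]; rewrite andbT {h}.
elim: x ok => //= [[|[|]]|t IHt f IHf|f IHf g IHg] //=.
  by move=> /and3P [tt /IHt -> /IHf ->]; rewrite !andbT; case: (t) tt.
by move=> /andP [/IHf -> /IHg ->].
Qed.

Lemma val_sw x : okn 2 n x -> val (sw x) = ((val x).1, flip (val x).2).
Proof.
elim: x => [|i|t IHt f IHf|f IHf g IHg].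
- by [].
- by case: i => [|[|]].
- move=> /okn_N [_ /IHt et /IHf ef]; rewrite /= et ef /vN /=.
  have -> : absorbs (pr (val t).1) (flip (val t).2) ((val f).1, flip (val f).2) =
            absorbs (pr (val t).1) (val t).2 (val f).
    rewrite /absorbs /single /flip /= eq_sym; congr (_ && (_ || _ && _)).
    by case: ((val f).2) => [[] []]; case: ((val t).2) => [[] []].
  by case: ifP.
- rewrite okn_J => /andP [/IHf ef /IHg eg]; rewrite /= ef eg /vjoin /=.
  by case: ifP => // _; case: ifP.
Qed.

(** A tree of the given ordinal, its mirror image under [sw] and their join provide the three
    nonempty sets of signs. *)
Lemma level_signs x s : level x -> x <> Z -> s <> (false, false) -> exists2 f, okn 2 n f & val f = (x, s).
Proof.
move=> [f ok e] xZ sn.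
have [t okt [et st]] : exists2 t, okn 2 n t & (val t).1 = x /\ single (val t).2.
  elim: f ok e => [|i|t _ f _|f IHf g IHg] ok e.
  - by rewrite -e in xZ.
  - by exists (L i); have [_ /(_ isT)] := val_valid ok isT.
  - by exists (N t f); have [_ /(_ isT)] := val_valid ok isT.
  - move: ok e; rewrite okn_J /= /vjoin => /andP [okf okg].
    by case: ifP => _; [apply: IHg|case: ifP => _; apply: IHf].
have vt : val t = (x, (val t).2) by rewrite -et; case: (val t).
have vs := val_sw okt; rewrite et in vs.
have vj : val (J t (sw t)) = (x, (true, true)).
  by rewrite /= vt vs /vjoin /= olt_irr; move: st; case: (val t).2 => [[] []].
have oks := sw_ok okt; have okj : okn 2 n (J t (sw t)) by rewrite okn_J okt.
move: st vt vs vj; case: (val t).2 => [[] []] //= _ vt vs vj; move: sn; case: s => [[] []] // _;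
  by [exists (J t (sw t))|exists t|exists (sw t)].
Qed.

Definition opened j := if n is ofin 1 then j == 0 else true.

Lemma val_al p q i : p < 2 -> q < 2 -> p <> q -> val (al p q i.+1) = (oexp i.+1, (p == 0, p == 1)).
Proof.
elim: i p q => [|i IH] p q hp hq pq; first by case: p hp {pq} => [|[|]].
rewrite -[val (al p q i.+2)]/(vN (val (L p)) (val (al q p i.+1))) IH //; last by congruence.
have e m : addw (oexp m) Z = oexp m.+1 by elim: m => //= m ->.
rewrite /vN /=.
have -> : absorbs (pr (W Z Z)) (p == 0, p == 1) (W Z (oexp i), (q == 0, q == 1)) = false.
  by case: p hp pq => [|[|]] //; case: q hq => [|[|]] // _ _ _; rewrite /absorbs /= ?andbF.
by rewrite /= e.
Qed.

(** A forest that is empty or carries both signs absorbs no root, so a root whose label has ordinal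
    [oexp j] after [pr] adds exactly [omega^j]. *)
Lemma level_addw j x : opened j -> level x -> level (addw x (oexp j)).
Proof.
move=> oj lx.
have [g okg [eg ng]] : exists2 g, okn 2 n g & (val g).1 = x /\ ~~ single (val g).2.
  case: (x =P Z) => [->|nz]; first by exists E; rewrite ?okn_E.
  by have [//|g ok e] := @level_signs x (true, true) lx nz; exists g; rewrite // e.
(* The label is a leaf for [j = 0] and otherwise an alternating chain of length [j + 1], whose
   ordinal [pr] lowers to [j]. The chain has rank 1, so it is a label from level 2 on. *)
have [t [tt okt et]] : exists t, [/\ istree t, okn 2 n (N t g) & pr (val t).1 = oexp j].
  case: j oj => [|j] oj.
    exists (L 0); split=> //; move: okg n0; rewrite /okn /= => /andP [-> hr] /=.
    by case: (n) hr => // -[|m] //= hr _; rewrite geq_max hr.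
  exists (al 0 1 j.+2); split=> //; last first.
    rewrite val_al //=; have fe i : fin (oexp i) by rewrite /fin; elim: i => //= i ->.
    by rewrite /pr; have := fe j.+2; rewrite /= => ->.
  have /andP [h1 h2] : okn 2 (ofin 1) (al 0 1 j.+2) by apply: al_ok.
  move: (al 0 1 j.+2) h1 h2 (isT : istree (al 0 1 j.+2)) => u h1 h2 tu.
  move: okg n0 oj; rewrite /okn /= tu h1 /= => /andP [-> hr].
  by rewrite /opened; case: (n) hr => // -[|[|m]] //= hr _ _; rewrite geq_max hr andbT; lia.
exists (N t g) => //; rewrite /= /vN et eg /absorbs.
by move: ng; rewrite /single; case: (_ != _).
Qed.

Lemma level_upd j m x : opened j -> level x -> level (upd j m x).
Proof. by move=> oj lx; elim: m => [|m IH]; [apply: level_trunc|apply: level_addw]. Qed.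

(** At level 1 all labels are leaves, so every exponent is 0. *)
Lemma level_closed j x : ~~ opened j -> level x -> trunc j x = Z.
Proof.
move=> nj; have [en jn] : n = ofin 1 /\ j <> 0.
  by move: nj; rewrite /opened; case: (n) => // -[|[|m]] //; case: (j).
move=> [f ok <-]; case: j jn {nj} => // j _.
suff h : allb (pred1 Z) (val f).1 by case: (val f).1 h => //= b a /andP [/eqP -> _].
elim: f ok => [|i|t _ f IH|f IHf g IHg] // ok.
- have [tt _ okf] := okn_N ok; have h := IH okf; rewrite /= /vN; case: ifP => // _.
  apply: allb_addw => //.
  move: ok; rewrite /okn en /= => /andP [/and3P [_ _ _]]; rewrite geq_max => /andP [r _].
  by case: (t) tt r => //= t1 f1 _; lia.
- move: ok; rewrite okn_J => /andP [/IHf h1 /IHg h2]; rewrite /= /vjoin.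
  by case: ifP => // _; case: ifP.
Qed.
End Levels.

(** * Games on towers of coordinates *)

(* [tl j] compares the parts of two elements above their [j] lowest coordinates and [tc j] is the
   coordinate number [j]; coordinate [j] may be changed freely when [op j], and is trivial otherwise.
   The size [tsz j] bounds the new element in terms of the old ones in a computable tower. *)
Record tower (op : nat -> bool) := Tower {
  tcar :> Type;
  tl : nat -> tcar -> tcar -> bool;
  tc : nat -> tcar -> nat;
  tz : tcar;
  tsz : nat -> tcar -> nat;
  tl_asym : forall j x y, tl j x y -> ~~ tl j y x;
  tl_ntrans : forall j x y z, tl j x z -> tl j x y || tl j y z;
  tl_step : forall j x y, tl j x y = tl j.+1 x y || ~~ tl j.+1 y x && (tc j x < tc j y);
  tl_tz : forall j x, ~~ tl j x tz;
  tc_tz : forall j, tc j tz = 0;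
  t_upd : forall j x m, op j -> exists y, [/\ ~~ tl j.+1 x y && ~~ tl j.+1 y x, tc j y = m &
    tsz j y <= cpair m (tsz j.+1 x)];
  t_closed : forall j x, ~~ op j -> ~~ tl j tz x;
  t_closed_sz : forall j x, ~~ op j -> tsz j x = 0 }.
#[global] Arguments tz {op t}.

Section Order.
Variables (op : nat -> bool) (A : tower op).
Implicit Types x y : A.

Definition teq j x y := ~~ tl j x y && ~~ tl j y x.

Lemma teq_refl j x : teq j x x.
Proof. by rewrite /teq andbb; apply/negP => h; have := tl_asym h; rewrite h. Qed.

Lemma teq_sym j x y : teq j x y = teq j y x. Proof. by rewrite /teq andbC. Qed.

Lemma tl_trans j x y z : tl j x y -> tl j y z -> tl j x z.
Proof. by move=> h1 /tl_asym h2; have := tl_ntrans z h1; rewrite (negPf h2) orbF. Qed.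

Lemma teq_tl j x y z : teq j x y -> (tl j x z = tl j y z) /\ (tl j z x = tl j z y).
Proof.
move=> /andP [h1 h2]; split; apply/idP/idP => h.
- by have := tl_ntrans y h; rewrite (negPf h1).
- by have := tl_ntrans x h; rewrite (negPf h2).
- by have := tl_ntrans y h; rewrite (negPf h2) orbF.
- by have := tl_ntrans x h; rewrite (negPf h1) orbF.
Qed.

Lemma teq_teq j x y z : teq j x y -> teq j x z = teq j y z.
Proof. by move=> h; rewrite /teq; have [-> ->] := teq_tl z h. Qed.

Lemma teqS j x y : teq j x y = teq j.+1 x y && (tc j x == tc j y).
Proof.
rewrite /teq (tl_step j x y) (tl_step j y x).
by case: (tl j.+1 x y); case: (tl j.+1 y x) => //=; case: ltngtP.
Qed.

Lemma closed_tc j x : ~~ op j -> tc j x = 0.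
Proof.
by move=> /(@t_closed _ A j x); rewrite tl_step negb_or tl_tz tc_tz /= -leqNgt leqn0 => /andP [_ /eqP].
Qed.

Lemma closed_tl j x y : ~~ op j -> tl j x y = false.
Proof.
move=> o; apply/negP => /(tl_ntrans tz).
by rewrite (negPf (tl_tz j x)) (negPf (t_closed y o)).
Qed.
End Order.

(** * Placing a single coordinate *)

Lemma nearest_below (s : seq (nat * nat)) m : (0, 0) \in s ->
  exists2 p, p \in s & p.1 <= m /\ forall q, q \in s -> q.1 <= m -> q.1 <= p.1.
Proof.
move=> s0; have : forall t : seq (nat * nat), {subset t <= s} -> exists2 p, p \in s & p.1 <= m /\ forall q, q \in t -> q.1 <= m -> q.1 <= p.1.
  elim=> [|a t IH] sub; first by exists (0, 0).
  have [|p ps [pm hp]] := IH; first by move=> q qt; apply: sub; rewrite inE qt orbT.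
  have sa : a \in s by apply: sub; rewrite inE eqxx.
  case: (boolP (p.1 < a.1 <= m)) => [/andP [pa am]|h].
    exists a => //; split=> // q; rewrite inE => /orP [/eqP -> //|/hp h qm].
    exact: leq_trans (h qm) (ltnW pa).
  exists p => //; split=> // q; rewrite inE => /orP [/eqP -> am|]; last exact: hp.
  by move: h; rewrite am andbT -leqNgt.
by move/(_ s (fun _ h => h)).
Qed.

Lemma nearest_above (s : seq (nat * nat)) m :
  (exists2 p, p \in s & m < p.1 /\ forall q, q \in s -> m < q.1 -> p.1 <= q.1) \/
  (forall q, q \in s -> q.1 <= m).
Proof.
elim: s => [|a s [[p ps [mp hp]]|h]]; first by right.
  left; case: (boolP (m < a.1 < p.1)) => [/andP [ma ap]|h].
    exists a; rewrite ?inE ?eqxx //; split=> // q; rewrite inE => /orP [/eqP -> //|/hp h mq].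
    exact: leq_trans (ltnW ap) (h mq).
  exists p; rewrite ?inE ?ps ?orbT //; split=> // q; rewrite inE => /orP [/eqP -> ma|]; last exact: hp.
  by move: h; rewrite ma /= -leqNgt.
case: (ltnP m a.1) => ma; last by right=> q; rewrite inE => /orP [/eqP -> |/h].
left; exists a; rewrite ?inE ?eqxx //; split=> // q; rewrite inE => /orP [/eqP -> //|/h].
by rewrite leqNgt => /negPf ->.
Qed.

Lemma capP C u v : minn C u = minn C v <-> u = v \/ C <= u /\ C <= v.
Proof.
split=> [|[->//|[h1 h2]]]; last by rewrite (minn_idPl h1) (minn_idPl h2).
by case: (leqP C u) => h1; case: (leqP C v) => h2 e; [right|left; lia|left; lia|left].
Qed.

Definition near_eq C a b a' b' := (a - b = a' - b' \/ C <= a - b /\ C <= a' - b') /\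
  (b - a = b' - a' \/ C <= b - a /\ C <= b' - a').

Lemma near_below Q m p p' q q' : p <= m -> m - p < Q -> (q <= m -> q <= p) ->
  near_eq (Q + Q) p q p' q' -> near_eq Q m q (p' + (m - p)) q'.
Proof.
move=> h1 h2 h3 [h4 h5]; case: (leqP q p) => qp.
  by split; case: h4 => h4; case: h5 => h5; lia.
have {}h3 : m < q by rewrite ltnNge; apply/negP => /h3; lia.
by split; case: h4 => h4; case: h5 => h5; lia.
Qed.

Lemma near_above Q m b b' q q' : m < b -> b - m < Q -> b - m <= b' -> (q <= m - Q \/ b <= q) ->
  Q <= m -> near_eq (Q + Q) b q b' q' -> near_eq Q m q (b' - (b - m)) q'.
Proof.
move=> h1 h2 h3 h6 h7 [h4 h5]; case: h6 => h6.
  by split; case: h4 => h4; case: h5 => h5; lia.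
by split; case: h4 => h4; case: h5 => h5; lia.
Qed.

Lemma near_far Q m p p' q q' : p <= m -> Q <= m - p -> q <= p \/ m + Q <= q ->
  near_eq (Q + Q) p q p' q' -> near_eq Q m q (p' + Q) q'.
Proof.
move=> h1 h2 [h3|h3] [h4 h5].
  by split; case: h4 => h4; case: h5 => h5; lia.
by split; case: h4 => h4; case: h5 => h5; lia.
Qed.

(** A point closer than [Q] to its neighbour below, or else to the one above, keeps that distance;
    any other point goes exactly [Q] above the neighbour below, where the doubled accuracy leaves
    space. The pair [(0, 0)] guarantees a neighbour below. *)
Lemma place (s : seq (nat * nat)) Q m : 0 < Q -> (0, 0) \in s ->
  (forall p q, p \in s -> q \in s -> minn (Q + Q) (p.1 - q.1) = minn (Q + Q) (p.2 - q.2)) ->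
  exists m', (forall p, p \in s -> minn Q (m - p.1) = minn Q (m' - p.2) /\
      minn Q (p.1 - m) = minn Q (p.2 - m')) /\
    forall B, (forall p, p \in s -> p.2 <= B) -> m' <= B + Q.
Proof.
move=> Q0 s0 hs0.
have hs p q : p \in s -> q \in s -> near_eq (Q + Q) p.1 q.1 p.2 q.2.
  by move=> ps qs; split; apply/capP; apply: hs0.
suff [m' hm hB] : exists2 m', forall p, p \in s -> near_eq Q m p.1 m' p.2 &
    forall B, (forall p, p \in s -> p.2 <= B) -> m' <= B + Q.
  by exists m'; split=> // p /hm [h1 h2]; split; apply/capP.
have [p ps [pm hp]] := nearest_below m s0.
case: (ltnP (m - p.1) Q) => mp.
  exists (p.2 + (m - p.1)) => [q qs|B hB]; last by apply: leq_add (hB p ps) (ltnW mp).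
  exact: near_below pm mp (hp q qs) (hs p q ps qs).
have far : (forall q, q \in s -> q.1 <= p.1 \/ m + Q <= q.1) -> exists2 m',
    forall p, p \in s -> near_eq Q m p.1 m' p.2 & forall B, (forall p, p \in s -> p.2 <= B) -> m' <= B + Q.
  move=> h; exists (p.2 + Q) => [q qs|B hB]; last by rewrite leq_add2r hB.
  exact: near_far pm mp (h q qs) (hs p q ps qs).
case: (nearest_above s m) => [[b bs [mb hb]]|h]; last by apply: far => q qs; left; apply: hp => //; apply: h.
case: (ltnP (b.1 - m) Q) => bm; last first.
  apply: far => q qs; case: (leqP q.1 m) => qm; [by left; apply: hp|right].
  by have := hb q qs qm; clear -bm mb; lia.
have b2 : b.1 - m <= b.2.
  have [h1 _] := hs b (0, 0) bs s0; rewrite !subn0 in h1.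
  case: h1 => [<-|[_ h1]]; first exact: leq_subr.
  by apply: leq_trans (ltnW bm) (leq_trans (leq_addr _ _) h1).
exists (b.2 - (b.1 - m)) => [q qs|B hB]; last by have := hB b bs; clear; lia.
have mQ : Q <= m by clear -mp; lia.
apply: near_above mb bm b2 _ mQ (hs b q bs qs).
case: (leqP q.1 m) => qm; last by right; apply: hb.
by left; have := hp q qs qm; clear -mp pm; lia.
Qed.

Section Game.
Variable op : nat -> bool.

(* With [r] rounds to go, differences in coordinate [j + i] count only up to [2 ^ (r - i)], and only
   between elements with equal coordinates above [j + i]; above [j + r] only the order counts. *)
Fixpoint sim (A B : tower op) r j N (x : nat -> A) (y : nat -> B) : Prop :=
  match r with
  | 0 => forall i k, i < N -> k < N -> tl j (x i) (x k) = tl j (y i) (y k)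
  | r'.+1 => sim r' j.+1 N x y /\
      (forall i, i < N -> minn (2 ^ r) (tc j (x i)) = minn (2 ^ r) (tc j (y i))) /\
      forall i k, i < N -> k < N -> teq j.+1 (x i) (x k) ->
        minn (2 ^ r) (tc j (x i) - tc j (x k)) = minn (2 ^ r) (tc j (y i) - tc j (y k))
  end.

Lemma minn_pos Q a b : 0 < Q -> minn Q a = minn Q b -> (0 < a) = (0 < b).
Proof. by move=> hQ h; apply/idP/idP; lia. Qed.

Lemma sim_order (A B : tower op) r j N (x : nat -> A) (y : nat -> B) : sim r j N x y ->
  forall i k, i < N -> k < N -> tl j (x i) (x k) = tl j (y i) (y k).
Proof.
elim: r j => //= r IH j [h1 [_ h3]] i k hi hk.
have e := IH _ h1; rewrite !(tl_step j) (e i k) // (e k i) //.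
case h: (tl j.+1 (y i) (y k)) => //=; case h': (tl j.+1 (y k) (y i)) => //=.
have t : teq j.+1 (x k) (x i) by rewrite /teq !e // h h'.
have := minn_pos (expn_gt0 2 r.+1) (h3 k i hk hi t).
by rewrite !subn_gt0.
Qed.

Lemma sim_teq (A B : tower op) r j N (x : nat -> A) (y : nat -> B) : sim r j N x y ->
  forall i k, i < N -> k < N -> teq j (x i) (x k) = teq j (y i) (y k).
Proof. by move=> /sim_order e i k hi hk; rewrite /teq !e. Qed.

Lemma sim_sym (A B : tower op) r j N (x : nat -> A) (y : nat -> B) : sim r j N x y -> sim r j N y x.
Proof.
elim: r j => /= [|r IH] j; first by move=> h i k hi hk; rewrite h.
move=> [h1 [h2 h3]]; split; first exact: IH.
split=> [i hi|i k hi hk]; first by rewrite h2.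
by rewrite -(sim_teq h1) // => /h3 ->.
Qed.

Lemma sim_congr (A B : tower op) r j N (x : nat -> A) (y y' : nat -> B) :
  (forall i, i < N -> teq j (y i) (y' i)) -> sim r j N x y -> sim r j N x y'.
Proof.
elim: r j => /= [|r IH] j hy.
  move=> h i k hi hk; rewrite h //.
  by have [-> _] := teq_tl (y k) (hy i hi); have [_ ->] := teq_tl (y' i) (hy k hk).
have hy1 i : i < N -> teq j.+1 (y i) (y' i) /\ tc j (y i) = tc j (y' i).
  by move=> /hy; rewrite teqS => /andP [-> /eqP ->].
move=> [h1 [h2 h3]]; split; first by apply: IH h1 => i /hy1 [].
split=> [i hi|i k hi hk t]; first by rewrite h2 //; have [_ ->] := hy1 i hi.
by rewrite h3 //; have [_ ->] := hy1 i hi; have [_ ->] := hy1 k hk.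
Qed.

Lemma max_below (A : tower op) j N (x : nat -> A) (D : nat -> bool) z : z < N -> D z ->
  exists p, [/\ p < N, D p & forall i, i < N -> D i -> ~~ tl j (x p) (x i)].
Proof.
move=> zN Dz; have : forall M, M <= N -> exists p, [/\ p < N, D p & forall i, i < M -> D i -> ~~ tl j (x p) (x i)].
  elim=> [|M IH] MN; first by exists z.
  have [p [pN Dp hp]] := IH (ltnW MN).
  case: (boolP (D M && tl j (x p) (x M))) => [/andP [DM t]|h].
    exists M; split=> // i; rewrite ltnS leq_eqVlt => /orP [/eqP -> _|iM Di].
      by have /andP [] := teq_refl j (x M).
    by apply: contra (hp i iM Di) => t'; apply: tl_trans t t'.
  exists p; split=> // i; rewrite ltnS leq_eqVlt => /orP [/eqP -> DM|]; last exact: hp.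
  by move: h; rewrite DM.
by move/(_ N (leqnn N)).
Qed.

Section Extend.
Variables A B : tower op.
Variable K : nat.

Definition bnd_by M N (y : nat -> B) := forall i k, k < N -> tc i (y k) <= M /\ tsz i (y k) <= M.

Lemma iter_cpair_ge r M : M <= iter r (cpair (M + K)) M.
Proof. by elim: r => //= r IH; apply: leq_trans IH (leq_cpair_r _ _). Qed.

(** Coordinates are compared only between elements that agree above them, so [place] is applied to
    the class of [a], together with 0. *)
Lemma class_place j N (x : nat -> A) (y : nat -> B) (a : A) Q : 0 < Q ->
  (forall i, i < N -> minn (Q + Q) (tc j (x i)) = minn (Q + Q) (tc j (y i))) ->
  (forall i k, i < N -> k < N -> teq j.+1 (x i) (x k) ->
    minn (Q + Q) (tc j (x i) - tc j (x k)) = minn (Q + Q) (tc j (y i) - tc j (y k))) ->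
  exists m', [/\ minn Q (tc j a) = minn Q m',
    forall i, i < N -> teq j.+1 a (x i) ->
      minn Q (tc j a - tc j (x i)) = minn Q (m' - tc j (y i)) /\
      minn Q (tc j (x i) - tc j a) = minn Q (tc j (y i) - m') &
    forall M, bnd_by M N y -> m' <= M + Q].
Proof.
move=> Q0 h1 h2.
pose s := (0, 0) :: [seq (tc j (x i), tc j (y i)) | i <- iota 0 N & teq j.+1 a (x i)].
have sP p : p \in s -> p = (0, 0) \/ exists i, [/\ i < N, teq j.+1 a (x i) & p = (tc j (x i), tc j (y i))].
  rewrite inE => /orP [/eqP|/mapP [i]]; first by left.
  by rewrite mem_filter mem_iota => /andP [t /andP [_ hi]] ->; right; exists i.
have sI i : i < N -> teq j.+1 a (x i) -> (tc j (x i), tc j (y i)) \in s.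
  move=> hi t; rewrite inE; apply/orP; right; apply/mapP; exists i => //.
  by rewrite mem_filter t mem_iota.
have [|p q /sP hp /sP hq|m' [hm hb]] := @place s Q (tc j a) Q0; first by rewrite inE eqxx.
  case: hp => [->|[i [hi ti ->]]]; case: hq => [->|[k [hk tk ->]]] //=.
    by rewrite !subn0 h1.
  by apply: h2 => //; rewrite -(teq_teq _ ti).
exists m'; split=> [|i hi /(sI i hi) /hm [] //|M bM].
  by have [] := hm (0, 0); rewrite ?inE ?eqxx //= !subn0.
apply: hb => p /sP [->//|[i [hi _ ->]]] /=; by have [] := bM j i hi.
Qed.

(** One move of the game. The part above coordinate [j] is answered by induction, with one round
    less; then coordinate [j] is set by [class_place], with half the accuracy. Each step puts one
    coordinate in front, whence the iterated pairing in the bound. *)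
Lemma extend r j N (x : nat -> A) (y : nat -> B) z (a : A) : 2 ^ r <= K ->
  sim r.+1 j N x y -> z < N -> x z = tz -> y z = tz ->
  exists b, sim r j N.+1 (scons a x) (scons b y) /\
    forall M, bnd_by M N y -> tsz j b <= iter r.+1 (cpair (M + K)) M.
Proof.
elim: r j => [|r IH] j hK hs zN xz yz.
  have ord := sim_order hs; case: hs => ord1 [cap dist]; rewrite /= in ord1.
  case: (boolP (op j)) => oj; last first.
    exists (y z); split=> [i k _ _|M /(_ j z zN) [_ h]]; first by rewrite !closed_tl.
    exact: leq_trans h (iter_cpair_ge _ _).
  suff [b [hb hbM]] : exists b, (forall i, i < N -> tl j a (x i) = tl j b (y i) /\ tl j (x i) a = tl j (y i) b) /\
      forall M, bnd_by M N y -> tsz j b <= iter 1 (cpair (M + K)) M.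
    exists b; split=> // -[|i] [|k] //= hi hk.
    - by have /andP [/negPf -> _] := teq_refl j a; have /andP [/negPf -> _] := teq_refl j b.
    - by have [] := hb k hk.
    - by have [] := hb i hi.
    - exact: ord.
  (* With no round left only the order has to be preserved, and inside the class of [a] accuracy 1
     does that. *)
  case: (pselect (exists2 k, k < N & teq j.+1 a (x k))) => [[k hk tk]|no].
    have [m' [_ hm mM]] := class_place a (isT : 0 < 1) cap dist.
    have [b [tb cb sb]] := t_upd (y k) m' oj; rewrite -/(teq j.+1 (y k) b) in tb.
    exists b; split=> [i hi|M bM]; last first.
      apply: leq_trans sb _; apply: leq_cpair; last by have [] := bM j.+1 k hk.
      by apply: leq_trans (mM M bM) _; rewrite leq_add2l.
    have [a1 a2] := teq_tl (x i) tk; have [b1 b2] := teq_tl (y i) tb.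
    rewrite !(tl_step j) a1 a2 ord1 // ord1 // b1 b2 cb.
    case h: (tl j.+1 b (y i)) => /=; case h': (tl j.+1 (y i) b) => //=.
    have ti : teq j.+1 a (x i) by rewrite (teq_teq _ tk) /teq !ord1 // b1 b2 h h'.
    have [d1 d2] := hm i hi ti.
    by have := minn_pos (ltn0Sn 0) d1; have := minn_pos (ltn0Sn 0) d2; rewrite !subn_gt0 => -> ->.
  (* Here [a] opens a new class. The answer goes right after the greatest old element below, into
     that element's class, with a coordinate above all old ones; the zero [z] ensures that there is
     such an element. *)
  have below i : i < N -> tl j.+1 (x i) a = ~~ tl j.+1 a (x i).
    move=> hi; case h: (tl j.+1 (x i) a); first by have := tl_asym h => ->.
    case h': (tl j.+1 a (x i)) => //; case: no; exists i => //; by rewrite /teq h h'.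
  have zb : tl j.+1 (x z) a by rewrite below // xz tl_tz.
  have [p [pN pa pmax]] := max_below j x (D := fun i => tl j.+1 (x i) a) zN zb.
  have [b [tb cb sb]] := t_upd (y p) (\max_(i < N) tc j (y i)).+1 oj; rewrite -/(teq j.+1 (y p) b) in tb.
  have pb : tl j (y p) b.
    rewrite tl_step cb; move: tb => /andP [_ ->] /=; rewrite ltnS.
    by rewrite (leq_bigmax (Ordinal pN)) orbT.
  exists b; split=> [i hi|M bM]; last first.
    apply: leq_trans sb _; apply: leq_cpair; last by have [] := bM j.+1 p pN.
    have K0 : 0 < K := hK; suff : \max_(i < N) tc j (y i) <= M by lia.
    by apply/bigmax_leqP => i _; have [] := bM j i (ltn_ord i).
  case: (boolP (tl j.+1 (x i) a)) => h.
    have bi : tl j (y i) b.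
      by have := tl_ntrans (y i) pb; rewrite -ord // (negPf (pmax i hi h)).
    rewrite bi (negPf (tl_asym bi)) (tl_step j (x i)) h; split=> //.
    by apply/negbTE; apply: tl_asym; rewrite tl_step h.
  have h' : tl j.+1 a (x i) by move: h; rewrite below // negbK.
  have ib : tl j.+1 b (y i).
    by have [<- _] := teq_tl (y i) tb; rewrite -ord1 //; apply: tl_trans pa h'.
  have e1 : tl j a (x i) by rewrite tl_step h'.
  have e2 : tl j b (y i) by rewrite tl_step ib.
  by rewrite e1 e2 (negPf (tl_asym e1)) (negPf (tl_asym e2)).
case: hs => hs [cap dist].
have hK' : 2 ^ r <= K by apply: leq_trans hK; rewrite leq_exp2l.
have [b0 [hb0 bM0]] := IH j.+1 hK' hs zN xz yz.
have ee : 2 ^ r.+2 = 2 ^ r.+1 + 2 ^ r.+1 by rewrite expnS mul2n addnn.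
have red u v : minn (2 ^ r.+2) u = minn (2 ^ r.+2) v -> minn (2 ^ r.+1) u = minn (2 ^ r.+1) v.
  by rewrite ee => h; lia.
case: (boolP (op j)) => oj; last first.
  exists b0; split; last by move=> M bM; rewrite t_closed_sz.
  split; first exact: hb0.
  by split=> [i _|i k _ _ _]; rewrite !closed_tc.
have [m' [hm0 hm mM]] : exists m', [/\ minn (2 ^ r.+1) (tc j a) = minn (2 ^ r.+1) m',
    forall i, i < N -> teq j.+1 a (x i) ->
      minn (2 ^ r.+1) (tc j a - tc j (x i)) = minn (2 ^ r.+1) (m' - tc j (y i)) /\
      minn (2 ^ r.+1) (tc j (x i) - tc j a) = minn (2 ^ r.+1) (tc j (y i) - m') &
    forall M, bnd_by M N y -> m' <= M + 2 ^ r.+1].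
  by apply: class_place; rewrite ?expn_gt0 // -ee.
have [b [tb cb sb]] := t_upd b0 m' oj; rewrite -/(teq j.+1 b0 b) in tb.
exists b; split=> [|M bM]; last first.
  apply: leq_trans sb _; apply: leq_cpair; last exact: bM0.
  by apply: leq_trans (mM M bM) _; rewrite leq_add2l.
split; last split.
- by apply: sim_congr hb0 => -[|i] hi //=; apply: teq_refl.
- by case=> [|i] hi; [rewrite [scons a x _]/= [scons b y _]/= cb|apply: red; apply: cap].
- case=> [|i] [|k] hi hk; rewrite ?[scons _ _ 0]/= ?[scons a x _.+1]/= ?[scons b y _.+1]/= ?cb.
  + by rewrite !subnn.
  + by move=> t; case: (hm k hk t).
  + by rewrite teq_sym => t; case: (hm i hi t).
  + by move=> t; apply: red; apply: dist.
Qed.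
End Extend.
End Game.

(** * Ordinal levels and their codes *)

Section LevelTower.
Variable n : onat.
Hypothesis n0 : n <> ofin 0.

Definition levels := {x : on | `[< level n x >]}.
Definition lv (x : levels) : on := sval x.

Lemma lvP (x : levels) : level n (lv x).
Proof. by case: x => x h; apply/asboolP. Qed.

Lemma lv_nf x : nf (lv x). Proof. exact: level_nf (lvP x). Qed.

Definition to_level x (h : level n x) : levels := exist _ x (asboolT h).

Lemma olt_asym x y : olt x y -> ~~ olt y x.
Proof. by move=> h; apply/negP => h'; have := olt_trans h h'; rewrite olt_irr. Qed.

Lemma olt_ntrans x y z : olt x z -> olt x y || olt y z.
Proof.
move=> h; case/or3P: (olt_total x y) => [->//|/eqP <-|h']; first by rewrite h orbT.
by rewrite (olt_trans h' h) orbT.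
Qed.

Definition level_tower : tower (opened n).
apply: (@Tower (opened n) levels (fun j x y => olt (trunc j (lv x)) (trunc j (lv y)))
  (fun j x => cnt j (lv x)) (to_level (level_Z n)) (fun _ _ => 0)) => //=.
- by move=> j x y; apply: olt_asym.
- by move=> j x y z; apply: olt_ntrans.
- by move=> j x y; apply: trunc_step; apply: lv_nf.
- by move=> j x; case: (trunc j (lv x)).
- move=> j x m oj; exists (to_level (level_upd n0 m oj (lvP x))).
  by rewrite /= upd_trunc olt_irr upd_cnt // lv_nf.
- by move=> j x oj; rewrite (level_closed oj (lvP x)).
Defined.

Lemma level_tower_tl0 (x y : level_tower) : tl 0 x y = olt (lv x) (lv y).
Proof.
have h z : trunc 0 z = z by apply: trunc_id; elim: z => //= b _ a ->; rewrite ole_Z.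
by rewrite /= !h.
Qed.
End LevelTower.

(** * Numbers as codes of sequences with finitely many nonzero terms *)

Lemma csnd0 : csnd 0 = 0. Proof. by apply/eqP; rewrite -leqn0 leq_csnd. Qed.
Lemma cfst0 : cfst 0 = 0. Proof. by apply/eqP; rewrite -leqn0 leq_cfst. Qed.

(** Repeated second projections reach 0 and stay there, so every number codes a sequence that is
    eventually 0, with entry [cfst (cut j z)] at [j]. *)
Lemma csnd_ltn z : z <> 0 -> csnd z < z.
Proof.
move=> h; have e := cpairK z; rewrite -{2}e; case: (posnP (cfst z)) => [f0|]; last exact: ltn_cpair_r.
have : 0 < csnd z by rewrite lt0n; apply/eqP => s0; apply: h; rewrite -e f0 s0 cpairE.
by rewrite f0 cpairE; case: (csnd z) => //= m _; lia.
Qed.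

Section NatTower.
Variables (n : onat) (clt : nat -> nat -> bool).
Hypothesis cltE : forall z z', clt z z' = if z == z' then false else
  if csnd z == csnd z' then cfst z < cfst z' else clt (csnd z) (csnd z').

Lemma clt_irr z : clt z z = false.
Proof. by rewrite cltE eqxx. Qed.

(** The comparison passes to both tails at once; two different numbers are not both 0, so their sum
    decreases. *)
Lemma csnd_pair_ind (P : nat -> nat -> Prop) :
  (forall z z', (z <> z' -> P (csnd z) (csnd z')) -> P z z') -> forall z z', P z z'.
Proof.
move=> h z z'; have [m] := ubnP (z + z'); elim: m z z' => // m IH z z' zm; apply: h => zz'.
have := leq_csnd z; have := leq_csnd z'; case: (posnP z) => [ez|pz]; last first.
  by have := csnd_ltn (z := z); move=> *; apply: IH; lia.
by have := csnd_ltn (z := z'); move=> *; apply: IH; lia.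
Qed.

Lemma clt0 z : clt z 0 = false.
Proof.
elim/ltn_ind: z => z IH; rewrite cltE; case: eqP => // /csnd_ltn /IH.
by rewrite csnd0 cfst0 => ->; case: eqP.
Qed.

Lemma clt_total z z' : [|| clt z z', z == z' | clt z' z].
Proof.
move: z z'; apply: csnd_pair_ind => z z' IH; case: eqP => [->|/eqP zz']; first by rewrite !orbT.
have {}IH := IH (elimN eqP zz').
rewrite (cltE z) (cltE z') (eq_sym z' z) (negPf zz') (eq_sym (csnd z')); case: eqP IH => //= e _.
by case: ltngtP => // e'; case/eqP: zz'; rewrite -(cpairK z) -(cpairK z') e e'.
Qed.

Lemma clt_asym z z' : clt z z' -> ~~ clt z' z.
Proof.
move: z z'; apply: csnd_pair_ind => z z' IH; rewrite (cltE z) (cltE z') (eq_sym z' z) (eq_sym (csnd z')).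
by case: eqP IH => //= zz' /(_ zz'); case: eqP => // _ _; rewrite -leqNgt; apply: ltnW.
Qed.

Lemma clt_step z z' : clt z z' =
  clt (csnd z) (csnd z') || ~~ clt (csnd z') (csnd z) && (cfst z < cfst z').
Proof.
rewrite {1}cltE; case: eqP => [->|zz']; first by rewrite clt_irr ltnn.
case: eqP => [->|/eqP e]; first by rewrite clt_irr.
have := clt_total (csnd z) (csnd z'); rewrite (negPf e) /=.
case h: (clt (csnd z) (csnd z')) => //=; last by move=> ->.
Qed.

Lemma clt_lex z z' : clt z z' <-> clt (csnd z) (csnd z') \/ csnd z = csnd z' /\ cfst z < cfst z'.
Proof.
rewrite {1}cltE; case: eqP => [->|zz'].
  by rewrite clt_irr ltnn; split=> // -[|[]].
case: eqP => [->|e]; first by rewrite clt_irr; split=> [|[|[]]] //; right.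
by split=> [|[|[]]] //; left.
Qed.

Lemma clt_trans x y z : clt x y -> clt y z -> clt x z.
Proof.
have [m] := ubnP (x + y + z); elim: m x y z => // m IH x y z lt xy yz.
have x0 : y <> 0 by move=> e; move: xy; rewrite e clt0.
have z0 : z <> 0 by move=> e; move: yz; rewrite e clt0.
have := csnd_ltn x0; have := csnd_ltn z0; have := leq_csnd x => lx ly lz.
apply/clt_lex; move/clt_lex: xy => [h1|[e1 h1]]; move/clt_lex: yz => [h2|[e2 h2]].
- by left; apply: IH h1 h2; lia.
- by left; rewrite -e2.
- by left; rewrite e1.
- by right; rewrite e1 e2; split=> //; apply: ltn_trans h1 h2.
Qed.

Lemma clt_ntrans x y z : clt x z -> clt x y || clt y z.
Proof.
move=> h; case/or3P: (clt_total x y) => [->//|/eqP <-|h']; first by rewrite h orbT.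
by rewrite (clt_trans h' h) orbT.
Qed.

Definition cdom z := if n is ofin 1 then csnd z == 0 else true.
Definition cut j z := iter j csnd z.
Definition codes := {z | cdom z}.

Lemma cut0 j : cut j 0 = 0. Proof. by rewrite /cut; elim: j => //= j ->; rewrite csnd0. Qed.

Lemma leq_cut j z : cut j z <= z.
Proof. by elim: j => //= j; apply: leq_trans; apply: leq_csnd. Qed.

Lemma cdom0 : cdom 0. Proof. by rewrite /cdom csnd0; case: n => // -[|[]]. Qed.

Lemma cut_closed j (x : codes) : ~~ opened n j -> cut j (sval x) = 0.
Proof.
case: x => z; rewrite /cdom /opened; case: n => // -[|[|m]] //= /eqP h; case: j => // j _.
by rewrite /cut iterSr h; apply: cut0.
Qed.

Definition code_tower : tower (opened n).
apply: (@Tower (opened n) codes (fun j x y => clt (cut j (sval x)) (cut j (sval y)))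
  (fun j x => cfst (cut j (sval x))) (exist _ 0 cdom0) (fun j x => cut j (sval x))) => /=.
- by move=> j x y; apply: clt_asym.
- by move=> j x y z; apply: clt_ntrans.
- by move=> j x y; apply: clt_step.
- by move=> j x; rewrite cut0 clt0.
- by move=> j; rewrite cut0 cfst0.
(* Coordinates below [j] are set to 0. The size at [j] is [cut j], here the pair of [m] and the old
   higher part, so the required bound holds with equality. *)
- move=> j x m oj; have cutY : cut j (iter j (cpair 0) (cpair m (cut j.+1 (sval x)))) = cpair m (cut j.+1 (sval x)).
    by elim: j {oj} (cpair _ _) => // j IH w; rewrite {1}/cut iterSr /= csnd_cpair; apply: IH.
  have dY : cdom (iter j (cpair 0) (cpair m (cut j.+1 (sval x)))).
    case: x {cutY} => z; move: oj; rewrite /cdom /opened; case: n => // -[|[|k]] //= /eqP -> /eqP h.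
    by rewrite /= csnd_cpair h.
  exists (exist (fun z => is_true (cdom z)) _ dY); rewrite /= cutY csnd_cpair cfst_cpair clt_irr; split=> //.
- by move=> j x oj; rewrite cut_closed // cut0 clt_irr.
- by move=> j x; apply: cut_closed.
Defined.
End NatTower.

(** * Evaluation with bounded quantifiers *)

Lemma clt_ex : exists clt : nat -> nat -> bool, C2 clt /\ forall z z', clt z z' =
  if z == z' then false else if csnd z == csnd z' then cfst z < cfst z' else clt (csnd z) (csnd z').
Proof.
pose G (f : nat -> nat) p := if cfst p == csnd p then 0
  else if csnd (cfst p) == csnd (csnd p) then nat_of_bool (cfst (cfst p) < cfst (csnd p))
  else f (cpair (csnd (cfst p)) (csnd (csnd p))).
have [||F [FC FE]] := @rec1 G.
- by rewrite /G; ctac.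
- move=> p f f' ff'; rewrite /G; case: eqP => // n1; case: eqP => // n2; apply: ff'.
  rewrite -{3}(cpairK p); apply: ltn_cpair; try exact: leq_csnd.
  case: (cfst p =P 0) => [e|/csnd_ltn -> //]; rewrite orbC csnd_ltn // => e'.
  by apply: n1; rewrite e e'.
exists (fun z z' => 0 < F (cpair z z')); split=> [|z z']; first by ctac.
by rewrite FE /G !cfst_cpair !csnd_cpair; case: (z == z') => //; case: (csnd z == csnd z') => //; case: (cfst z < cfst z').
Qed.

Fixpoint qd f := match f with
  | PLe _ _ | PEq _ _ => 0
  | PNot a => qd a
  | PAnd a b | POr a b | PImp a b => maxn (qd a) (qd b)
  | PAll a | PEx a => (qd a).+1 end.

Lemma qd_code f : qd f <= pcode f.
Proof.
have bin c a b u v : a <= u -> b <= v -> maxn a b <= cpair c (cpair u v).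
  move=> h1 h2; apply: leq_trans (leq_cpair_r _ _); rewrite geq_max.
  by rewrite (leq_trans h1 (leq_cpair_l _ _)) (leq_trans h2 (leq_cpair_r _ _)).
elim: f => //= [f IH|f If g Ig|f If g Ig|f If g Ig|f IH|f IH]; try exact: bin.
- by apply: leq_trans IH (leq_cpair_r _ _).
- by apply: leq_ltn_trans IH (ltn_cpair_r _ _).
- by apply: leq_ltn_trans IH (ltn_cpair_r _ _).
Qed.

Definition pow2 R := nat_rect (fun=> nat) 1 (fun _ a => a + a) R.
(** The bound of [extend] with accuracy constant [K = 2 ^ R], as a computable function. *)
Definition grow R B := nat_rect (fun=> nat) B (fun _ a => cpair (B + pow2 R) a) R.

Lemma growE R B : grow R B = iter R (cpair (B + 2 ^ R)) B.
Proof.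
have -> : 2 ^ R = pow2 R by elim: R => //= R <-; rewrite expnS mul2n addnn.
by rewrite /grow; move: (pow2 R) => K; elim: R => //= m ->.
Qed.

Lemma bex_ext p q m : (forall i, i < m -> p i = q i) -> bex p m = bex q m.
Proof. by move=> h; apply/bexP/bexP => -[i lt]; rewrite ?h // -?h //; exists i; rewrite ?h // -?h. Qed.

Lemma leq_grow R B : B <= grow R B.
Proof. by rewrite growE; apply: iter_cpair_ge. Qed.

Section Eval.
Variables (n : onat) (clt : nat -> nat -> bool).
Hypothesis n0 : n <> ofin 0.
Hypothesis cltE : forall z z', clt z z' = if z == z' then false else
  if csnd z == csnd z' then cfst z < cfst z' else clt (csnd z) (csnd z').
Hypothesis cltC : C2 clt.

(* [cpair s z] stands for the pair of the element coded by [z] and the sign number [s]. *)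
Definition vcode w := [&& cfst w < 3, csnd w != 0 & cdom n (csnd w)].
Definition cle w w' := clt (csnd w) (csnd w') ||
  (csnd w == csnd w') && ((cfst w == cfst w') || (cfst w' == 2)).
Definition sg s : sgn := (s != 1, s != 0).

(** The parameter [d] packs the number [R] of rounds left, a bound [B] on the codes chosen so far
    and the list [e] of chosen elements. Quantifiers search codes up to [grow R B] with sign numbers
    at most 2, hence the limit [cpair 2 (grow R B)]. *)
Definition pgG (h : nat -> nat -> nat) c d :=
  let R := cfst d in let B := cfst (csnd d) in let e := csnd (csnd d) in
  let i := cfst (csnd c) in let j := csnd (csnd c) in
  if cfst c == 0 then nat_of_bool (cle (cnth e i) (cnth e j))
  else if cfst c == 1 then nat_of_bool (cle (cnth e i) (cnth e j) && cle (cnth e j) (cnth e i))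
  else if cfst c == 2 then nat_of_bool (h (csnd c) d == 0)
  else if cfst c == 3 then nat_of_bool ((0 < h i d) && (0 < h j d))
  else if cfst c == 4 then nat_of_bool ((0 < h i d) || (0 < h j d))
  else if cfst c == 5 then nat_of_bool ((h i d == 0) || (0 < h j d))
  else if cfst c == 6 then nat_of_bool (~~ bex (fun w => vcode w && (csnd w <= grow R B) &&
    (h (csnd c) (cpair R.-1 (cpair (grow R B) (cpair w e))) == 0)) (cpair 2 (grow R B)).+1)
  else nat_of_bool (bex (fun w => vcode w && (csnd w <= grow R B) &&
    (0 < h (csnd c) (cpair R.-1 (cpair (grow R B) (cpair w e))))) (cpair 2 (grow R B)).+1).

Lemma C_cdom : C1 (cdom n).
Proof. by rewrite /cdom; case: n => [[|[|m]]|]; ctac. Qed.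

Lemma pg_ex : exists F, C2 F /\ forall c d, F c d = pgG F c d.
Proof.
have h1 : C2 grow by rewrite /grow /pow2; ctac.
have h2 : C2 cle by rewrite /cle; ctac.
have h3 := C_cdom; have h4 : C1 vcode by rewrite /vcode; ctac.
apply: (rec2 (bnd := fun d => cpair (cfst d) (cpair (grow (cfst d) (cfst (csnd d)))
  (cpair (cpair 2 (grow (cfst d) (cfst (csnd d)))) (csnd (csnd d)))))).
- by rewrite /pgG; cbv zeta; ctacb.
- by ctac.
- move=> c d f f' ff'; rewrite /pgG; cbv zeta; case: (posnP (cfst c)) => // c0.
  have [l1 [l2 l3]] : [/\ csnd c < c, cfst (csnd c) < c & csnd (csnd c) < c].
    have lt := ltn_csnd c0; split=> //; [apply: leq_ltn_trans (leq_cfst _) lt|apply: leq_ltn_trans (leq_csnd _) lt].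
  set R := cfst d in ff' *; set B := cfst (csnd d) in ff' *; set e := csnd (csnd d) in ff' *.
  have dle : d <= cpair R (cpair (grow R B) (cpair (cpair 2 (grow R B)) e)).
    rewrite -{1}(cpairK d) -(cpairK (csnd d)); apply: leq_cpair => //; apply: leq_cpair; last exact: leq_cpair_r.
    exact: leq_grow.
  rewrite !(ff' _ d) //.
  have wle w : w < (cpair 2 (grow R B)).+1 -> f (csnd c) (cpair R.-1 (cpair (grow R B) (cpair w e))) =
      f' (csnd c) (cpair R.-1 (cpair (grow R B) (cpair w e))).
    by move=> lt; apply: ff' => //; do !apply: leq_cpair => //; apply: leq_pred.
  do 5 (case: (cfst c == _) => //).
  by case: (cfst c == 6); congr nat_of_bool; [congr negb|]; apply: bex_ext => w /wle ->.
Qed.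

Variables (F : nat -> nat -> nat) (FE : forall c d, F c d = pgG F c d).

Notation LT := (level_tower n0).
Notation CT := (code_tower n cltE).

(* The game position after [N] moves: the two sides have the same order type up to the number [R] of
   remaining moves. The last component [N] is the zero of both towers. *)
Definition matched N R B e (r : nat -> pst 2 n) := exists (x : nat -> LT) (y : nat -> CT),
  [/\ x N = tz, y N = tz, sim R 0 N.+1 x y & forall i, i < N ->
    [/\ lv (x i) = (val (sval (r i))).1, sval (y i) = csnd (cnth e i), csnd (cnth e i) <= B,
       cfst (cnth e i) < 3 & (val (sval (r i))).2 = sg (cfst (cnth e i))]].

Lemma pst_okn (u : pst 2 n) : okn 2 n (sval u). Proof. by case/andP: (svalP u). Qed.

Lemma pst_val (u : pst 2 n) : (val (sval u)).1 <> Z /\ (val (sval u)).2 <> (false, false).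
Proof.
have ok := pst_okn u; have [v _] := val_valid ok (leqnn 2); case/andP: (svalP u) => _.
rewrite (fle_val ok (okn_E _ _)) /vle /=; move: v; rewrite /valid_v.
by case: (val (sval u)) => [[|b a] [[] []]].
Qed.

Lemma code_tl0 (y y' : CT) : tl 0 y y' = clt (sval y) (sval y'). Proof. by []. Qed.

Lemma matched_le N R B e r i j : matched N R B e r -> i < N -> j < N ->
  (pst_le (r i) (r j) <-> cle (cnth e i) (cnth e j)).
Proof.
move=> [x [y [_ _ s h]]] iN jN; have [xi yi _ si sgi] := h i iN; have [xj yj _ sj sgj] := h j jN.
have o := sim_order s (ltnW iN : i < N.+1) (ltnW jN : j < N.+1).
have o' := sim_order s (ltnW jN : j < N.+1) (ltnW iN : i < N.+1).
move: o o'; rewrite !level_tower_tl0 !code_tl0 xi xj yi yj => o o'.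
rewrite /pst_le (fle_val (pst_okn _) (pst_okn _)) /vle /cle o.
have -> : ((val (sval (r i))).1 == (val (sval (r j))).1) = (csnd (cnth e i) == csnd (cnth e j)).
  apply/eqP/eqP => e1.
    have := clt_total cltE (csnd (cnth e i)) (csnd (cnth e j)).
    by rewrite -o -o' e1 olt_irr orbF => /eqP.
  have := olt_total (val (sval (r i))).1 (val (sval (r j))).1.
  by rewrite o o' e1 clt_irr // orbF => /eqP.
rewrite sgi sgj; move: (cfst _) (cfst _) si sj.
by case=> [|[|[|//]]] // [|[|[|//]]].
Qed.

Lemma sim_zeros (op : nat -> bool) (A A' : tower op) R j (x : nat -> A) (y : nat -> A') :
  x 0 = tz -> y 0 = tz -> sim R j 1 x y.
Proof.
move=> x0 y0; elim: R j => [|R IH] j /=.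
  by case=> [|//] [|//] _ _; rewrite x0 y0 (negPf (tl_tz _ _)) (negPf (tl_tz _ _)).
by split=> //; split=> [[|//]|[|//] [|//]] *; rewrite x0 y0 !tc_tz.
Qed.

Lemma matched0 R (r : nat -> pst 2 n) : matched 0 R 0 0 r.
Proof. by exists (fun=> tz), (fun=> tz); split=> //; apply: sim_zeros. Qed.

Lemma bnd_codes N B (y : nat -> CT) : (forall k, k < N -> sval (y k) <= B) -> bnd_by B N y.
Proof.
move=> h i k /h le; have lc : cut i (sval (y k)) <= B by apply: leq_trans (leq_cut _ _) le.
by split=> //; apply: leq_trans (leq_cfst _) lc.
Qed.

Lemma matched_scons N R B B' e r (x : nat -> LT) (y : nat -> CT) (a : LT) (b : CT) u w :
  x N = tz -> y N = tz -> sim R 0 N.+2 (scons a x) (scons b y) -> B <= B' ->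
  (forall i, i < N ->
    [/\ lv (x i) = (val (sval (r i))).1, sval (y i) = csnd (cnth e i), csnd (cnth e i) <= B,
       cfst (cnth e i) < 3 & (val (sval (r i))).2 = sg (cfst (cnth e i))]) ->
  [/\ lv a = (val (sval u)).1, sval b = csnd w, csnd w <= B', cfst w < 3 & (val (sval u)).2 = sg (cfst w)] ->
  matched N.+1 R B' (cpair w e) (scons u r).
Proof.
move=> xz yz s BB h hu; exists (scons a x), (scons b y); split=> // -[_|i iN]; first by rewrite cnth0.
by rewrite cnthS /=; have [? ? le ? ?] := h i iN; split=> //; apply: leq_trans le BB.
Qed.

Lemma sim_last N R (x : nat -> LT) (y : nat -> CT) (a : LT) (b : CT) : x N = tz -> y N = tz ->
  sim R 0 N.+2 (scons a x) (scons b y) -> (lv a == Z) = (sval b == 0).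
Proof.
move=> xz yz s; have := sim_order s (ltnSn N.+1) (ltn0Sn N.+1).
rewrite level_tower_tl0 code_tl0 [scons a x N.+1]/= [scons b y N.+1]/= xz yz /= => o.
apply/eqP/eqP => e.
  by move: o; rewrite e /= => /esym h; have := clt_total cltE 0 (sval b); rewrite h clt0 // orbF => /eqP.
by move: o; rewrite e clt_irr //; case: (lv a).
Qed.

(** The ordinal of [u] is answered by [extend] within the bound that [pgG] searches; its signs are
    copied. *)
Lemma matched_code N R B e r (u : pst 2 n) : matched N R.+1 B e r -> exists w,
  [/\ vcode w, csnd w <= grow R.+1 B & matched N.+1 R (grow R.+1 B) (cpair w e) (scons u r)].
Proof.
move=> [x [y [xz yz s h]]].
have lu : level n (val (sval u)).1 by exists (sval u) => //; apply: pst_okn.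
have hB : bnd_by B N.+1 y.
  apply: bnd_codes => k; rewrite ltnS leq_eqVlt => /orP [/eqP ->|/h [_ -> //]].
  by rewrite yz.
have [|b [sb /(_ B hB) lb]] := @extend _ _ _ (2 ^ R.+1) R 0 N.+1 x y N (to_level lu) _ s (ltnSn N) xz yz.
  by rewrite leq_exp2l.
rewrite -growE in lb.
have [c [c3 cE]] : exists c, c < 3 /\ (val (sval u)).2 = sg c.
  have [_] := pst_val u; case: (val (sval u)).2 => -[] [] //= _; by [exists 2|exists 0|exists 1].
have [uZ _] := pst_val u; exists (cpair c (sval b)).
have lb' : sval b <= grow R.+1 B by [].
split; rewrite /vcode ?csnd_cpair ?cfst_cpair ?c3 //.
  by rewrite -(sim_last xz yz sb); move/eqP: uZ => /= -> /=; apply: (svalP b).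
by apply: matched_scons xz yz sb (leq_grow _ _) h _; rewrite csnd_cpair cfst_cpair.
Qed.

Lemma matched_elt N R B e r w : matched N R.+1 B e r -> vcode w -> csnd w <= grow R.+1 B ->
  exists u, matched N.+1 R (grow R.+1 B) (cpair w e) (scons u r).
Proof.
move=> [x [y [xz yz s h]]] /and3P [w3 w0 dw] wB; pose b : CT := exist (fun z => is_true (cdom n z)) _ dw.
have [|a [sa _]] := @extend _ _ _ (2 ^ R.+1) R 0 N.+1 y x N b _ (sim_sym s) (ltnSn N) yz xz.
  by rewrite leq_exp2l.
have {}sa := sim_sym sa.
have aZ : lv a <> Z by apply/eqP; rewrite (sim_last xz yz sa).
have [|f ok ef] := @level_signs n (lv a) (sg (cfst w)) (lvP a) aZ.
  by case: (cfst w) w3 => [|[|[|]]].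
have hf : okn 2 n f && ~~ fle f E.
  rewrite ok (fle_val ok (okn_E _ _)) ef /vle /=.
  by move: aZ; case: (lv a) => // p q _ /=.
by exists (Pst hf); apply: matched_scons xz yz sa (leq_grow _ _) h _; rewrite /= ef.
Qed.

Lemma evalP f N R B e r : qd f <= R -> pbound N f -> matched N R B e r ->
  (0 < F (pcode f) (cpair R (cpair B e)) <-> gsat (@pst_le 2 n) r f).
Proof.
have FEc c a d : F (cpair c a) d = pgG F (cpair c a) d by [].
elim: f N R B e r => [i j|i j|f IH|f If g Ig|f If g Ig|f If g Ig|f IH|f IH] N R B e r;
  rewrite [pcode _]/= FEc /pgG !cfst_cpair !csnd_cpair ?cfst_cpair /=.
- by move=> _ [iN jN] m; rewrite (matched_le m iN jN); case: (cle _ _).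
- move=> _ [iN jN] m; rewrite (matched_le m iN jN) (matched_le m jN iN).
  by case: (cle _ _); case: (cle _ _); split=> // -[].
- move=> q b m; rewrite -(IH N R B e r q b m).
  by move: (F _ _) => v; split=> [|h]; [case: v|case: v h => // v []].
- rewrite geq_max => /andP [q1 q2] [b1 b2] m; rewrite -(If N R B e r q1 b1 m) -(Ig N R B e r q2 b2 m).
  by rewrite lt0b; split=> /andP.
- rewrite geq_max => /andP [q1 q2] [b1 b2] m; rewrite -(If N R B e r q1 b1 m) -(Ig N R B e r q2 b2 m).
  by rewrite lt0b; split=> /orP.
- rewrite geq_max => /andP [q1 q2] [b1 b2] m; rewrite -(If N R B e r q1 b1 m) -(Ig N R B e r q2 b2 m).
  by rewrite lt0b -leqn0 leqNgt -implybE; split=> /implyP.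
- case: R => // R; rewrite ltnS => q b m; split=> [h u|h].
    have [w [vw wB m']] := matched_code u m; apply/(IH _ _ _ _ _ q b m').
    move: h; case: bexP => //= no _; rewrite lt0n; apply/eqP => e0; apply: no; exists w.
      by rewrite ltnS -(cpairK w); apply: leq_cpair => //; case/and3P: vw.
    by rewrite vw wB e0.
  case: bexP => //= -[w _ /andP [/andP [vw wB] /eqP e0]].
  by have [u m'] := matched_elt m vw wB; have /(IH _ _ _ _ _ q b m') := h u; rewrite e0.
- case: R => // R; rewrite ltnS => q b m; split=> [|[u h]].
    case: bexP => //= -[w _ /andP [/andP [vw wB] h]] _.
    by have [u m'] := matched_elt m vw wB; exists u; apply/(IH _ _ _ _ _ q b m').
  have [w [vw wB m']] := matched_code u m.
  case: bexP => // -[]; exists w; last by rewrite vw wB; apply/(IH _ _ _ _ _ q b m').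
  by rewrite ltnS -(cpairK w); apply: leq_cpair => //; case/and3P: vw.
Qed.
End Eval.

Lemma decidable_part n : n <> ofin 0 -> decidable_set (Th_poset (@FFk_le 2 n)).
Proof.
move=> n0; have [clt [cltC cltE]] := clt_ex; have [F [FC FE]] := pg_ex n cltC.
have [b [bC bE]] := closed_pform_C1.
(* The code of a sentence bounds its quantifier depth and serves as the number of rounds; the bound
   0 and the empty list are together coded by [cpair 0 0 = 0]. *)
apply: (@decidable_C1 _ (fun c => b c && (0 < F c (cpair c 0)))); first by ctac.
move=> c; have [u0 _] : exists u : pst 2 n, True.
  have h : okn 2 n (L 0) && ~~ fle (L 0) E by rewrite /okn; case: (n).
  by exists (Pst h).
have ev f : pbound 0 f -> (0 < F (pcode f) (cpair (pcode f) 0) <-> Th_poset (@FFk_le 2 n) (pcode f)).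
  move=> hf; rewrite (Th_posetE (fun=> u0) hf) -(evalP FE (qd_code f) hf (matched0 n0 cltE _ _)).
  by have -> : cpair 0 0 = 0 by rewrite cpairE.
split=> [h|/andP [/bE [f hf <-]]]; last by move/(ev f hf).
have [f [hf [e _]]] := h; apply/andP; split; first by apply/bE; exists f.
by move: h; rewrite -e => /(ev f hf).
Qed.

Theorem theorem3p3 (k : nat) (n : onat) :
  2 <= k -> n <> ofin 0 ->
  (k = 2 -> decidable_set (Th_poset (@FFk_le k n))) /\
  (k <> 2 ->
     ~ decidable_set (Th_poset (@FFk_le k n)) /\
     comp_iso (Th_poset (@FFk_le k n)) Th_arith).
Proof.
move=> k2 n0; split=> [->|kn2]; first exact: decidable_part.
by apply: undecidable_part n0; rewrite ltn_neqAle k2 andbT; apply/eqP => e; apply: kn2.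
Qed.
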